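(* For every $\boldsymbol\lambda=(\lambda^{(1)},\dots,\lambda^{(L)})\in[0,\infty)^L$, $$\lim_{n\to\infty}F_n(\boldsymbol\lambda)=\frac{\sum_{l=1}^L\lambda^{(l)}}{4}+\sup_{\mathbf q\in[0,\infty)^L}\left[\mathcal F(\boldsymbol\lambda,\mathbf q)-\sum_{l=1}^L\frac{\lambda^{(l)}(q_l^2+2q_l)}{4}\right].$$
   Context: Fix integers $L\ge 1$, $L_1\ge 0$ and a space $\mathcal Z$ of side information. Let $p(x,y,z)$ be a probability distribution on $\{\pm1\}^L\times\{\pm1\}^{L_1}\times\mathcal Z$ such that every single coordinate $x^{(l)}$ ($1\le l\le L$) and $y^{(l_1)}$ ($1\le l_1\le L_1$) is marginally uniform on $\{\pm1\}$; $p(x,y|z)$ is the conditional probability mass function of $(x,y)$ given $z$. For each $n$ let $(X_i,Y_i,Z_i)$, $1\le i\le n$, be i.i.d. from $p$, with $X_i=(X_i^{(1)},\dots,X_i^{(L)})$. Spiked Gaussian model: for $l=1,\dots,L$, $\mathbf A^{(l)}=\sqrt{\lambda^{(l)}/n}\,\mathbf X^{(l)}\mathbf X^{(l)\top}+\mathbf W^{(l)}$, where $\mathbf X^{(l)}=(X_1^{(l)},\dots,X_n^{(l)})^\top$ and $\mathbf W^{(1)},\dots,\mathbf W^{(L)}$ are independent symmetric matrices, independent of all $(X_i,Y_i,Z_i)$, with independent entries $W^{(l)}_{i,j}\sim\mathcal N(0,1+\mathbf 1\{i=j\})$ for $i\le j$. For $\mathbf x\in\{\pm1\}^{n\times L}$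 (rows $x_i$) and $\mathbf y\in\{\pm1\}^{n\times L_1}$ (rows $y_i$) put $$H(\mathbf x)=\sum_{l=1}^L\sum_{1\le i<j\le n}\sqrt{\tfrac{\lambda^{(l)}}{n}}A^{(l)}_{i,j}x_i^{(l)}x_j^{(l)},\qquad Z_n(\boldsymbol\lambda)=\sum_{\mathbf x,\mathbf y}\prod_{i=1}^np(x_i,y_i|Z_i)\,e^{H(\mathbf x)},\qquad F_n(\boldsymbol\lambda)=\frac1n\mathbb E\log Z_n(\boldsymbol\lambda).$$ The scalar free energy is $$\mathcal F(\boldsymbol\lambda,\mathbf q)=\mathbb E\log\Big(\sum_{x,y}p(x,y|Z)\exp\Big(\sum_{l=1}^L\lambda^{(l)}q_lX^{(l)}x^{(l)}+\sqrt{\lambda^{(l)}q_l}\,W^{(l)\prime}x^{(l)}\Big)\Big),$$ where $(X,Y,Z)\sim p$ and $W^{(1)\prime},\dots,W^{(L)\prime}$ are i.i.d. $\mathcal N(0,1)$ independent of $(X,Y,Z)$. *)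

(* Defs.v *)
From HB Require Import structures.
From mathcomp Require Import all_boot all_order all_algebra.
From mathcomp Require Import all_classical all_reals all_analysis.

Set Implicit Arguments.
Unset Strict Implicit.
Unset Printing Implicit Defensive.

Import Order.TTheory GRing.Theory Num.Theory.
Import numFieldNormedType.Exports.

Local Open Scope classical_set_scope.
Local Open Scope ring_scope.

Section Independence.
Context d (T : measurableType d) (R : realType) (P : probability T R).

Definition mutually_independent (I : finType) (F : I -> set_system T) : Prop :=
  forall A : I -> set T, (forall i, F i (A i)) ->
  forall J : {set I},
    P (\bigcap_(i in [set` J]) A i) = (\prod_(i in J) P (A i))%E.

Definition sigma_of d' (T' : measurableType d') (X : {RV P >-> T'})
    : set_system T :=
  preimage_set_system setT X measurable.

(* Equality is required on measurable sets only: off the sigma-algebra the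
   values of a measure are junk. *)
Definition has_law d' (T' : measurableType d') (X : {RV P >-> T'})
    (mu : set T' -> \bar R) : Prop :=
  forall B, measurable B -> distribution P X B = mu B.

End Independence.

(* {+1,-1}^L is encoded as L.-tuple bool, which carries the product (here:
   discrete) sigma-algebra; a bit b stands for the sign (-1)^b. *)
Definition spin (R : realType) (L : nat) (x : L.-tuple bool) (l : 'I_L) : R :=
  (-1) ^+ tnth x l.

Section SideInformation.
Context (R : realType) (L L1 : nat) (dZ : measure_display)
  (Zs : measurableType dZ).

Notation sample := (L.-tuple bool * L1.-tuple bool * Zs)%type.

Definition uniform_coordinates (p : probability sample R) : Prop :=
  (forall (l : 'I_L) (b : bool),
     p [set t | tnth t.1.1 l = b] = (2^-1 : R)%:E) /\
  (forall (l1 : 'I_L1) (b : bool),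
     p [set t | tnth t.1.2 l1 = b] = (2^-1 : R)%:E).

(* [pc z x y] is a version of the conditional probability p(x, y | z). *)
Record is_cond_pmf (p : probability sample R)
    (pc : Zs -> L.-tuple bool -> L1.-tuple bool -> R) : Prop := IsCondPmf {
  cond_pmf_measurable : forall x y, measurable_fun setT (fun z => pc z x y) ;
  cond_pmf_ge0 : forall z x y, 0 <= pc z x y ;
  cond_pmf_sum1 : forall z, \sum_x \sum_y pc z x y = 1 ;
  cond_pmf_disintegration : forall x y (B : set Zs), measurable B ->
    p [set t | t.1 = (x, y) /\ B t.2] =
    (\int[p]_(t in [set t | B t.2]) (pc t.2 x y)%:E)%E }.

Section SpikedModel.
Context (d : measure_display) (Omega : measurableType d)
  (P : probability Omega R) (n : nat).

(* Indices of the independent sources of randomness: the n samples and the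
   entries W^(l)_{i,j} with i <= j. *)
Definition source : finType :=
  ('I_n + 'I_L * {ij : 'I_n * 'I_n | (ij.1 <= ij.2)%N})%type.

Definition source_sigma (S : 'I_n -> {RV P >-> sample})
    (W : 'I_L -> 'I_n -> 'I_n -> {RV P >-> R}) (s : source)
    : set_system Omega :=
  match s with
  | inl i => sigma_of (S i)
  | inr (l, ij) => sigma_of (W l (val ij).1 (val ij).2)
  end.

(* [normal_prob m s] is parametrized by the standard deviation s. *)
Record is_spiked_model (p : probability sample R)
    (S : 'I_n -> {RV P >-> sample})
    (W : 'I_L -> 'I_n -> 'I_n -> {RV P >-> R}) : Prop := IsSpikedModel {
  spiked_sample_law : forall i, has_law (S i) p ;
  spiked_noise_law : forall l (i j : 'I_n), (i <= j)%N ->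
    has_law (W l i j) (normal_prob 0 (Num.sqrt (1 + (i == j)%:R))) ;
  spiked_noise_sym : forall l i j w, W l i j w = W l j i w ;
  spiked_independent : mutually_independent P (source_sigma S W) }.

Definition observation (lam : 'I_L -> R) (S : 'I_n -> {RV P >-> sample})
    (W : 'I_L -> 'I_n -> 'I_n -> {RV P >-> R}) (w : Omega) (l : 'I_L)
    : 'M[R]_n :=
  let X : 'cV[R]_n := \col_i spin R (S i w).1.1 l in
  Num.sqrt (lam l / n%:R) *: (X *m X^T) + \matrix_(i, j) W l i j w.

Definition hamiltonian (lam : 'I_L -> R) (A : 'I_L -> 'M[R]_n)
    (x : {ffun 'I_n -> L.-tuple bool}) : R :=
  \sum_(l < L) \sum_(i < n) \sum_(j < n | (i < j)%N)
    Num.sqrt (lam l / n%:R) * A l i j * spin R (x i) l * spin R (x j) l.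

Definition partition_function
    (pc : Zs -> L.-tuple bool -> L1.-tuple bool -> R) (lam : 'I_L -> R)
    (A : 'I_L -> 'M[R]_n) (z : 'I_n -> Zs) : R :=
  \sum_(x : {ffun 'I_n -> L.-tuple bool})
  \sum_(y : {ffun 'I_n -> L1.-tuple bool})
    (\prod_(i < n) pc (z i) (x i) (y i)) * expR (hamiltonian lam A x).

Definition free_energy (pc : Zs -> L.-tuple bool -> L1.-tuple bool -> R)
    (S : 'I_n -> {RV P >-> sample})
    (W : 'I_L -> 'I_n -> 'I_n -> {RV P >-> R}) (lam : 'I_L -> R) : \bar R :=
  ((n%:R^-1 : R)%:E * 'E_P[fun w =>
    ln (partition_function pc lam (observation lam S W w)
          (fun i => (S i w).2))])%E.

End SpikedModel.

Section ScalarModel.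
Context (d : measure_display) (Omega : measurableType d)
  (P : probability Omega R).

Definition scalar_source_sigma (S : {RV P >-> sample})
    (G : 'I_L -> {RV P >-> R}) (s : option 'I_L) : set_system Omega :=
  if s is Some l then sigma_of (G l) else sigma_of S.

Record is_scalar_model (p : probability sample R) (S : {RV P >-> sample})
    (G : 'I_L -> {RV P >-> R}) : Prop := IsScalarModel {
  scalar_sample_law : has_law S p ;
  scalar_noise_law : forall l, has_law (G l) (normal_prob 0 1) ;
  scalar_independent : mutually_independent P (scalar_source_sigma S G) }.

Definition scalar_free_energy
    (pc : Zs -> L.-tuple bool -> L1.-tuple bool -> R)
    (S : {RV P >-> sample}) (G : 'I_L -> {RV P >-> R})
    (lam q : 'I_L -> R) : \bar R :=
  'E_P[fun w =>
    ln (\sum_x \sum_y pc (S w).2 x y *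
      expR (\sum_(l < L)
        (lam l * q l * spin R (S w).1.1 l * spin R x l
         + Num.sqrt (lam l * q l) * G l w * spin R x l)))]%E.

End ScalarModel.

End SideInformation.

(* Main.v *)
(* Write the partition function, up to a deterministic factor, as
   Zt = sum_x v(x) exp(h(x, X) + noise(x)), and study the moments E[Zt^a] for a
   close to 0 instead of E[log Zt].  For 0 < t < 1 Kahane's inequality compares
   E[(sum_x v(x) exp(g(x) - Var g(x) / 2))^t] for two centred Gaussian fields g with
   ordered covariances.  It is applied to the pair field, of covariance
   sum_l lam_l (R_l^2 - n) / (2 n), R_l being n times the overlap of two replicas,
   and to independent fields on the sites, of covariance sum_l lam_l q_l R_l,
   corrected by constants completing the square R_l^2 - 2 n q_l R_l + n^2 q_l^2 >= 0.
   - For the exponent - t, the Nishimori identity (Bayes' rule together with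
     Cameron-Martin) rewrites the planted moment as an unplanted one of order
     1 - t; the site model then factorizes, which gives the lower bound of the
     limit for every q.
   - For the exponent t, the signal R_l(x, X)^2 is linearized exactly at the grid
     value m = R_l / n; by subadditivity of the power t the sum over the (n+1)^L grid
     points goes outside, and for each of them the comparison applies to the noise
     alone.  A further sign argument replaces m by |m|.
   Letting t tend to 0 with n, the moments give E[log Zt]. *)
Require Import Defs.
From HB Require Import structures.
From mathcomp Require Import all_boot all_order all_algebra.
From mathcomp Require Import all_classical all_reals all_analysis.
From mathcomp Require Import measurable_realfun ring lra.
Import Order.TTheory GRing.Theory Num.Theory.
Import numFieldNormedType.Exports.
Set Implicit Arguments. Unset Strict Implicit. Unset Printing Implicit Defensive.
Local Open Scope classical_set_scope.
Local Open Scope ring_scope.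

(** * Gaussian integrals *)

(** Every estimate is an upper bound on a moment, because the comparison works in one direction
    only: the site covariance never exceeds the pair covariance plus a constant, and for a power of
    order in (0, 1), which is concave, a larger covariance gives a smaller moment. An upper bound on
    the moment of order [- t] bounds E[log Zt] from below, one of order [t] bounds it from above,
    both by Jensen. The obstacle lies in order [t]: Bayes' rule would turn it into an unplanted
    moment of order 1 + t, where the power is convex and the comparison reverses. Hence the signal
    is linearized before comparing, and only the noise is compared, at order [t] itself. On the
    scalar side moments are expanded to second order at 0, with a remainder uniform over bounded
    parameters. The Gaussian comparison exchanges small increments and rests on a Taylor bound for
    s^t. Gaussian vectors occur only as iterated one-dimensional averages; an independence argument
    brings the given probability spaces to that form. *)

Section gauss.
Context {R : realType}.
Local Open Scope ereal_scope.
Local Notation mu := (@lebesgue_measure R).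
Local Notation mR := (measurableTypeR R).
Implicit Types (f : mR -> \bar R) (s a b : R).

Lemma lebesgue_measure_shift a (A : set R) : measurable A ->
  pushforward mu ((fun x : R => x + a)%R : measurableTypeR R -> measurableTypeR R) A = mu A.
Proof.
move=> mA.
have mf : measurable_fun setT ((fun x : R => x + a)%R : measurableTypeR R -> measurableTypeR R).
  exact: measurable_funD.
pose mf_mixin := isMeasurableFun.Build _ _ _ _ _ mf.
pose F : {mfun measurableTypeR R >-> measurableTypeR R} :=
  HB.pack ((fun x : R => x + a)%R : measurableTypeR R -> measurableTypeR R) mf_mixin.
apply/esym.
apply: (@lebesgue_measure_unique R (pushforward mu F)) => //= _ [[u v]] _ <-.
rewrite /pushforward/=.
rewrite (_ : _ @^-1` _ = `](u - a)%R, (v - a)%R]%classic); last first.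
  by apply/seteqP; split => x /=; rewrite !in_itv/= ltrBlDr lerBrDr.
rewrite !lebesgue_measure_itv/= !lte_fin ltrBlDr subrK.
by case: ifP => // _; rewrite -!EFinD; congr (_%:E); ring.
Qed.

Lemma ge0_integral_shift a f : measurable_fun setT f -> (forall x, 0 <= f x) ->
  \int[mu]_x f ((x : R) + a)%R = \int[mu]_x f x.
Proof.
move=> mf f0.
have mfa : measurable_fun setT ((fun x : R => x + a)%R : measurableTypeR R -> measurableTypeR R).
  exact: measurable_funD.
pose mf_mixin := isMeasurableFun.Build _ _ _ _ _ mfa.
pose F : {mfun measurableTypeR R >-> measurableTypeR R} :=
  HB.pack ((fun x : R => x + a)%R : measurableTypeR R -> measurableTypeR R) mf_mixin.
transitivity (\int[pushforward mu F]_x f x).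
  by rewrite ge0_integral_pushforward//= preimage_setT.
by apply: eq_measure_integral => A mA _; exact: lebesgue_measure_shift.
Qed.

Lemma ge0_integral_opp f : measurable_fun setT f -> (forall x, 0 <= f x) ->
  \int[mu]_x f (- (x : R))%R = \int[mu]_x f x.
Proof.
move=> mf f0.
have mfa : measurable_fun setT (-%R : measurableTypeR R -> measurableTypeR R).
  exact: oppr_measurable.
pose mf_mixin := isMeasurableFun.Build _ _ _ _ _ mfa.
pose F : {mfun measurableTypeR R >-> measurableTypeR R} :=
  HB.pack (-%R : measurableTypeR R -> measurableTypeR R) mf_mixin.
transitivity (\int[pushforward mu F]_x f x).
  by rewrite ge0_integral_pushforward//= preimage_setT.
by apply: eq_measure_integral => A mA _; exact: lebesgue_measureN.
Qed.

Lemma ge0_integral_normal m s f : measurable_fun setT f -> (forall x, 0 <= f x) ->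
  \int[normal_prob m s]_x f x = \int[mu]_x (f x * (normal_pdf m s x)%:E).
Proof.
move=> mf f0.
rewrite -(Radon_Nikodym_SigmaFinite.change_of_variables (normal_prob_dominates m s))//.
have mg : measurable_fun setT (fun x : mR => (normal_pdf m s x)%:E).
  by apply/measurable_EFinP; exact: measurable_normal_pdf.
have mrn : measurable_fun setT (Radon_Nikodym_SigmaFinite.f (normal_prob m s) mu).
  by apply: measurable_int; apply: Radon_Nikodym_SigmaFinite.f_integrable; exact: normal_prob_dominates.
apply: ge0_ae_eq_integral => //.
- exact: emeasurable_funM.
- exact: emeasurable_funM.
- by move=> x _; rewrite mule_ge0// Radon_Nikodym_SigmaFinite.f_ge0//; exact: normal_prob_dominates.
- by move=> x _; rewrite mule_ge0// lee_fin normal_pdf_ge0.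
(* The Radon-Nikodym derivative and [normal_pdf] integrate to the same measure of every measurable
   set, so they agree almost everywhere. *)
apply: ae_eqe_mul2l => /=.
apply: integral_ae_eq => //.
- apply: Radon_Nikodym_SigmaFinite.f_integrable; exact: normal_prob_dominates.
- move=> E _ mE. rewrite -Radon_Nikodym_SigmaFinite.f_integral//.
  exact: normal_prob_dominates.
Qed.
End gauss.

Section normal.
Context {R : realType}.
Local Notation mR := (measurableTypeR R).
Implicit Types (f : mR -> \bar R) (s a b c t : R).

Lemma normal_pdf_shift s t x : 0 < s ->
  normal_pdf 0 s (x - s ^+ 2 * t) =
  normal_pdf 0 s x * expR (t * x - s ^+ 2 * t ^+ 2 / 2).
Proof.
move=> s0; rewrite !normal_pdfE ?gt_eqF//.
rewrite /= -[RHS]mulrA; congr (_ * _); rewrite /normal_fun -expRD; congr expR.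
by field; rewrite gt_eqF.
Qed.

(** Bayes' rule for a Gaussian sum: the joint density of a summand [x] and the total [y] is the
    density of [y] times the conditional density of [x], a normal law of mean [y * a ^+ 2 / c ^+ 2]
    and deviation [a * b / c]. *)
Lemma normal_pdf_mul a b c x y : 0 < a -> 0 < b -> 0 < c ->
    c ^+ 2 = a ^+ 2 + b ^+ 2 ->
  normal_pdf 0 a x * normal_pdf 0 b (y - x) =
  normal_pdf 0 c y * normal_pdf (y * a ^+ 2 / c ^+ 2) (a * b / c) x.
Proof.
move=> a0 b0 c0 cE; rewrite !normal_pdfE ?gt_eqF ?divr_gt0 ?mulr_gt0//.
rewrite /= /normal_peak /normal_fun.
rewrite [LHS](_ : _ = ((Num.sqrt (a ^+ 2 * pi *+ 2))^-1 * (Num.sqrt (b ^+ 2 * pi *+ 2))^-1) *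
  (expR (- (x - 0) ^+ 2 / (a ^+ 2 *+ 2)) * expR (- (y - x - 0) ^+ 2 / (b ^+ 2 *+ 2)))); last by ring.
rewrite [RHS](_ : _ = ((Num.sqrt (c ^+ 2 * pi *+ 2))^-1 * (Num.sqrt ((a * b / c) ^+ 2 * pi *+ 2))^-1) *
  (expR (- (y - 0) ^+ 2 / (c ^+ 2 *+ 2)) * expR (- (x - y * a ^+ 2 / c ^+ 2) ^+ 2 / ((a * b / c) ^+ 2 *+ 2)))); last by ring.
congr (_ * _).
  rewrite -!invfM -!sqrtrM ?mulrn_wge0 ?mulr_ge0 ?sqr_ge0 ?pi_ge0 ?ltW//.
  by congr ((Num.sqrt _)^-1); field; rewrite gt_eqF.
rewrite -!expRD; congr expR.
have : b ^+ 2 = c ^+ 2 - a ^+ 2 by rewrite cE; ring.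
move=> b2.
have c2 : c ^+ 2 != 0 by rewrite expf_neq0// gt_eqF.
have a2 : a ^+ 2 != 0 by rewrite expf_neq0// gt_eqF.
have b2n : b ^+ 2 != 0 by rewrite expf_neq0// gt_eqF.
rewrite !exprMn exprVn !subr0.
set A := a ^+ 2 in cE c2 a2 b2n *. set B := b ^+ 2 in cE c2 a2 b2n *.
rewrite cE in c2 *.
by field; rewrite c2 a2 b2n.
Qed.

Local Open Scope ereal_scope.
Local Notation mu := (@lebesgue_measure R).

Let mpdf m s : measurable_fun setT (fun x : mR => (normal_pdf m s x)%:E).
Proof. by apply/measurable_EFinP; exact: measurable_normal_pdf. Qed.

Let mshift (m : R) : measurable_fun setT ((fun x : R => x + m)%R : measurableTypeR R -> measurableTypeR R).
Proof. exact: measurable_funD. Qed.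

Let mcompD f (m : R) : measurable_fun setT f -> measurable_fun setT (fun x : mR => f ((x : R) + m)%R).
Proof. by move=> mf; exact: (measurableT_comp mf (mshift m)). Qed.

(** The one-dimensional Cameron-Martin formula, obtained by moving the translation from [f] to the
    density. *)
Lemma normal_shift s t f : (0 < s)%R -> measurable_fun setT f ->
    (forall x, 0 <= f x) ->
  \int[normal_prob 0 s]_x f (x + s ^+ 2 * t)%R =
  \int[normal_prob 0 s]_x ((expR (t * x - s ^+ 2 * t ^+ 2 / 2))%:E * f x).
Proof.
move=> s0 mf f0.
rewrite ge0_integral_normal//; last exact: mcompD.
have mexp : measurable_fun setT (fun x : mR => (expR (t * x - s ^+ 2 * t ^+ 2 / 2))%:E).
  apply/measurable_EFinP; apply: measurableT_comp => //.
  by apply: measurable_funB => //; exact: measurable_funM.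
rewrite ge0_integral_normal//; last 2 first.
- by apply: emeasurable_funM.
- by move=> x; rewrite mule_ge0// lee_fin expR_ge0.
rewrite -[LHS](@ge0_integral_shift R (- (s ^+ 2 * t))%R); last 2 first.
- by apply: emeasurable_funM => //; exact: mcompD.
- by move=> x; rewrite mule_ge0// lee_fin normal_pdf_ge0.
apply: eq_integral => x _.
rewrite subrK normal_pdf_shift// EFinM muleA muleAC; congr (_ * _).
by rewrite muleC.
Qed.

Lemma normal_expR s t : (0 < s)%R ->
  \int[normal_prob 0 s]_x (expR (t * x - s ^+ 2 * t ^+ 2 / 2))%:E = 1.
Proof.
move=> s0; transitivity (\int[normal_prob 0 s]_x
    ((expR (t * x - s ^+ 2 * t ^+ 2 / 2))%:E * cst 1 x)).
  by apply: eq_integral => x _; rewrite /= mule1.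
rewrite -(@normal_shift s t (cst 1))//.
by rewrite (_ : (fun x : R => cst 1 (x + s ^+ 2 * t)%R) = cst 1 :> (R -> \bar R))// integral_cst//= probability_setT mule1.
Qed.

Lemma normal_opp s f : (0 < s)%R -> measurable_fun setT f ->
    (forall x, 0 <= f x) ->
  \int[normal_prob 0 s]_x f (- x)%R = \int[normal_prob 0 s]_x f x.
Proof.
move=> s0 mf f0.
have mfN : measurable_fun setT (fun x : mR => f (- (x : R))%R).
  by apply: (measurableT_comp mf); exact: oppr_measurable.
rewrite !ge0_integral_normal//.
rewrite -[LHS]ge0_integral_opp; last 2 first.
- by apply: emeasurable_funM.
- by move=> x; rewrite mule_ge0// lee_fin normal_pdf_ge0.
apply: eq_integral => x _; rewrite opprK; congr (_ * (_)%:E).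
by rewrite !normal_pdfE ?gt_eqF// /normal_fun !subr0 sqrrN.
Qed.

(** After Tonelli, [normal_pdf_mul] leaves the conditional density of the first summand, whose
    integral is 1. *)
Lemma normal_conv a b c f : (0 < a)%R -> (0 < b)%R -> (0 < c)%R ->
    (c ^+ 2 = a ^+ 2 + b ^+ 2)%R ->
    measurable_fun setT f -> (forall x, 0 <= f x) ->
  \int[normal_prob 0 a]_x \int[normal_prob 0 b]_y f (x + y)%R =
  \int[normal_prob 0 c]_y f y.
Proof.
move=> a0 b0 c0 cE mf f0.
have madd : measurable_fun setT (fun z : mR * mR => f ((z.1 : R) + z.2)%R).
  apply: (measurableT_comp mf); apply: measurable_funD => //.
have mF : measurable_fun setT (fun x : mR => \int[normal_prob 0 b]_y f ((x : R) + y)%R).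
  exact: (measurable_fun_fubini_tonelli_F _ madd (fun z => f0 _)).
rewrite ge0_integral_normal//; last by move=> x; exact: integral_ge0.
transitivity (\int[mu]_x \int[mu]_y (f y * (normal_pdf 0 a x * normal_pdf 0 b (y - x))%:E)).
  apply: eq_integral => x _.
  have mfx : measurable_fun setT (fun y : mR => f ((x : R) + y)%R).
    by apply: measurableT_comp => //; exact: measurable_funD.
  rewrite ge0_integral_normal// -ge0_integralZr//; last 3 first.
  - apply: emeasurable_funM; [exact: mfx|exact: mpdf].
  - by move=> y _; rewrite mule_ge0// lee_fin normal_pdf_ge0.
  - by rewrite lee_fin normal_pdf_ge0.
  rewrite -[RHS](@ge0_integral_shift R x); last 2 first.
  - apply: emeasurable_funM => //; apply/measurable_EFinP; apply: measurable_funM => //.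
    apply: measurableT_comp; first exact: measurable_normal_pdf.
    exact: measurable_funB.
  - by move=> y; rewrite mule_ge0// lee_fin mulr_ge0 ?normal_pdf_ge0.
  apply: eq_integral => y _; rewrite addrK addrC -muleA; congr (_ * _).
  by rewrite EFinM muleC.
have mh : measurable_fun setT (fun z : mR * mR =>
    f z.2 * (normal_pdf 0 a z.1 * normal_pdf 0 b ((z.2 : R) - z.1))%:E).
  apply: emeasurable_funM; first exact: measurableT_comp.
  apply/measurable_EFinP; apply: measurable_funM.
    by apply: measurableT_comp => //; exact: measurable_normal_pdf.
  apply: measurableT_comp; first exact: measurable_normal_pdf.
  exact: measurable_funB.
rewrite (fubini_tonelli (m1 := mu) (m2 := mu) _ mh); last first.
  by move=> z; rewrite mule_ge0// lee_fin mulr_ge0 ?normal_pdf_ge0.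
rewrite ge0_integral_normal//; apply: eq_integral => y _ /=.
under eq_integral do rewrite (normal_pdf_mul _ _ a0 b0 c0 cE).
rewrite ge0_integralZl//; last 2 first.
- apply/measurable_EFinP; apply: measurable_funM => //; exact: measurable_normal_pdf.
- by move=> x _; rewrite lee_fin mulr_ge0 ?normal_pdf_ge0.
congr (_ * _).
under eq_integral do rewrite EFinM.
rewrite ge0_integralZl//; last 2 first.
- by move=> x _; rewrite lee_fin normal_pdf_ge0.
- by rewrite lee_fin normal_pdf_ge0.
by rewrite integral_normal_pdf mule1.
Qed.

End normal.

(** * Gaussian averages along a list of fields *)

Section gop.
Context {R : realType} (Sg : finType).
Local Notation mR := (measurableTypeR R).
Implicit Types (b u : Sg -> R) (s g : R) (F G : (Sg -> R) -> \bar R).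
Local Open Scope ereal_scope.

(* The term [- s^2 b^2 / 2] keeps the Gaussian mean of [expR (u x)] constant. *)
Definition tilt b s g u : Sg -> R :=
  fun x => (u x + (b x * g - s ^+ 2 * b x ^+ 2 / 2))%R.

Fact gop_key : unit. Proof. exact: tt. Qed.

(** An expectation over one Gaussian source, in which [u] carries the contribution of all the
    others; iterating it plays the role of a Gaussian vector. The lock keeps unification and
    simplification from unfolding the integral. *)
Definition gop : (Sg -> R) -> R -> ((Sg -> R) -> \bar R) -> (Sg -> R) -> \bar R :=
  locked_with gop_key (fun b s F u => \int[normal_prob 0 s]_g F (tilt b s g u)).

Lemma gopE b s F u : gop b s F u = \int[normal_prob 0 s]_g F (tilt b s g u).
Proof. by rewrite /gop unlock. Qed.

(** Measurability is tested along measurable families [u t], which spares a sigma-algebra on the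
    function space [Sg -> R]. *)
Definition good F := (forall u, 0 <= F u) /\
  forall d (T : measurableType d) (u : T -> Sg -> R),
    (forall x, measurable_fun setT (fun t => u t x)) ->
    measurable_fun setT (fun t => F (u t)).

Lemma good_ge0 F u : good F -> 0 <= F u. Proof. by case. Qed.

Lemma good_tilt2 F b s d (T : measurableType d) (u : T -> Sg -> R) : good F ->
  (forall x, measurable_fun setT (fun t => u t x)) ->
  measurable_fun setT (fun z : T * mR => F (tilt b s z.2 (u z.1))).
Proof.
move=> [_ mF] mu; apply: mF => x; apply: measurable_funD.
  exact: (measurableT_comp (mu x)).
by apply: measurable_funB => //; exact: measurable_funM.
Qed.

Lemma good_tilt F b s u : good F ->
  measurable_fun setT (fun g : mR => F (tilt b s g u)).
Proof.
move=> [_ mF]; apply: mF => x; apply: measurable_funD => //.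
by apply: measurable_funB => //; exact: measurable_funM.
Qed.

Lemma gop_good b s F : good F -> good (gop b s F).
Proof.
move=> gF; split => [u|d T u mu].
  by rewrite gopE; apply: integral_ge0 => g _; exact: good_ge0.
rewrite (_ : (fun z => _) = (fun z => \int[normal_prob 0 s]_g F (tilt b s g (u z)))).
  2: by apply/funext => z; rewrite gopE.
exact: (measurable_fun_fubini_tonelli_F _ (good_tilt2 b s gF mu) (fun z => good_ge0 _ gF)).
Qed.

Lemma good_cst (k : \bar R) : 0 <= k -> good (fun=> k).
Proof. by move=> k0; split => //= d T u _; exact: measurable_cst. Qed.

Lemma goodD F G : good F -> good G -> good (fun u => F u + G u).
Proof.
move=> gF gG; split => [u|d T u mu]; first by rewrite adde_ge0//; exact: good_ge0.
by apply: emeasurable_funD; [exact: gF.2|exact: gG.2].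
Qed.

Lemma goodM F G : good F -> good G -> good (fun u => F u * G u).
Proof.
move=> gF gG; split => [u|d T u mu]; first by rewrite mule_ge0//; exact: good_ge0.
by apply: emeasurable_funM; [exact: gF.2|exact: gG.2].
Qed.

Lemma good_sum (I : Type) (r : seq I) (P : pred I) (F : I -> (Sg -> R) -> \bar R) :
  (forall i, good (F i)) -> good (fun u => \sum_(i <- r | P i) F i u).
Proof.
move=> gF; elim: r => [|i r IH].
  rewrite (_ : (fun u => _) = fun=> 0); first exact: good_cst.
  by apply/funext => u; rewrite big_nil.
case Pi : (P i); last first.
  rewrite (_ : (fun u => _) = (fun u => \sum_(i <- r | P i) F i u))//.
  by apply/funext => u; rewrite big_cons Pi.
rewrite (_ : (fun u => _) = (fun u => F i u + \sum_(i <- r | P i) F i u)).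
  exact: goodD.
by apply/funext => u; rewrite big_cons Pi.
Qed.

Lemma good_EFin (f : (Sg -> R) -> R) : (forall u, 0 <= f u)%R ->
  (forall d (T : measurableType d) (u : T -> Sg -> R),
    (forall x, measurable_fun setT (fun t => u t x)) ->
    measurable_fun setT (fun t => f (u t))) -> good (fun u => (f u)%:E).
Proof.
move=> f0 mf; split => [u|d T u mu]; first by rewrite lee_fin.
by apply/measurable_EFinP; exact: mf.
Qed.

Lemma good_comp F (h : (Sg -> R) -> Sg -> R) : good F ->
  (forall d (T : measurableType d) (u : T -> Sg -> R) x,
    (forall x, measurable_fun setT (fun t => u t x)) ->
    measurable_fun setT (fun t => h (u t) x)) -> good (fun u => F (h u)).
Proof.
move=> gF mh; split => [u|d T u mu]; first exact: good_ge0.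
by apply: gF.2 => x; exact: mh.
Qed.

Lemma good_translate F (v : Sg -> R) : good F -> good (fun u => F (fun x => u x + v x)%R).
Proof. by move=> gF; apply: good_comp => // d T u x mu; exact: measurable_funD. Qed.

Lemma good_expR x : good (fun u => (expR (u x))%:E).
Proof.
apply: good_EFin => [u|d T u mu]; first exact: expR_ge0.
exact: measurableT_comp.
Qed.

Lemma gop_le b s F G u : good F -> good G -> (forall u, F u <= G u) ->
  gop b s F u <= gop b s G u.
Proof.
move=> gF gG FG; rewrite !gopE; apply: ge0_le_integral => //.
- by move=> x _; exact: good_ge0.
- exact: good_tilt.
- exact: good_tilt.
Qed.

Lemma gopD b s F G u : good F -> good G ->
  gop b s (fun u => F u + G u) u = gop b s F u + gop b s G u.
Proof.
move=> gF gG; rewrite !gopE ge0_integralD//.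
- by move=> x _; exact: good_ge0.
- exact: good_tilt.
- by move=> x _; exact: good_ge0.
- exact: good_tilt.
Qed.

Lemma gopZ b s (k : \bar R) F u : 0 <= k -> good F ->
  gop b s (fun u => k * F u) u = k * gop b s F u.
Proof.
move=> k0 gF; rewrite !gopE ge0_integralZl//.
- exact: good_tilt.
- by move=> x _; exact: good_ge0.
Qed.

Lemma gop_cst b s (k : \bar R) u : gop b s (fun=> k) u = k.
Proof. by rewrite !gopE integral_cst//= probability_setT mule1. Qed.

Lemma gop_comm b s c r F u : good F ->
  gop b s (gop c r F) u = gop c r (gop b s F) u.
Proof.
move=> gF; rewrite !gopE; under eq_integral do rewrite gopE; under [RHS]eq_integral do rewrite gopE.
have mz : measurable_fun setT (fun z : mR * mR => F (tilt c r z.2 (tilt b s z.1 u))).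
  apply: (@good_tilt2 F c r _ mR (fun g => tilt b s g u)) => // x.
  by apply: measurable_funD => //; apply: measurable_funB => //.
transitivity (\int[normal_prob 0 r]_h \int[normal_prob 0 s]_g F (tilt c r h (tilt b s g u))).
  exact: (fubini_tonelli (m1 := normal_prob 0 s) (m2 := normal_prob 0 r)
    (fun z : mR * mR => F (tilt c r z.2 (tilt b s z.1 u))) mz (fun z => good_ge0 _ gF)).
apply: eq_integral => h _; apply: eq_integral => g _; congr F.
by apply/funext => x; rewrite /tilt addrAC.
Qed.

(** [tilt] is additive in the pair of [g] and [s ^+ 2], so the compensating terms add up exactly as
    the variances do. *)
Lemma gop_conv b a1 a2 c F u : (0 < a1)%R -> (0 < a2)%R -> (0 < c)%R ->
    (c ^+ 2 = a1 ^+ 2 + a2 ^+ 2)%R -> good F ->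
  gop b c F u = gop b a1 (gop b a2 F) u.
Proof.
move=> a10 a20 c0 cE gF; rewrite !gopE; under [RHS]eq_integral do rewrite gopE.
transitivity (\int[normal_prob 0 a1]_g \int[normal_prob 0 a2]_h F (tilt b c (g + h) u)).
  exact/esym/(normal_conv (f := fun g => F (tilt b c g u)) a10 a20 c0 cE
    (good_tilt b c u gF) (fun g => good_ge0 _ gF)).
apply: eq_integral => g _; apply: eq_integral => h _; congr F.
by apply/funext => x; rewrite /tilt cE; ring.
Qed.

(** Cameron-Martin for fields: the weight [expR (u y)] produces the density
    [expR (b y * g - s ^+ 2 * b y ^+ 2 / 2)], which translates [g] by [s ^+ 2 * b y] and so moves
    the field at [x] by its covariance with the field at [y]. *)
Lemma gop_shift b s F u y : (0 < s)%R -> good F ->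
  gop b s (fun u => (expR (u y))%:E * F u) u =
  (expR (u y))%:E * gop b s F (fun x => u x + s ^+ 2 * (b x * b y))%R.
Proof.
move=> s0 gF; rewrite !gopE.
transitivity (\int[normal_prob 0 s]_g ((expR (u y))%:E *
    ((expR (b y * g - s ^+ 2 * b y ^+ 2 / 2))%:E * F (tilt b s g u)))).
  by apply: eq_integral => g _; rewrite /tilt expRD EFinM muleA.
have mexp : measurable_fun setT (fun x : mR => (expR (b y * x - s ^+ 2 * b y ^+ 2 / 2))%:E).
  apply/measurable_EFinP; apply: measurableT_comp => //.
  by apply: measurable_funB => //; exact: measurable_funM.
rewrite ge0_integralZl//; last 2 first.
- by apply: emeasurable_funM => //; exact: good_tilt.
- by move=> g _; rewrite mule_ge0//; exact: good_ge0.
congr (_ * _); rewrite -(@normal_shift R s (b y) (fun g => F (tilt b s g u)))//.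
- apply: eq_integral => g _; congr F; apply/funext => x; rewrite /tilt; ring.
- exact: good_tilt.
- by move=> g; exact: good_ge0.
Qed.

Lemma gop_opp b s F u : (0 < s)%R -> good F ->
  gop (fun x => - b x)%R s F u = gop b s F u.
Proof.
move=> s0 gF; rewrite !gopE -[RHS]normal_opp//.
- apply: eq_integral => g _; congr F; apply/funext => x; rewrite /tilt; ring.
- exact: good_tilt.
- by move=> g; exact: good_ge0.
Qed.

Lemma gop_translate b s F u v :
  gop b s F (fun x => u x + v x)%R = gop b s (fun u => F (fun x => u x + v x)%R) u.
Proof.
by rewrite !gopE; apply: eq_integral => g _; congr F; apply/funext => x; rewrite /tilt addrAC.
Qed.

Section gops.
Context {K : Type} (b : K -> Sg -> R).
Implicit Types ks : seq K.

Definition gops s ks F := foldr (fun k F => gop (b k) s F) F ks.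

Lemma gops_cons s k ks F : gops s (k :: ks) F = gop (b k) s (gops s ks F).
Proof. by []. Qed.

Lemma gops_good s ks F : good F -> good (gops s ks F).
Proof. by move=> gF; elim: ks => //= k ks IH; exact: gop_good. Qed.

Lemma gops_le s ks F G : good F -> good G -> (forall u, F u <= G u) ->
  forall u, gops s ks F u <= gops s ks G u.
Proof.
move=> gF gG FG; elim: ks => //= k ks IH u.
by apply: gop_le => //; exact: gops_good.
Qed.

Lemma gopsD s ks F G : good F -> good G ->
  gops s ks (fun u => F u + G u) = (fun u => gops s ks F u + gops s ks G u).
Proof.
move=> gF gG; elim: ks => //= k ks ->; apply/funext => u.
by rewrite gopD//; exact: gops_good.
Qed.

Lemma gopsZ s ks (k : \bar R) F : 0 <= k -> good F ->
  gops s ks (fun u => k * F u) = (fun u => k * gops s ks F u).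
Proof.
move=> k0 gF; elim: ks => //= j ks ->; apply/funext => u.
by rewrite gopZ//; exact: gops_good.
Qed.

Lemma gops_cst s ks (k : \bar R) : gops s ks (fun=> k) = fun=> k.
Proof. by elim: ks => //= j ks ->; apply/funext => u; rewrite gop_cst. Qed.

Lemma gops_sum s ks (I : Type) (r : seq I) (F : I -> (Sg -> R) -> \bar R) :
  (forall i, good (F i)) ->
  gops s ks (fun u => \sum_(i <- r) F i u) =
  (fun u => \sum_(i <- r) gops s ks (F i) u).
Proof.
move=> gF; elim: r => [|i r IH].
  rewrite (_ : (fun u => _) = fun=> 0).
    by rewrite gops_cst; apply/funext => u; rewrite big_nil.
  by apply/funext => u; rewrite big_nil.
rewrite (_ : (fun u => _) = (fun u => F i u + \sum_(i <- r) F i u)); last first.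
  by apply/funext => u; rewrite big_cons.
rewrite gopsD//; last exact: good_sum.
by rewrite IH; apply/funext => u; rewrite big_cons.
Qed.

Lemma gops_gop s ks c r F : good F ->
  gops s ks (gop c r F) = gop c r (gops s ks F).
Proof.
move=> gF; elim: ks => [//|k ks IH].
rewrite !gops_cons IH; apply/funext => u; apply: gop_comm.
exact: gops_good.
Qed.

Lemma gops_conv ks a1 a2 c F : (0 < a1)%R -> (0 < a2)%R -> (0 < c)%R ->
    (c ^+ 2 = a1 ^+ 2 + a2 ^+ 2)%R -> good F ->
  gops c ks F = gops a1 ks (gops a2 ks F).
Proof.
move=> a10 a20 c0 cE gF; elim: ks => [//|k ks IH].
rewrite !gops_cons IH; apply/funext => u.
rewrite (gop_conv _ _ a10 a20 c0 cE); last by do 2 apply: gops_good.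
by rewrite gops_gop; last exact: gops_good.
Qed.

Lemma gops_translate s ks F u v :
  gops s ks F (fun x => u x + v x)%R = gops s ks (fun u => F (fun x => u x + v x)%R) u.
Proof.
elim: ks u => [//|k ks IH] u; rewrite !gops_cons gop_translate.
by congr (gop _ _ _ _); apply/funext => w; rewrite IH.
Qed.

Definition cov ks x y : R := (\sum_(k <- ks) b k x * b k y)%R.

Lemma gops_shift s ks F u y : (0 < s)%R -> good F ->
  gops s ks (fun u => (expR (u y))%:E * F u) u =
  (expR (u y))%:E * gops s ks F (fun x => u x + s ^+ 2 * cov ks x y)%R.
Proof.
move=> s0 gF; elim: ks u => [|k ks IH] u.
  by congr (_ * F _); apply/funext => x; rewrite /cov big_nil mulr0 addr0.
rewrite !gops_cons.
rewrite (_ : gops s ks _ = fun u => (expR (u y))%:E *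
   gops s ks F (fun x => u x + s ^+ 2 * cov ks x y)%R); last exact/funext.
rewrite gop_shift; [|exact: s0|by apply: good_translate; exact: gops_good].
congr (_ * _); rewrite -gop_translate; congr (gop _ _ _ _); apply/funext => x.
by rewrite /cov big_cons mulrDr addrA.
Qed.

End gops.

Lemma gops_comm {K K' : Type} (b : K -> Sg -> R) (b' : K' -> Sg -> R) s ks r ks' F :
  good F -> gops b s ks (gops b' r ks' F) = gops b' r ks' (gops b s ks F).
Proof.
move=> gF; elim: ks' => [//|k ks' IH].
by rewrite !gops_cons gops_gop ?IH; [|exact: gops_good].
Qed.

End gop.

(** * Inequalities for real powers *)

Section powR_facts.
Context {R : realType}.
Implicit Types (a s t x y : R).

(** Young's inequality for the product of s^a and 1, with the exponents 1/a and 1/(1 - a). *)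
Lemma powR_le_affine a s : 0 < a < 1 -> 0 <= s -> s `^ a <= 1 + a * (s - 1).
Proof.
move=> /andP[a0 a1] s0.
have := @conjugate_powR R (s `^ a) 1 a^-1 (1 - a)^-1.
rewrite powR_ge0 ler01 !invr_gt0 a0 subr_gt0 a1 !invrK powR1 mulr1 mul1r.
rewrite -powRrM mulfV ?gt_eqF// powRr1// => /(_ erefl erefl erefl erefl).
by rewrite addrC subrK => /(_ erefl); lra.
Qed.

(** Both bounds come from [powR_le_affine]: the lower one by inverting it, since (1 - z)(1 + z) <=
    1, the upper one by writing s^(-a) as s^(1 - a) / s. The range [2^-1 <= s] makes the factor
    [2 * s - 1] of the final remainder nonnegative. *)
Lemma powRN_bounds a s : 0 < a < 1 -> 2^-1 <= s ->
  1 - a * (s - 1) <= s `^ (- a) <= 1 - a * (s - 1) + 2 * a * (s - 1) ^+ 2.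
Proof.
move=> a01 s2; have s0 : 0 < s by lra.
case/andP: (a01) => a0 a1.
apply/andP; split.
  have sa := powR_le_affine a01 (ltW s0).
  rewrite powRN.
  have sa0 : 0 < s `^ a by rewrite powR_gt0.
  rewrite -[leRHS]mul1r ler_pdivlMr//.
  have [h|h] := leP (1 - a * (s - 1)) 0.
    by apply: (le_trans (mulr_le0_ge0 h (ltW sa0))).
  apply: (le_trans (ler_wpM2l (ltW h) sa)).
  have := sqr_ge0 (a * (s - 1)); nra.
have a01' : 0 < 1 - a < 1 by lra.
have sa := powR_le_affine a01' (ltW s0).
have -> : s `^ (- a) = s `^ (1 - a) / s.
  transitivity (s `^ ((1 - a) - 1)); first by congr (_ `^ _); ring.
  by rewrite powRB ?powRr1 ?(gt_eqF s0) ?implybT ?(ltW s0).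
rewrite ler_pdivrMr//; apply: (le_trans sa).
rewrite -subr_ge0.
have -> : (1 - a * (s - 1) + 2 * a * (s - 1) ^+ 2) * s - (1 + (1 - a) * (s - 1)) =
  a * (s - 1) ^+ 2 * (2 * s - 1) by ring.
by apply: mulr_ge0; [apply: mulr_ge0; [lra|exact: sqr_ge0]|lra].
Qed.

(** The constant is uniform in [t]. For [s < 2^-1] the right-hand side is at least 2 and dominates
    by size alone; for larger [s] the derivative of the difference is controlled by [powRN_bounds]
    at [1 - t], and the mean value theorem applies between 1 and [s]. *)
Lemma powR_taylor t s : 0 < t < 1 -> 0 <= s ->
  `|s `^ t - (1 + t * (s - 1) - t * (1 - t) / 2 * (s - 1) ^+ 2)|
  <= 16 * `|s - 1| ^+ 3.
Proof.
move=> t01 s0; have /andP[t0 t1] := t01.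
have [s2|s2] := ltP s 2^-1.
  have st0 : 0 <= s `^ t <= 1.
    rewrite powR_ge0/=; apply: (le_trans (powR_le_affine t01 s0)).
    have : t * (s - 1) <= 0 by rewrite mulr_ge0_le0; lra.
    lra.
  have h1 : 8^-1 <= `|s - 1| ^+ 3.
    rewrite ltr0_norm; last by lra.
    have -> : 8^-1 = (2^-1) ^+ 3 :> R by field.
    rewrite lerXn2r// ?nnegrE; lra.
  apply: (@le_trans _ _ 2); last by lra.
  have h2 : - 1 <= t * (s - 1) <= 0 by nra.
  have h3 : 0 <= t * (1 - t) / 2 * (s - 1) ^+ 2 <= 1.
    have h4 : 0 <= t * (1 - t) / 2 <= 1 by nra.
    have h5 : 0 <= (s - 1) ^+ 2 <= 1 by nra.
    case/andP: h4 => ? ?; case/andP: h5 => ? ?.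
    by rewrite mulr_ge0//= mulr_ile1.
  rewrite ler_norml; lra.
have sp : 0 < s by lra.
pose f x : R := x `^ t - (1 + t * (x - 1) - t * (1 - t) / 2 * (x - 1) ^+ 2).
pose df x : R := t * x `^ (t - 1) - (t - t * (1 - t) * (x - 1)).
have f1 : f 1 = 0 by rewrite /f powR1; ring.
have dfE x : 0 < x -> is_derive x 1 f (df x).
  move=> x0; have h := is_derive1_powR t x0.
  have -> : f = (@powR R ^~ t) - (cst 1 + t *: (id - cst 1) -
      (t * (1 - t) / 2) *: (id - cst 1) ^+ 2).
    by apply/funext => y.
  apply: is_derive_eq.
  rewrite /df /GRing.scale/= expr1 (_ : (id - cst 1) x = x - 1)//; field => //.
have dfb x : 2^-1 <= x -> `|df x| <= 2 * (x - 1) ^+ 2.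
  move=> x2; have a01 : 0 < 1 - t < 1 by lra.
  have := powRN_bounds a01 x2; rewrite opprB /df => /andP[h1 h2].
  have -> : t * x `^ (t - 1) - (t - t * (1 - t) * (x - 1)) =
    t * (x `^ (t - 1) - (1 - (1 - t) * (x - 1))) by ring.
  rewrite normrM ger0_norm ?(ltW t0)// ger0_norm; last lra.
  apply: (@le_trans _ _ (1 * (2 * (1 - t) * (x - 1) ^+ 2))).
    apply: ler_pM; lra.
  rewrite mul1r; have := sqr_ge0 (x - 1); nra.
have cf x : 0 < x -> {for x, continuous f}.
  move=> x0; apply: differentiable_continuous; apply/derivable1_diffP.
  exact: (@ex_derive _ _ _ _ _ _ _ (dfE x x0)).
have key x : 2^-1 <= x -> `|f x| <= 2 * `|x - 1| ^+ 3.
  move=> x2.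
  have MVTb a b : 0 < a -> a <= b -> exists2 c, c \in `[a, b]%R & f b - f a = df c * (b - a).
    move=> a0 ab; apply: MVT_segment => //.
      by move=> y; rewrite in_itv/= => /andP[ay _]; apply: dfE; exact: lt_trans ay.
    apply: continuous_in_subspaceT => y; rewrite inE/= in_itv/= => /andP[ay _].
    by apply: cf; exact: lt_le_trans ay.
  have [x1|x1] := leP x 1.
    have [|c] := MVTb x 1 _ x1; first by lra.
    rewrite f1 sub0r in_itv/= => /andP[xc c1] E.
    have -> : f x = - (df c * (1 - x)) by rewrite -E opprK.
    rewrite normrN normrM exprS mulrC mulrCA distrC ler_wpM2l//.
    apply: (le_trans (dfb c _)); first by lra.
    rewrite real_normK ?num_real//; nra.
  have [||c] := MVTb 1 x; [lra|lra|].
  rewrite f1 subr0 in_itv/= => /andP[c1 cx] ->.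
  rewrite normrM exprS mulrC mulrCA ler_wpM2l//.
  apply: (le_trans (dfb c _)); first by lra.
  rewrite real_normK ?num_real//; nra.
apply: (le_trans (key s s2)).
by rewrite ler_wpM2r ?exprn_ge0//; lra.
Qed.

Lemma powR_sum_le (I : Type) (r : seq I) (f : I -> R) t : 0 < t < 1 ->
  (forall i, 0 <= f i) -> (\sum_(i <- r) f i) `^ t <= \sum_(i <- r) (f i) `^ t.
Proof.
move=> t01 f0; have /andP[t0 t1] := t01; elim: r => [|i r IH].
  by rewrite !big_nil powR0// gt_eqF.
rewrite !big_cons; apply: (@le_trans _ _ ((f i) `^ t + (\sum_(j <- r) f j) `^ t)); last by rewrite lerD2l.
have S0 : 0 <= \sum_(j <- r) f j by exact: sumr_ge0.
move: (\sum_(j <- r) f j) (f i) (f0 i) S0 => y x x0 y0.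
have [->|xn0] := eqVneq x 0; first by rewrite add0r powR0 ?gt_eqF// add0r.
have xy0 : 0 < x + y by rewrite ltr_wpDr// lt_neqAle eq_sym xn0.
(* A share z / (x + y) lies in [0, 1], hence is at most its power of order [t]; the two shares sum
   to 1. *)
have key z : 0 <= z <= x + y -> z / (x + y) * (x + y) `^ t <= z `^ t.
  move=> /andP[z0 zxy]; have [->|zn0] := eqVneq z 0.
    by rewrite mul0r mul0r powR_ge0.
  rewrite [leRHS](_ : _ = (z / (x + y)) `^ t * (x + y) `^ t).
    rewrite ler_wpM2r ?powR_ge0//; apply: ger1_powR; last exact: ltW.
    by apply/andP; split; [rewrite divr_gt0// lt_neqAle eq_sym zn0|
      rewrite ler_pdivrMr// mul1r].
  by rewrite -powRM ?divr_ge0 ?(ltW xy0)// divfK// gt_eqF.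
apply: le_trans (lerD (key x _) (key y _)); [|lra|lra].
by rewrite -mulrDl -mulrDl divff ?gt_eqF// mul1r.
Qed.

(** Young's inequality with the conjugate exponents 1 + t and (1 + t)/t; it separates the two
    coupled partition functions in [flipped_signs]. *)
Lemma young_powR t x y : 0 < t -> 0 <= x -> 0 <= y ->
  (1 + t) * (x * y `^ t) <= x `^ (1 + t) + t * y `^ (1 + t).
Proof.
move=> t0 x0 y0.
have := @conjugate_powR R x (y `^ t) (1 + t) ((1 + t) / t) x0 (powR_ge0 _ _).
rewrite invf_div -powRrM (_ : t * ((1 + t) / t) = 1 + t); last by field; rewrite gt_eqF.
have t1 : 0 < 1 + t by lra.
rewrite t1 divr_gt0// => /(_ erefl erefl).
have -> : (1 + t)^-1 + t / (1 + t) = 1 by field; rewrite gt_eqF.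
move=> /(_ erefl) h.
rewrite mulrC -ler_pdivlMr//; apply: (le_trans h).
rewrite le_eqVlt; apply/orP; left; apply/eqP; field.
by rewrite !gt_eqF.
Qed.

Lemma expR_sub1_le x : expR x - 1 <= x * expR x.
Proof.
have := expR_ge1Dx (- x); rewrite expRN => h.
have e0 := expR_gt0 x.
have : (1 - x) * expR x <= 1 by rewrite -ler_pdivlMr// mul1r.
by rewrite mulrBl mul1r; lra.
Qed.

(** The left-hand side is E[(e^u - 1)^4] for a Gaussian u of variance [x] with E[e^u] = 1. It
    carries the factor [(expR x - 1) ^+ 2], which makes it quadratic in the variance. *)
Lemma fourth_moment_le x : 0 <= x <= 1 ->
  expR (6 * x) - 4 * expR (3 * x) + 6 * expR x - 3 <= 6 * expR 1 ^+ 6 * x ^+ 2.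
Proof.
move=> /andP[x0 x1].
have -> : expR (6 * x) = expR x ^+ 6 by rewrite -expRM_natl.
have -> : expR (3 * x) = expR x ^+ 3 by rewrite -expRM_natl.
have h0 : 1 <= expR x by rewrite -expR0 ler_expR.
have h1 : expR x <= expR 1 by rewrite ler_expR.
have h2 := expR_sub1_le x.
move: (expR x) (expR 1) h0 h1 h2 => y M h0 h1 h2.
have -> : y ^+ 6 - 4 * y ^+ 3 + 6 * y - 3 = (y - 1) ^+ 2 * (y ^+ 4 + 2 * y ^+ 3 + 3 * y ^+ 2 - 3) by ring.
have M1 : 1 <= M by lra.
have -> : 6 * M ^+ 6 * x ^+ 2 = (x * M) ^+ 2 * (6 * M ^+ 4) by ring.
have y4 : y ^+ 4 <= M ^+ 4 by rewrite lerXn2r ?nnegrE//; lra.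
have y3 : y ^+ 3 <= y ^+ 4 by rewrite ler_weXn2l.
have y2 : y ^+ 2 <= y ^+ 4 by rewrite ler_weXn2l.
have y1 : 1 <= y ^+ 2 by rewrite exprn_ege1.
have y31 : 1 <= y ^+ 3 by rewrite exprn_ege1.
apply: ler_pM.
- exact: sqr_ge0.
- lra.
- have xM : 0 <= x * M by rewrite mulr_ge0//; lra.
  have h3 : y - 1 <= x * M by apply: (le_trans h2); rewrite ler_wpM2l.
  by rewrite ler_sqr ?nnegrE//; lra.
- lra.
Qed.

End powR_facts.

Lemma sqr_sum_le (R : realType) (I : finType) (p a : I -> R) :
  (forall i, 0 <= p i) -> \sum_i p i = 1 ->
  (\sum_i p i * a i) ^+ 2 <= \sum_i p i * a i ^+ 2.
Proof.
move=> p0 p1.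
have E m : \sum_i p i * (a i - m) ^+ 2 =
    \sum_i p i * a i ^+ 2 - 2 * m * (\sum_i p i * a i) + m ^+ 2 * \sum_i p i.
  rewrite !mulr_sumr -sumrB -big_split/=; apply: eq_bigr => i _.
  by ring.
have : 0 <= \sum_i p i * (a i - \sum_i p i * a i) ^+ 2.
  by apply: sumr_ge0 => i _; rewrite mulr_ge0// sqr_ge0.
by rewrite E p1; lra.
Qed.

(** * Explicit lognormal moments *)

Section mean.
Context {R : realType} (Sg : finType) {K : Type} (b : K -> Sg -> R).
Variables (s : R) (ks : seq K).
Hypothesis s0 : 0 < s.

(** Couples the admissibility of [f] with a finite real value of its Gaussian mean, so that explicit
    means combine linearly inside the extended reals. *)
Definition mean (f : (Sg -> R) -> R) (m : R) :=
  good (fun u => (f u)%:E) /\ gops b s ks (fun u => (f u)%:E) (fun=> 0) = m%:E.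

Lemma mean_cst c : 0 <= c -> mean (fun=> c) c.
Proof. by move=> c0; split; [exact: good_cst|rewrite gops_cst]. Qed.

Lemma meanD f g m n : mean f m -> mean g n -> mean (fun u => f u + g u) (m + n).
Proof.
move=> [gf fm] [gg gn]; split.
  by under eq_fun do rewrite EFinD; exact: goodD.
by under eq_fun do rewrite EFinD; rewrite gopsD// fm gn.
Qed.

Lemma meanZ f m c : 0 <= c -> mean f m -> mean (fun u => c * f u) (c * m).
Proof.
move=> c0 [gf fm]; split.
  by under eq_fun do rewrite EFinM; apply: goodM => //; exact: good_cst.
by under eq_fun do rewrite EFinM; rewrite gopsZ// fm.
Qed.

Lemma mean_sum (I : Type) (r : seq I) f m :
  (forall i : I, mean (f i) (m i)) ->
  mean (fun u => \sum_(i <- r) f i u) (\sum_(i <- r) m i).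
Proof.
move=> fm; elim: r => [|i r IH].
  rewrite big_nil (_ : (fun u => _) = fun=> 0); first exact: mean_cst.
  by apply/funext => u; rewrite big_nil.
rewrite big_cons (_ : (fun u => _) = fun u => f i u + \sum_(i <- r) f i u).
  exact: meanD.
by apply/funext => u; rewrite big_cons.
Qed.

(** A difference is reached by transposition: [f] is nonnegative, so the means of [f] and [g] add up
    to that of [h], and the finite mean of [g] can be cancelled. *)
Lemma mean_sub f g h m n : good (fun u => (f u)%:E) -> mean g m -> mean h n ->
  (forall u, f u + g u = h u) -> mean f (n - m).
Proof.
move=> gf [gg gm] [gh hn] E; split=> //.
have : (gops b s ks (fun u => (f u)%:E) (fun=> 0%R) + m%:E = n%:E)%E.
  have := congr1 (@^~ (fun=> 0)) (gopsD b s ks gf gg).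
  rewrite -gm -hn => /= <-; congr (gops _ _ _ _ _).
  by apply/funext => u; rewrite -EFinD E.
case: (gops _ _ _ _ _) => //= r; rewrite -EFinD => -[<-].
by rewrite addrK.
Qed.

(** Each factor [expR (u x)] pulled out by [gops_shift] adds one variance to the drift seen by the
    remaining ones, so [n] factors produce n(n - 1)/2 of them. *)
Lemma gops_expRM (n : nat) x u :
  gops b s ks (fun u => (expR (n%:R * u x))%:E) u =
  (expR (n%:R * u x + s ^+ 2 * cov b ks x x * (n * n.-1)%:R / 2))%:E.
Proof.
elim: n u => [|n IH] u.
  rewrite (_ : (fun u => _) = fun=> 1%E); last by apply/funext => w; rewrite mul0r expR0.
  by rewrite gops_cst mul0n !mul0r mulr0 mul0r addr0 expR0.
rewrite (_ : (fun u => _) = fun u => ((expR (u x))%:E * (expR (n%:R * u x))%:E)%E); last first.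
  by apply/funext => w; rewrite -EFinM -expRD -natr1; congr ((expR _)%:E); ring.
rewrite gops_shift//; last first.
  apply: good_EFin => [w|d T w mw]; first exact: expR_ge0.
  by apply: measurableT_comp => //; exact: measurable_funM.
rewrite IH -EFinM -expRD; congr ((expR _)%:E) => /=.
have -> : (n.+1 * n)%:R = n%:R * n%:R + n%:R :> R by rewrite natrM -natr1 mulrDl mul1r.
have -> : (n * n.-1)%:R = n%:R * n%:R - n%:R :> R.
  by case: n {IH} => [|n]; rewrite ?mul0n ?mulr0 ?subrr//= natrM -natr1; ring.
by rewrite -natr1; field.
Qed.

Lemma mean_expRX x n :
  mean (fun u => expR (u x) ^+ n) (expR (s ^+ 2 * cov b ks x x * (n * n.-1)%:R / 2)).
Proof.
rewrite (_ : (fun u => _) = fun u => expR (n%:R * u x)); last first.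
  by apply/funext => u; rewrite expRM_natl.
split; last by rewrite gops_expRM mulr0 add0r.
apply: good_EFin => [w|d T w mw]; first exact: expR_ge0.
by apply: measurableT_comp => //; exact: measurable_funM.
Qed.

Lemma mean_expR x : mean (fun u => expR (u x)) 1.
Proof.
have := mean_expRX x 1; rewrite muln0 mulr0 mul0r expR0.
by under eq_fun do rewrite expr1.
Qed.

Lemma mean_expR2 x y :
  mean (fun u => expR (u x) * expR (u y)) (expR (s ^+ 2 * cov b ks x y)).
Proof.
split.
  apply: good_EFin => [w|d T w mw]; first by rewrite mulr_ge0 ?expR_ge0.
  by apply: measurable_funM => //; exact: measurableT_comp.
rewrite (_ : (fun u => _) = fun u => ((expR (u y))%:E * (expR (u x))%:E)%E); last first.
  by apply/funext => w; rewrite -EFinM mulrC.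
rewrite gops_shift//; last exact: good_expR.
rewrite (_ : (fun u : Sg -> R => _) = fun u => (expR (1%:R * u x))%:E); last first.
  by apply/funext => w; rewrite mul1r.
by rewrite gops_expRM/= muln0 mulr0 mul0r addr0 expR0 mul1e mul1r add0r.
Qed.

Let good_subX x n : ~~ odd n -> good (fun u : Sg -> R => ((expR (u x) - 1) ^+ n)%:E).
Proof.
move=> n2; apply: good_EFin => [w|d T w mw]; first by rewrite exprn_even_ge0.
apply: measurable_funX; apply: measurable_funB => //; exact: measurableT_comp.
Qed.

Lemma mean_sub2 x : mean (fun u => (expR (u x) - 1) ^+ 2) (expR (s ^+ 2 * cov b ks x x) - 1).
Proof.
have -> : expR (s ^+ 2 * cov b ks x x) - 1 =
    expR (s ^+ 2 * cov b ks x x * (2 * 1)%:R / 2) + 1 - 2 * 1.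
  by rewrite muln1 mulfK//; ring.
apply: (@mean_sub _ (fun u => 2 * expR (u x)) (fun u => expR (u x) ^+ 2 + 1)).
- exact: good_subX.
- by apply: meanZ => //; exact: mean_expR.
- by apply: meanD; [exact: (mean_expRX x 2)|exact: mean_cst].
- by move=> u; ring.
Qed.

(** In the binomial expansion the k-th power of [expR (u x)] has mean exp(w k(k - 1)/2): hence the
    exponents 6, 3 and 1, while -3 collects the terms k = 1 and k = 0. *)
Lemma mean_sub4 x (w := s ^+ 2 * cov b ks x x) :
  mean (fun u => (expR (u x) - 1) ^+ 4)
    (expR (6 * w) - 4 * expR (3 * w) + 6 * expR w - 3).
Proof.
have -> : expR (6 * w) - 4 * expR (3 * w) + 6 * expR w - 3 =
   (expR (w * (4 * 3)%:R / 2) + 6 * expR (w * (2 * 1)%:R / 2) + 1) -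
   (4 * expR (w * (3 * 2)%:R / 2) + 4 * 1).
  have -> : 6 * w = w * (4 * 3)%:R / 2 by field.
  have -> : 3 * w = w * (3 * 2)%:R / 2 by field.
  by rewrite muln1 mulfK//; ring.
apply: (@mean_sub _ (fun u => 4 * expR (u x) ^+ 3 + 4 * expR (u x))
  (fun u => expR (u x) ^+ 4 + 6 * expR (u x) ^+ 2 + 1)).
- exact: good_subX.
- apply: meanD; (apply: meanZ; first by []); [exact: mean_expRX|exact: mean_expR].
- apply: meanD; last exact: mean_cst.
  apply: meanD; first exact: mean_expRX.
  by apply: meanZ => //; exact: mean_expRX.
- by move=> u; ring.
Qed.

End mean.

(** * Kahane's comparison for moments of partition functions *)

Section kahane.
Context {R : realType} (Sg : finType) (t : R).
Hypothesis t01 : 0 < t < 1.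
Implicit Types (v p : Sg -> R) (s V : R).

Definition wsum v (u : Sg -> R) : R := \sum_x v x * expR (u x).
Definition powsum v (u : Sg -> R) : \bar R := (wsum v u `^ t)%:E.

Lemma wsum_ge0 v u : (forall x, 0 <= v x) -> 0 <= wsum v u.
Proof. by move=> v0; apply: sumr_ge0 => x _; rewrite mulr_ge0// expR_ge0. Qed.

Lemma measurable_wsum v d (T : measurableType d) (u : T -> Sg -> R) :
  (forall x, measurable_fun setT (fun z => u z x)) ->
  measurable_fun setT (fun z => wsum v (u z)).
Proof.
move=> mu; apply: measurable_sum => x; apply: measurable_funM => //.
exact: measurableT_comp.
Qed.

Lemma good_wsum v : (forall x, 0 <= v x) -> good (fun u => (wsum v u)%:E).
Proof.
by move=> v0; apply: good_EFin => [u|d T u mu]; [exact: wsum_ge0|exact: measurable_wsum].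
Qed.

Lemma good_powsum v : good (powsum v).
Proof.
apply: good_EFin => [u|d T u mu]; first exact: powR_ge0.
by apply: (measurableT_comp (measurable_powR t)); exact: measurable_wsum.
Qed.

Lemma wsum_add v u w : wsum v (fun x => u x + w x) = wsum (fun x => v x * expR (w x)) u.
Proof. by apply: eq_bigr => x _; rewrite expRD; ring. Qed.

Let c := t * (1 - t) / 2.

Let c0 : 0 <= c.
Proof. by case/andP: t01 => ? ?; rewrite /c divr_ge0// mulr_ge0//; lra. Qed.

(* By AM-GM the cubic Taylor remainder is split into even moments, whose
   Gaussian means are explicit. *)
Let D p s (u : Sg -> R) : R := \sum_x p x *
  (8 * s * (expR (u x) - 1) ^+ 2 + 8 / s * (expR (u x) - 1) ^+ 4).

Lemma step_pointwise p s u : (forall x, 0 <= p x) -> \sum_x p x = 1 -> 0 < s ->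
  `|wsum p u `^ t - (1 + t * (wsum p u - 1) - c * (wsum p u - 1) ^+ 2)| <= D p s u.
Proof.
move=> p0 p1 s0; apply: (le_trans (powR_taylor t01 (wsum_ge0 u p0))).
have -> : wsum p u - 1 = \sum_x p x * (expR (u x) - 1).
  rewrite -{1}p1 -sumrB; apply: eq_bigr => x _; ring.
set y := \sum_x _.
have y2 : y ^+ 2 <= \sum_x p x * (expR (u x) - 1) ^+ 2 by exact: sqr_sum_le.
have y4 : y ^+ 4 <= \sum_x p x * (expR (u x) - 1) ^+ 4.
  rewrite -[y ^+ 4]/(y ^+ (2 * 2)) exprM.
  have h : 0 <= \sum_x p x * (expR (u x) - 1) ^+ 2.
    by apply: sumr_ge0 => x _; rewrite mulr_ge0// sqr_ge0.
  apply: (@le_trans _ _ ((\sum_x p x * (expR (u x) - 1) ^+ 2) ^+ 2)).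
    by rewrite lerXn2r ?nnegrE ?sqr_ge0.
  apply: (le_trans (sqr_sum_le _ p0 p1)).
  by apply: ler_sum => x _; rewrite -exprM.
apply: (@le_trans _ _ (8 * s * y ^+ 2 + 8 / s * y ^+ 4)).
  have -> : y ^+ 4 = `|y| ^+ 4 by rewrite -normrX ger0_norm// exprn_even_ge0.
  have -> : y ^+ 2 = `|y| ^+ 2 by rewrite -normrX ger0_norm// exprn_even_ge0.
  rewrite -subr_ge0.
  have -> : 8 * s * `|y| ^+ 2 + 8 / s * `|y| ^+ 4 - 16 * `|y| ^+ 3 =
     8 / s * (`|y| * (s - `|y|)) ^+ 2 by field; rewrite gt_eqF.
  by rewrite mulr_ge0 ?sqr_ge0// divr_ge0// ltW.
rewrite /D; under [leRHS]eq_bigr do rewrite mulrDr mulrCA [X in _ + X]mulrCA.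
rewrite big_split/= -!mulr_sumr lerD// ler_wpM2l//; first by rewrite mulr_ge0// ltW.
by rewrite divr_ge0// ltW.
Qed.

Section one_step.
Context {K : Type} (b : K -> Sg -> R) (ks : seq K) (V : R).
Hypothesis covV : forall x, 0 <= cov b ks x x <= V.

Let M : R := expR 1.
(** The two terms come from the second and the fourth moment in [D], with s^2 V bounding the
    variance; 48 is 8 times the 6 of [fourth_moment_le]. *)
Let C := 8 * V * M + 48 * M ^+ 6 * V ^+ 2.

Let mean_D p s : (forall x, 0 <= p x) -> \sum_x p x = 1 -> 0 < s -> s ^+ 2 * V <= 1 ->
  exists2 m, mean b s ks (D p s) m & m <= C * s ^+ 3.
Proof.
move=> p0 p1 s0 sV.
pose w x := s ^+ 2 * cov b ks x x.
have w01 x : 0 <= w x <= 1.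
  have /andP[h1 h2] := covV x; rewrite mulr_ge0 ?sqr_ge0//=.
  by apply: le_trans sV; rewrite ler_wpM2l// sqr_ge0.
have wV x : w x <= s ^+ 2 * V.
  by have /andP[h1 h2] := covV x; rewrite ler_wpM2l// sqr_ge0.
exists (\sum_x p x * (8 * s * (expR (w x) - 1) + 8 / s *
   (expR (6 * w x) - 4 * expR (3 * w x) + 6 * expR (w x) - 3))).
  apply: mean_sum => x; apply: meanZ => //; apply: meanD; apply: meanZ.
  - by rewrite mulr_ge0// ltW.
  - exact: mean_sub2.
  - by rewrite divr_ge0// ltW.
  - exact: mean_sub4.
rewrite -[leRHS]mul1r -[X in _ <= X * _]p1 mulr_suml; apply: ler_sum => x _; rewrite ler_wpM2l//.
have /andP[wx0 wx1] := w01 x.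
have M0 : 0 < M by exact: expR_gt0.
have h1 : expR (w x) - 1 <= s ^+ 2 * V * M.
  apply: (le_trans (expR_sub1_le _)); rewrite ler_pM ?expR_ge0//.
  by rewrite ler_expR.
have h2 := fourth_moment_le (w01 x).
have h3 : 6 * M ^+ 6 * w x ^+ 2 <= 6 * M ^+ 6 * (s ^+ 2 * V) ^+ 2.
  rewrite ler_wpM2l ?mulr_ge0 ?exprn_ge0 ?(ltW M0)//.
  by rewrite lerXn2r ?nnegrE//; exact: le_trans (wV x).
have -> : C * s ^+ 3 = 8 * s * (s ^+ 2 * V * M) + 8 / s * (6 * M ^+ 6 * (s ^+ 2 * V) ^+ 2).
  by rewrite /C; field; rewrite gt_eqF.
apply: lerD; apply: ler_wpM2l => //.
- by rewrite mulr_ge0// ltW.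
- by rewrite divr_ge0// ltW.
- exact: le_trans h2 h3.
Qed.

(** With c = t(1 - t)/2, the mean of Z^t is 1 - c(q - 1) up to order s^3, where [q] is the second
    moment of Z: the covariance enters only through [q], and with a negative sign. Terms carrying a
    minus sign are transposed, whence the extra [c] on both sides. *)
Lemma step_mean p s (q := \sum_x \sum_y p x * p y * expR (s ^+ 2 * cov b ks x y)) :
  (forall x, 0 <= p x) -> \sum_x p x = 1 -> 0 < s -> s ^+ 2 * V <= 1 ->
  (gops b s ks (powsum p) (fun=> 0%R) + (c * q + c)%:E <= (1 + 2 * c + C * s ^+ 3)%:E /\
  (1 + 2 * c)%:E <= gops b s ks (powsum p) (fun=> 0%R) + (c * q + c + C * s ^+ 3)%:E)%E.
Proof.
move=> p0 p1 s0 sV.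
have [m [gD mD] mC] := mean_D p0 p1 s0 sV.
have mq : mean b s ks (fun u => c * wsum p u ^+ 2 + c) (c * q + c).
  apply: meanD; last exact: mean_cst.
  apply: meanZ => //.
  rewrite (_ : (fun u => _) = fun u : Sg -> R => \sum_x \sum_y p x * p y * (expR (u x) * expR (u y))).
    apply: mean_sum => x; apply: mean_sum => y; apply: meanZ; first exact: mulr_ge0.
    exact: mean_expR2.
  apply/funext => u; rewrite expr2 /wsum mulr_suml; apply: eq_bigr => x _.
  by rewrite mulr_sumr; apply: eq_bigr => y _; ring.
have t0 : 0 < t by case/andP: t01.
have t1 : t < 1 by case/andP: t01.
have mr : mean b s ks (fun u => (1 - t) + (t + 2 * c) * wsum p u) (1 + 2 * c).
  have -> : 1 + 2 * c = (1 - t) + (t + 2 * c) * \sum_x p x * 1.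
    by under eq_bigr do rewrite mulr1; rewrite p1; ring.
  apply: meanD; first by apply: mean_cst; lra.
  apply: meanZ; first by apply: addr_ge0; [exact: ltW|exact: mulr_ge0].
  by apply: mean_sum => x; apply: meanZ => //; exact: mean_expR.
have mrD : mean b s ks (fun u => (1 - t) + (t + 2 * c) * wsum p u + D p s u) (1 + 2 * c + m).
  exact: meanD.
have mqD : mean b s ks (fun u => c * wsum p u ^+ 2 + c + D p s u) (c * q + c + m).
  exact: meanD.
have addG f n : mean b s ks f n -> (gops b s ks (powsum p) (fun=> 0%R) + n%:E =
    gops b s ks (fun u => (wsum p u `^ t + f u)%:E) (fun=> 0%R))%E.
  move=> [gf fn]; rewrite -fn.
  have := congr1 (@^~ (fun=> 0%R)) (gopsD b s ks (good_powsum p) gf) => /= <-.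
  by congr (gops _ _ _ _ _); apply/funext => u.
have gadd f n : mean b s ks f n -> good (fun u => (wsum p u `^ t + f u)%:E).
  by move=> [gf fn]; under eq_fun do rewrite EFinD; apply: goodD => //; exact: good_powsum.
split.
  rewrite (addG _ _ mq); apply: (@le_trans _ _ (1 + 2 * c + m)%:E); last by rewrite lee_fin lerD2l.
  rewrite -mrD.2; apply: gops_le; [exact: gadd mq|exact: mrD.1|] => u.
  rewrite lee_fin; have := step_pointwise u p0 p1 s0; rewrite ler_norml; lra.
apply: (@le_trans _ _ (gops b s ks (powsum p) (fun=> 0%R) + (c * q + c + m)%:E)%E); last first.
  by rewrite leeD2l// lee_fin lerD2l.
rewrite (addG _ _ mqD) -mr.2; apply: gops_le; [exact: mr.1|exact: gadd mqD|] => u.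
rewrite lee_fin; have := step_pointwise u p0 p1 s0; rewrite ler_norml; lra.
Qed.

End one_step.
End kahane.

Section kahane2.
Context {R : realType} (Sg : finType) (t : R).
Hypothesis t01 : 0 < t < 1.
Context {K1 K0 : Type} (b1 : K1 -> Sg -> R) (b0 : K0 -> Sg -> R)
  (ks1 : seq K1) (ks0 : seq K0).
Hypothesis cov01 : forall x y, cov b0 ks0 x y <= cov b1 ks1 x y.

Local Notation H v := (powsum t v).
Let V : R := \sum_x cov b1 ks1 x x.

Lemma cov_ge0 {K : Type} (b : K -> Sg -> R) ks x : 0 <= cov b ks x x.
Proof. by apply: sumr_ge0 => k _; rewrite -expr2 sqr_ge0. Qed.

Let cov1V x : 0 <= cov b1 ks1 x x <= V.
Proof.
rewrite cov_ge0/= /V (bigD1 x)//= lerDl; apply: sumr_ge0 => y _; exact: cov_ge0.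
Qed.

Let cov0V x : 0 <= cov b0 ks0 x x <= V.
Proof.
by rewrite cov_ge0/= (le_trans (cov01 x x))//; case/andP: (cov1V x).
Qed.

(** Twice the constant of [step_mean], which is applied once to each field. *)
Let C := 2 * (8 * V * expR 1 + 48 * expR 1 ^+ 6 * V ^+ 2).

Let V0 : 0 <= V. Proof. by apply: sumr_ge0 => x _; exact: cov_ge0. Qed.

Let C0 : 0 <= C.
Proof. by rewrite mulr_ge0// addr_ge0// !mulr_ge0 ?exprn_ge0 ?expR_ge0 ?V0. Qed.

Lemma one_step_prob p s : (forall x, 0 <= p x) -> \sum_x p x = 1 -> 0 < s ->
  s ^+ 2 * V <= 1 ->
  (gops b1 s ks1 (H p) (fun=> 0%R) <=
   gops b0 s ks0 (H p) (fun=> 0%R) + (C * s ^+ 3)%:E)%E.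
Proof.
move=> p0 p1 s0 sV.
have [h1 _] := step_mean t01 cov1V p0 p1 s0 sV.
have [_ h2] := step_mean t01 cov0V p0 p1 s0 sV.
have h3 : \sum_x \sum_y p x * p y * expR (s ^+ 2 * cov b0 ks0 x y) <=
          \sum_x \sum_y p x * p y * expR (s ^+ 2 * cov b1 ks1 x y).
  apply: ler_sum => x _; apply: ler_sum => y _; rewrite ler_wpM2l ?mulr_ge0//.
  by rewrite ler_expR ler_wpM2l// sqr_ge0.
have t2 : 0 <= t * (1 - t) / 2.
  by case/andP: t01 => ? ?; rewrite divr_ge0// mulr_ge0//; lra.
have {h3} := ler_wpM2l t2 h3.
move: h1 h2; rewrite /C.
have := good_ge0 (fun=> 0) (gops_good b1 s ks1 (good_powsum t p)).
have := good_ge0 (fun=> 0) (gops_good b0 s ks0 (good_powsum t p)).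
case: (gops b1 _ _ _ _) => [x| |]//; case: (gops b0 _ _ _ _) => [y| |]// _ _.
- by rewrite -!EFinD !lee_fin; lra.
- by move=> *; rewrite addye// leey.
Qed.

(** The state [u] is absorbed in the weights, which homogeneity then normalizes to probabilities.
    The error is multiplied by S^t, at most 1 + S: this bound, affine in [wsum], is stable under
    averaging. *)
Lemma one_step v s u : (forall x, 0 <= v x) -> 0 < s -> s ^+ 2 * V <= 1 ->
  (gops b1 s ks1 (H v) u <=
   gops b0 s ks0 (H v) u + (C * s ^+ 3 * (1 + wsum v u))%:E)%E.
Proof.
move=> v0 s0 sV.
have E (K : Type) (b : K -> Sg -> R) ks : gops b s ks (H v) u =
    gops b s ks (H (fun x => v x * expR (u x))) (fun=> 0).
  rewrite {1}(_ : u = fun x => (fun=> 0) x + u x); last first.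
    by apply/funext => x; rewrite add0r.
  rewrite gops_translate.
  have -> : (fun w : Sg -> R => H v (fun x => w x + u x)) = H (fun x => v x * expR (u x)).
    by apply/funext => w; rewrite /powsum wsum_add.
  by [].
rewrite (E _ b1) (E _ b0); set w := fun x => _; have w0 x : 0 <= w x by rewrite mulr_ge0// expR_ge0.
have -> : wsum v u = \sum_x w x by [].
set S := \sum_x w x; have S0 : 0 <= S by exact: sumr_ge0.
have [Se|Sn] := eqVneq S 0.
  have wz x : w x = 0.
    by have /psumr_eq0P := Se; apply.
  have -> : H w = fun=> 0%:E.
    apply/funext => z; rewrite /powsum /wsum big1 ?powR0//.
      by rewrite gt_eqF//; case/andP: t01.
    by move=> x _; rewrite wz mul0r.
  by rewrite !gops_cst add0e lee_fin Se addr0 mulr1 mulr_ge0// exprn_ge0// ltW.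
have Sp : 0 < S by rewrite lt_neqAle eq_sym Sn.
pose p x := w x / S.
have p0 x : 0 <= p x by rewrite divr_ge0.
have p1 : \sum_x p x = 1 by rewrite -mulr_suml divff.
have HE : H w = fun z => ((S `^ t)%:E * H p z)%E.
  apply/funext => z; rewrite /powsum -EFinM -powRM//; last exact: wsum_ge0.
  congr ((_ `^ _)%:E); rewrite /wsum mulr_sumr; apply: eq_bigr => x _.
  by rewrite mulrA /p mulrCA divff// mulr1.
have St : (0 <= (S `^ t)%:E)%E by rewrite lee_fin powR_ge0.
have gp := good_powsum t p.
rewrite HE (gopsZ b1 s ks1 St gp) (gopsZ b0 s ks0 St gp).
apply: (le_trans (lee_wpmul2l St (one_step_prob p0 p1 s0 sV))).
rewrite ge0_muleDr//; last 2 first.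
- exact/good_ge0/gops_good/good_powsum.
- by rewrite lee_fin mulr_ge0// exprn_ge0// ltW.
rewrite leeD2l// -EFinM lee_fin mulrC ler_wpM2l//.
  by rewrite mulr_ge0// exprn_ge0// ltW.
apply: (le_trans (powR_le_affine t01 S0)).
by case/andP: t01 => ? ?; nra.
Qed.

(** [wsum] is a martingale along the averages, so the one-step errors add up without being
    amplified. *)
Lemma gops_wsum {K : Type} (b : K -> Sg -> R) ks s v u (k : R) :
  0 <= k -> 0 < s -> (forall x, 0 <= v x) ->
  gops b s ks (fun u => (k * (1 + wsum v u))%:E) u = (k * (1 + wsum v u))%:E.
Proof.
move=> k0 s0 v0.
rewrite {1}(_ : u = fun x => (fun=> 0) x + u x); last first.
  by apply/funext => x; rewrite add0r.
rewrite gops_translate.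
have [_] : mean b s ks (fun w => k * (1 + \sum_x v x * expR (u x) * expR (w x)))
    (k * (1 + \sum_x v x * expR (u x) * 1)).
  apply: meanZ => //; apply: meanD; first exact: mean_cst.
  apply: mean_sum => x; apply: meanZ; first by rewrite mulr_ge0// expR_ge0.
  exact: mean_expR.
under [in X in _ = X -> _]eq_bigr do rewrite mulr1.
move=> <-.
rewrite (_ : (fun w => (k * (1 + wsum v _))%:E) =
  (fun w => (k * (1 + \sum_x v x * expR (u x) * expR (w x)))%:E))//.
by apply/funext => w; rewrite wsum_add.
Qed.

Lemma iter_gops_good {K : Type} (b : K -> Sg -> R) ks s n F : good F ->
  good (iter n (gops b s ks) F).
Proof. by move=> gF; elim: n => // n IH; exact: gops_good. Qed.

Lemma iter_gops {K : Type} (b : K -> Sg -> R) ks s n F : 0 < s -> good F ->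
  iter n.+1 (gops b s ks) F = gops b (s * Num.sqrt n.+1%:R) ks F.
Proof.
move=> s0 gF; elim: n => [|n IH]; first by rewrite /= sqrtr1 mulr1.
rewrite iterS IH -(gops_conv _ _ s0 _ (c := s * Num.sqrt n.+2%:R))//.
- by rewrite mulr_gt0// sqrtr_gt0.
- by rewrite mulr_gt0// sqrtr_gt0.
- rewrite !exprMn !sqr_sqrtr// -[in LHS]natr1; ring.
Qed.

Lemma iter_step v s n u : (forall x, 0 <= v x) -> 0 < s -> s ^+ 2 * V <= 1 ->
  (iter n (gops b1 s ks1) (H v) u <=
   iter n (gops b0 s ks0) (H v) u + (n%:R * (C * s ^+ 3) * (1 + wsum v u))%:E)%E.
Proof.
move=> v0 s0 sV; have gH := good_powsum t v.
have k0 : 0 <= C * s ^+ 3 by rewrite mulr_ge0// exprn_ge0// ltW.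
have ge k : 0 <= k -> good (fun u => (k * (1 + wsum v u))%:E).
  move=> k0'; under eq_fun do rewrite EFinM EFinD.
  by apply: goodM; [exact: good_cst|apply: goodD; [exact: good_cst|exact: good_wsum]].
elim: n u => [|n IH] u.
  by rewrite /= mul0r mul0r adde0.
have nk0 : 0 <= n%:R * (C * s ^+ 3) by rewrite mulr_ge0.
rewrite iterS.
apply: (@le_trans _ _ (gops b1 s ks1 (fun u => iter n (gops b0 s ks0) (H v) u +
    (n%:R * (C * s ^+ 3) * (1 + wsum v u))%:E)%E u)).
  apply: gops_le => //; first exact: iter_gops_good.
  by apply: goodD; [exact: iter_gops_good|exact: ge].
rewrite gopsD; [|exact: iter_gops_good|exact: ge].
rewrite gops_wsum//.
(* The averages commute, so the increment to be exchanged is brought next to [H v], where [one_step]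
   applies. *)
have -> : gops b1 s ks1 (iter n (gops b0 s ks0) (H v)) =
    iter n (gops b0 s ks0) (gops b1 s ks1 (H v)).
  elim: n {IH nk0} => // n IHn.
  by rewrite !iterS gops_comm ?IHn//; exact: iter_gops_good.
have : (iter n (gops b0 s ks0) (gops b1 s ks1 (H v)) u <=
        iter n.+1 (gops b0 s ks0) (H v) u + (C * s ^+ 3 * (1 + wsum v u))%:E)%E.
  elim: n {IH nk0} u => [|n IHn] u; first exact: one_step.
  rewrite iterS.
  apply: (@le_trans _ _ (gops b0 s ks0 (fun u => iter n.+1 (gops b0 s ks0) (H v) u +
      (C * s ^+ 3 * (1 + wsum v u))%:E)%E u)).
    apply: gops_le => //; first by apply: iter_gops_good; exact: gops_good.
    by apply: goodD; [exact: iter_gops_good|exact: ge].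
  by rewrite gopsD ?gops_wsum//; [exact: iter_gops_good|exact: ge].
move=> h; apply: (le_trans (leeD2r _ h)).
rewrite -addeA leeD2l// -EFinD lee_fin -natr1 le_eqVlt; apply/orP; left; apply/eqP; ring.
Qed.

(* Lindeberg's argument: a unit Gaussian field is a sum of [n] independent ones
   of variance [1 / n]; exchanging them one at a time costs [O(n^(-3/2))] each. *)
Theorem kahane v u : (forall x, 0 <= v x) ->
  (gops b1 1 ks1 (H v) u <= gops b0 1 ks0 (H v) u)%E.
Proof.
move=> v0; apply/lee_addgt0Pr => e e0.
pose A := C * (1 + wsum v u).
have A0 : 0 <= A by rewrite mulr_ge0// addr_ge0// wsum_ge0.
(* The step variance is the inverse of n + 1. Exceeding [V] makes the step admissible; exceeding
   [(A / e) ^+ 2] brings the accumulated error A / sqrt(n + 1) below [e]. *)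
pose n := (Num.truncn (V + (A / e) ^+ 2)).
have nlt : V + (A / e) ^+ 2 < n.+1%:R by exact: truncnS_gt.
have Ae0 : 0 <= (A / e) ^+ 2 by exact: sqr_ge0.
set q := Num.sqrt n.+1%:R : R.
have q0 : 0 < q by rewrite sqrtr_gt0.
have q2 : q ^+ 2 = n.+1%:R by rewrite sqr_sqrtr.
have s0 : 0 < q^-1 by rewrite invr_gt0.
have sV : q^-1 ^+ 2 * V <= 1.
  by rewrite exprVn q2 mulrC ler_pdivrMr// mul1r ltW//; apply: le_lt_trans nlt; rewrite lerDl.
have := @iter_step v q^-1 n.+1 u v0 s0 sV.
rewrite !iter_gops//; [|exact: good_powsum|exact: good_powsum].
rewrite -/q mulVf ?gt_eqF// => h; apply: (le_trans h); rewrite leeD2l// lee_fin.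
have -> : n.+1%:R * (C * q^-1 ^+ 3) * (1 + wsum v u) = A / q.
  by rewrite -q2 /A; field; rewrite gt_eqF.
rewrite ler_pdivrMr// mulrC -ler_pdivrMr//.
have Aq : (A / e) ^+ 2 <= q ^+ 2 by rewrite q2 ltW//; apply: le_lt_trans nlt; rewrite lerDr.
by rewrite ler_sqr ?nnegrE ?(ltW q0) ?(divr_ge0 A0 (ltW e0)) in Aq.
Qed.

End kahane2.

(** * Independence and joint integrals *)

Section indep_integral.
Context d (T : measurableType d) (R : realType) (P : probability T R).
Context d1 (T1 : measurableType d1) d2 (T2 : measurableType d2) (mu : probability T2 R).
Variables (phi : T -> T1) (X : T -> T2).
Hypotheses (mphi : measurable_fun setT phi) (mX : measurable_fun setT X).
Hypothesis indep : forall A B, measurable A -> measurable B ->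
  P (phi @^-1` A `&` X @^-1` B) = (P (phi @^-1` A) * mu B)%E.

Lemma ge0_integral_indep (f : T1 * T2 -> \bar R) :
  measurable_fun setT f -> (forall z, 0 <= f z)%E ->
  (\int[P]_w f (phi w, X w) = \int[P]_w \int[mu]_x f (phi w, x))%E.
Proof.
move=> mf f0.
have mpair : measurable_fun setT (fun w => (phi w, X w)) by exact: measurable_fun_pair.
pose mphi_mixin := isMeasurableFun.Build _ _ _ _ _ mphi.
pose Phi : {RV P >-> T1} := HB.pack phi mphi_mixin.
pose mpair_mixin := isMeasurableFun.Build _ _ _ _ _ mpair.
pose Pair : {RV P >-> (T1 * T2)%type} := HB.pack (fun w => (phi w, X w)) mpair_mixin.
transitivity (\int[distribution P Pair]_z f z)%E.
  by rewrite ge0_integral_distribution.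
transitivity (\int[distribution P Phi \x mu]_z f z)%E.
  apply: eq_measure_integral => A mA _; apply/esym/product_measure_unique => //.
rewrite fubini_tonelli1// ge0_integral_distribution//.
- exact: measurable_fun_fubini_tonelli_F.
- by move=> x; exact: integral_ge0.
Qed.

End indep_integral.

(** * Sigma-algebras generated by blocks of sources *)

Section blocks.
Context d (T : measurableType d) (R : realType) (P : probability T R).
Context (I : finType) (F : I -> set_system T).
Hypothesis indF : mutually_independent P F.
Hypothesis FT : forall i, F i setT.
Hypothesis Fm : forall i, F i `<=` measurable.
Hypothesis FI : forall i, setI_closed (F i).
Implicit Types J : {set I}.

(** A pi-system generating the sigma-algebra of the block [J]; since each source contains [setT], it
    grows with [J]. *)
Definition cylinders J : set_system T :=
  [set C | exists2 A : I -> set T, (forall i, F i (A i)) &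
    C = \bigcap_(i in [set` J]) A i].

Lemma cylindersT J : cylinders J setT.
Proof. by exists (fun=> setT) => //; apply/esym/seteqP; split => x. Qed.

Lemma cylinders_measurable J : cylinders J `<=` measurable.
Proof.
move=> _ [A FA ->]; apply: fin_bigcap_measurable => // i _; exact: Fm.
Qed.

Lemma cylinders_setI J : setI_closed (cylinders J).
Proof.
move=> _ _ [A FA ->] [B FB ->]; exists (fun i => A i `&` B i).
  by move=> i; exact: FI.
by rewrite bigcapI.
Qed.

Lemma sub_cylinders J i : i \in J -> F i `<=` cylinders J.
Proof.
move=> iJ B FB; exists (fun j => if j == i then B else setT).
  by move=> j; case: eqP => [->|].
apply/seteqP; split => [x Bx j _ /=|x /(_ i)/=]; first by case: ifP.
by rewrite eqxx; apply.
Qed.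

Definition adapted J d' (T' : measurableType d') (X : T -> T') :=
  measurable_fun setT (X : g_sigma_algebraType (cylinders J) -> T').

Lemma cylinders_mono J J' : J \subset J' -> cylinders J `<=` cylinders J'.
Proof.
move=> JJ' _ [A FA ->]; exists (fun i => if i \in J then A i else setT).
  by move=> i; case: ifP.
apply/seteqP; split => x /= h i iJ /=.
  by case: ifP => // iJ0; exact: h.
by have := h i (fintype.subsetP JJ' _ iJ); rewrite /= (_ : i \in J)//.
Qed.

Lemma adapted_mono J J' d' (T' : measurableType d') (X : T -> T') :
  J \subset J' -> adapted J X -> adapted J' X.
Proof.
move=> JJ' mX mT B mB; apply: (sub_smallest2r _ (cylinders_mono JJ')).
  exact: smallest_sigma_algebra.
exact: mX.
Qed.

Lemma adapted_measurable J d' (T' : measurableType d') (X : T -> T') :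
  adapted J X -> measurable_fun setT X.
Proof.
move=> mX mT B mB; have := mX measurableT B mB.
apply: smallest_sub; first exact: sigma_algebra_measurable.
exact: cylinders_measurable.
Qed.

Lemma adapted_source J i d' (T' : measurableType d') (X : T -> T') :
  i \in J -> (forall B, measurable B -> F i (X @^-1` B)) -> adapted J X.
Proof.
move=> iJ FX mT B mB; rewrite setTI; apply: sub_sigma_algebra.
by apply: (sub_cylinders iJ); exact: FX.
Qed.

(** Pi-lambda argument: for fixed [B], the finite measures sending [A] to P(A and B) and to P(A)
    P(B) agree on the cylinders of [J]. *)
Lemma indep_block J i A B : i \notin J -> <<s cylinders J >> A -> F i B ->
  P (A `&` B) = (P A * P B)%E.
Proof.
move=> iJ sA FB.
have mB : measurable B by exact: Fm FB.
have PB : P B = (fine (P B))%:E by rewrite fineK// fin_num_measure.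
have PB0 : 0 <= fine (P B) by rewrite fine_ge0.
pose m1 := mrestr P mB.
pose m2 := mscale (NngNum PB0) P.
rewrite -[LHS]/(m1 A) [RHS](_ : _ = m2 A); last by rewrite /m2 /mscale/= -PB muleC.
apply: (@g_sigma_algebra_measure_unique _ _ _ (cylinders J) _ (fun=> setT)) => //.
- exact: cylinders_measurable.
- by move=> _; exact: cylindersT.
- by rewrite bigcup_const//; exists 0%N.
- exact: cylinders_setI.
- move=> _ [C FC ->].
  rewrite /= /m1 /m2 /mrestr /mscale/= -PB.
  pose C' j := if j == i then B else C j.
  have FC' j : F j (C' j) by rewrite /C'; case: eqP => [->|].
  have -> : \bigcap_(j in [set` J]) C j `&` B = \bigcap_(j in [set` i |: J]) C' j.
    apply/seteqP; split => [x [Cx Bx] j /=|x h].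
      rewrite /C' in_setU1; case: eqP => [//|_ /= jJ]; exact: Cx.
    split; last by have := h i; rewrite /C' /= setU11 eqxx; apply.
    move=> j /= jJ; have := h j; rewrite /C' /= in_setU1 jJ orbT.
    case: eqP => [ji|_]; last exact.
    by rewrite -ji jJ in iJ.
  rewrite (indF FC') (indF FC) big_setU1//= {1}/C' eqxx; congr (_ * _)%E.
  apply: eq_bigr => j jJ; rewrite /C'; case: eqP => // ji.
  by rewrite -ji jJ in iJ.
- move=> _; rewrite [X in (X < _)%E](_ : _ = P (setT `&` B))//.
  by rewrite (le_lt_trans (probability_le1 _ _)) ?ltry// setTI.
Qed.

(** The block enters through the identity map from [T] to [T] with the coarser sigma-algebra of [J];
    its pair with [X] has a product law, so [X] is integrated out while everything adapted to [J]
    stays frozen. *)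
Lemma indep_peel J i d2 (T2 : measurableType d2) (mu : probability T2 R) (X : T -> T2)
    (f : g_sigma_algebraType (cylinders J) * T2 -> \bar R) :
  i \notin J -> (forall B, measurable B -> F i (X @^-1` B)) ->
  (forall B, measurable B -> P (X @^-1` B) = mu B) ->
  measurable_fun setT f -> (forall z, 0 <= f z)%E ->
  (\int[P]_w f (w, X w) = \int[P]_w \int[mu]_x f (w, x))%E.
Proof.
move=> iJ FX lX mf f0.
have mX : measurable_fun setT X.
  by move=> mT B mB; rewrite setTI; exact/Fm/FX.
have mid : measurable_fun setT (fun w : T => w : g_sigma_algebraType (cylinders J)).
  apply: (@adapted_measurable J _ (g_sigma_algebraType (cylinders J)) id).
  exact: measurable_id.
apply: (ge0_integral_indep mid mX _ mf f0) => A B mA mB.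
by rewrite preimage_id -lX// (indep_block iJ mA)//; exact: FX.
Qed.

End blocks.

Section jgood.
Context (R : realType) (Sg : finType) d0 (T0 : measurableType d0).
Local Notation mR := (measurableTypeR R).
Implicit Types G : T0 -> (Sg -> R) -> \bar R.

(** The version of [good] for a functional that also depends on a random parameter, as it does
    through random weights. *)
Definition jgood G :=
  (forall w u, (0 <= G w u)%E) /\
  forall d' (T' : measurableType d') (h : T' -> T0) (u : T' -> Sg -> R),
    measurable_fun setT h -> (forall x, measurable_fun setT (fun z => u z x)) ->
    measurable_fun setT (fun z => G (h z) (u z)).

Lemma jgood_gop G c s : jgood G -> jgood (fun w => gop c s (G w)).
Proof.
move=> gG; split => [w u|d' T' h u mh mu].
  by rewrite gopE; apply: integral_ge0 => g _; exact: gG.1.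
rewrite (_ : (fun z => _) = (fun z => \int[normal_prob 0 s]_g G (h z) (tilt c s g (u z)))%E).
  2: by apply/funext => z; rewrite gopE.
have mz : measurable_fun setT (fun z : T' * mR => G (h z.1) (tilt c s z.2 (u z.1))).
  apply: gG.2; first exact: measurableT_comp.
  move=> x; apply: measurable_funD; first exact: (measurableT_comp (mu x)).
  by apply: measurable_funB => //; exact: measurable_funM.
exact: (measurable_fun_fubini_tonelli_F _ mz (fun z => gG.1 _ _)).
Qed.

Lemma jgood_gops (K : Type) (b : K -> Sg -> R) G s ks :
  jgood G -> jgood (fun w => gops b s ks (G w)).
Proof. by move=> gG; elim: ks => //= k ks IH; exact: jgood_gop. Qed.

Lemma jgood_powsum t (v : T0 -> Sg -> R) :
  (forall x, measurable_fun setT (fun w => v w x)) -> jgood (fun w => powsum t (v w)).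
Proof.
move=> mv; split => [w u|d' T' h u mh mu]; first by rewrite lee_fin powR_ge0.
apply/measurable_EFinP; apply: (measurableT_comp (measurable_powR t)).
apply: measurable_sum => x; apply: measurable_funM.
  exact: (measurableT_comp (mv x)).
exact: measurableT_comp.
Qed.

End jgood.

Section link.
Context d (T : measurableType d) (R : realType) (P : probability T R).
Context (I : finType) (F : I -> set_system T).
Hypothesis indF : mutually_independent P F.
Hypothesis FT : forall i, F i setT.
Hypothesis Fm : forall i, F i `<=` measurable.
Hypothesis FI : forall i, setI_closed (F i).
Implicit Types J : {set I}.
Local Notation mR := (measurableTypeR R).

Section gaussian_link.
Context (Sg : finType) (K : eqType) (sK : K -> I) (W : K -> T -> R)
  (b : K -> Sg -> R).

Definition goodw J (G : T -> (Sg -> R) -> \bar R) :=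
  jgood (G : g_sigma_algebraType (cylinders F J) -> (Sg -> R) -> \bar R).

Lemma goodw_mono J J' G : J \subset J' -> goodw J G -> goodw J' G.
Proof.
move=> JJ' [G0 mG]; split => // d' T' h u mh mu; apply: mG => // mT B mB.
apply: mh => //; apply: (sub_smallest2r _ (cylinders_mono FT JJ') mB).
exact: smallest_sigma_algebra.
Qed.

(** Carries an expectation on the given space to the iterated averages. In the induction the head
    [W k] first joins the known block, so that the tail can be averaged, and is then peeled off as
    one [gop]. *)
Lemma gaussian_link ks J (u : T -> Sg -> R) G :
  uniq [seq sK k | k <- ks] -> (forall k, k \in ks -> sK k \notin J) ->
  (forall k B, k \in ks -> measurable B -> F (sK k) (W k @^-1` B)) ->
  (forall k B, k \in ks -> measurable B -> P (W k @^-1` B) = normal_prob 0 1 B) ->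
  (forall x, adapted F J (fun w => u w x)) -> goodw J G ->
  (\int[P]_w G w (fun x => u w x + \sum_(k <- ks) (b k x * W k w - b k x ^+ 2 / 2))%R =
   \int[P]_w gops b 1 ks (G w) (u w))%E.
Proof.
move=> + + + + + gG.
elim: ks J u gG => [|k ks IH] J u gG uks ksJ FW lW mu.
  apply: eq_integral => w _; congr (G w _); apply/funext => x.
  by rewrite big_nil addr0.
case/andP: uks => kks uks.
have gGs : goodw J (fun w => gops b 1 ks (G w)) by exact: jgood_gops.
pose f (z : g_sigma_algebraType (cylinders F J) * mR) :=
  gops b 1 ks (G z.1) (tilt (b k) 1 z.2 (u z.1)).
have mf : measurable_fun setT f.
  apply: gGs.2 => // x; apply: measurable_funD; first exact: (measurableT_comp (mu x)).
  by apply: measurable_funB => //; exact: measurable_funM.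
have kJ : sK k \notin J by apply: ksJ; rewrite mem_head.
have FWk B : measurable B -> F (sK k) (W k @^-1` B) by apply: FW; rewrite mem_head.
have h := @indep_peel _ T R P I F indF FT Fm FI J (sK k) _ mR (normal_prob 0 1) (W k) f
  kJ FWk (fun B mB => lW k B (mem_head _ _) mB) mf (fun z => gGs.1 _ _).
transitivity (\int[P]_w f (w, W k w))%E; last first.
  by rewrite h; apply: eq_integral => w _; rewrite gops_cons gopE.
rewrite /f /=.
rewrite -(IH (sK k |: J) (fun w => tilt (b k) 1 (W k w) (u w))).
- apply: eq_integral => w _; congr (G w _); apply/funext => x.
  by rewrite big_cons /tilt expr1n mul1r addrA.
- exact: goodw_mono (finset.subsetUr _ _) gG.
- exact: uks.
- move=> j jks; rewrite in_setU1 negb_or ksJ ?inE ?jks ?orbT// andbT.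
  by apply: contraNneq kks => <-; exact: map_f.
- by move=> j B jks; apply: FW; rewrite inE jks orbT.
- by move=> j B jks; apply: lW; rewrite inE jks orbT.
- move=> x; apply: measurable_funD.
    exact: (adapted_mono FT (finset.subsetUr _ _) (mu x)).
  apply: measurable_funB => //; apply: measurable_funM => //.
  by apply: (adapted_source FT (finset.setU11 _ _)).
Qed.

End gaussian_link.

Section sample_product.
Context d2 (T2 : measurableType d2) (p : probability T2 R).
Context (A : eqType) (sA : A -> I) (S : A -> T -> T2).
Hypothesis sAinj : injective sA.
Hypothesis FS : forall a B, measurable B -> F (sA a) (S a @^-1` B).
Hypothesis lS : forall a B, measurable B -> P (S a @^-1` B) = p B.

Lemma adapted_prode J (Psi : A -> T2 -> \bar R) r :
  (forall a, measurable_fun setT (Psi a)) -> (forall a, a \in r -> sA a \in J) ->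
  adapted F J (fun w => \prod_(a <- r) Psi a (S a w))%E.
Proof.
move=> mPsi; elim: r => [|a r IH] rJ.
  rewrite (_ : (fun w => _) = cst 1%E); first exact: measurable_cst.
  by apply/funext => w; rewrite big_nil.
rewrite (_ : (fun w => _) = (fun w => Psi a (S a w) * \prod_(a <- r) Psi a (S a w))%E).
  2: by apply/funext => w; rewrite big_cons.
apply: emeasurable_funM; last by apply: IH => c cr; apply: rJ; rewrite inE cr orbT.
apply: (measurableT_comp (mPsi a)).
by apply: (adapted_source FT (rJ a (mem_head _ _))); exact: FS.
Qed.

Lemma integral_prod_samples (Psi : A -> T2 -> \bar R) r : uniq r ->
  (forall a, measurable_fun setT (Psi a)) -> (forall a t, 0 <= Psi a t)%E ->
  (\int[P]_w \prod_(a <- r) Psi a (S a w) = \prod_(a <- r) \int[p]_t Psi a t)%E.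
Proof.
move=> + mPsi Psi0.
have pr0 r' w : (0 <= \prod_(a <- r') Psi a (S a w))%E.
  by elim/big_ind : _ => // x y x0 y0; exact: mule_ge0.
elim: r => [_|a r IH /= /andP[ar ur]].
  rewrite big_nil (_ : (fun w => _) = cst 1%E).
    by rewrite integral_cst//= probability_setT mule1.
  by apply/funext => w; rewrite big_nil.
pose J := [set i | i \in [seq sA c | c <- r]]%SET.
have saJ : sA a \notin J by rewrite inE mem_map.
have rJ c : c \in r -> sA c \in J by move=> cr; rewrite inE map_f.
have mr := adapted_prode mPsi rJ.
rewrite big_cons -(IH ur).
pose f (z : g_sigma_algebraType (cylinders F J) * T2) :=
  (Psi a z.2 * \prod_(c <- r) Psi c (S c z.1))%E.
have mf : measurable_fun setT f.
  apply: emeasurable_funM; first exact: measurableT_comp.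
  exact: (measurableT_comp mr).
transitivity (\int[P]_w f (w, S a w))%E.
  by apply: eq_integral => w _; rewrite big_cons.
rewrite (@indep_peel _ T R P I F indF FT Fm FI J (sA a) _ T2 p (S a) f saJ (@FS a) (@lS a) mf)//; last first.
  by move=> z; rewrite mule_ge0.
rewrite -ge0_integralZl//; last 2 first.
- exact: adapted_measurable mr.
- exact: integral_ge0.
apply: eq_integral => w _; rewrite /f/= ge0_integralZr//.
Qed.

End sample_product.
End link.

(** * Conditional probabilities and disintegration over the side information *)

Section density_transfer.
Context d (T : measurableType d) d2 (T2 : measurableType d2) (R : realType).
Context (mu : {measure set T -> \bar R}) (phi : T -> T2).
Hypothesis mphi : measurable_fun setT phi.
Local Open Scope ereal_scope.
Import HBNNSimple.

Let indic_comp (B : set T2) : measurable B ->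
  measurable_fun setT (fun t => (\1_B (phi t) : R)%:E).
Proof.
by move=> mB; apply/measurable_EFinP; apply: (measurableT_comp _ mphi); exact: measurable_indic.
Qed.

Lemma integral_nnsfun_density (f : T -> \bar R) (h : {nnsfun T2 >-> R}) :
  measurable_fun setT f -> (forall t, 0 <= f t) ->
  \int[mu]_t (f t * (h (phi t))%:E) =
  \sum_(y \in range h) y%:E * \int[mu]_t (f t * (\1_(h @^-1` [set y]) (phi t))%:E).
Proof.
move=> mf f0.
have y0 y : range h y -> (0 <= y)%R by move=> [x _ <-]; exact: fun_ge0.
transitivity (\int[mu]_t \sum_(y \in range h) (y%:E * (f t * (\1_(h @^-1` [set y]) (phi t))%:E))).
  apply: eq_integral => t _; rewrite fimfunE -fsumEFin// ge0_mule_fsumr; last first.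
    by move=> y; exact: nnfun_muleindic_ge0.
  by apply: eq_fsbigr => y _; rewrite EFinM muleCA.
rewrite ge0_integral_fsum//.
- apply: eq_fsbigr => y /[!inE] ry; rewrite ge0_integralZl//.
  + by apply: emeasurable_funM => //; exact: indic_comp.
  + by move=> t _; rewrite mule_ge0// lee_fin.
  + by rewrite lee_fin y0.
- move=> y; apply: emeasurable_funM; first exact: measurable_cst.
  by apply: emeasurable_funM => //; exact: indic_comp.
- move=> y t _; rewrite muleCA mule_ge0// -EFinM.
  exact: nnfun_muleindic_ge0.
Qed.

(** The hypothesis on indicators says that the two densities have the same conditional expectation
    given [phi]. It extends to simple functions of [phi] by linearity, then to [g] by monotone
    convergence. *)
Lemma ge0_integral_density_transfer (f1 f2 : T -> R) (g : T2 -> \bar R) :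
  measurable_fun setT f1 -> (forall t, 0 <= f1 t)%R ->
  measurable_fun setT f2 -> (forall t, 0 <= f2 t)%R ->
  (forall B, measurable B ->
    \int[mu]_t ((f1 t)%:E * (\1_B (phi t))%:E) = \int[mu]_t ((f2 t)%:E * (\1_B (phi t))%:E)) ->
  measurable_fun setT g -> (forall z, 0 <= g z) ->
  \int[mu]_t ((f1 t)%:E * g (phi t)) = \int[mu]_t ((f2 t)%:E * g (phi t)).
Proof.
move=> mf1 f10 mf2 f20 f12 mg g0.
pose h := nnsfun_approx measurableT mg.
have key (f : T -> R) : measurable_fun setT f -> (forall t, 0 <= f t)%R ->
    \int[mu]_t ((f t)%:E * g (phi t)) =
    limn (fun n => \int[mu]_t ((f t)%:E * (h n (phi t))%:E)).
  move=> mf f0; rewrite -monotone_convergence//.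
  - apply: eq_integral => t _; apply/esym/cvg_lim => //.
    by apply: cvgeZl => //; apply: cvg_nnsfun_approx.
  - move=> n; apply: emeasurable_funM; apply/measurable_EFinP => //.
    exact: measurableT_comp.
  - by move=> n t _; rewrite mule_ge0// lee_fin.
  - move=> t _ m n mn; rewrite lee_wpmul2l ?lee_fin//.
    exact/lefP/nd_nnsfun_approx.
rewrite (key f1)// (key f2)//; congr (limn _); apply/funext => n.
have h1 : measurable_fun setT (fun t => (f1 t)%:E) by exact/measurable_EFinP.
have h2 : measurable_fun setT (fun t => (f2 t)%:E) by exact/measurable_EFinP.
have e1 t : 0 <= (f1 t)%:E by rewrite lee_fin.
have e2 t : 0 <= (f2 t)%:E by rewrite lee_fin.
rewrite (integral_nnsfun_density (h n) h1 e1) (integral_nnsfun_density (h n) h2 e2).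
by apply: eq_fsbigr => y _; rewrite f12.
Qed.

End density_transfer.


Lemma measurable_tuple_bool n (A : set (n.-tuple bool)) : measurable A.
Proof.
rewrite (_ : A = \bigcup_(a in A) [set a]); last first.
  by apply/seteqP; split => [x Ax|x [a Aa ->//]]; exists x.
apply: fin_bigcup_measurable => [|a _]; first exact: finite_finset.
rewrite (_ : [set a] = \bigcap_(i in [set: 'I_n]) ((@tnth n bool)^~ i @^-1` [set tnth a i])).
  apply: fin_bigcap_measurable => [|i _]; first exact: finite_finset.
  by rewrite -[X in measurable X]setTI; exact: measurable_tnth.
apply/seteqP; split => [x -> i//|x h]; apply: eq_from_tnth => i; exact: h.
Qed.

(** The conditional law of x alone: the Hamiltonian does not involve y, so the sum over y can be
    carried out site by site beforehand. *)
Definition pX (R : realType) (L L1 : nat) (Zs : Type)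
  (pc : Zs -> L.-tuple bool -> L1.-tuple bool -> R) (z : Zs) (a : L.-tuple bool) : R :=
  \sum_b pc z a b.

Section disintegration.
Context (R : realType) (L L1 : nat) (dZ : measure_display) (Zs : measurableType dZ).
Local Notation sample := (L.-tuple bool * L1.-tuple bool * Zs)%type.
Context (p : probability sample R) (pc : Zs -> L.-tuple bool -> L1.-tuple bool -> R).
Hypothesis hpc : is_cond_pmf p pc.

Lemma pX_ge0 z a : 0 <= pX pc z a.
Proof. by apply: sumr_ge0 => b _; exact: (cond_pmf_ge0 hpc). Qed.

Lemma pX_sum1 z : \sum_a pX pc z a = 1.
Proof. exact: (cond_pmf_sum1 hpc). Qed.

Lemma measurable_pX a : measurable_fun setT (fun z => pX pc z a).
Proof. by apply: measurable_sum => b; exact: (cond_pmf_measurable hpc). Qed.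

Lemma measurable_eq_spin a : measurable_fun setT (fun t : sample => (t.1.1 == a)%:R : R).
Proof.
rewrite (_ : (fun t => _) = \1_[set t : sample | t.1.1 = a]).
  apply: measurable_indic.
  rewrite -[X in measurable X]setTI.
  apply: (measurableT_comp measurable_fst measurable_fst measurableT (Y := [set a])).
  exact: measurable_tuple_bool.
by apply/funext => t; rewrite indicE; case: eqP => [e|e]; [rewrite mem_set|rewrite memNset].
Qed.

Lemma disintegration a (g : Zs -> \bar R) :
  measurable_fun setT g -> (forall z, 0 <= g z)%E ->
  (\int[p]_t (((t.1.1 == a)%:R : R)%:E * g t.2) = \int[p]_t ((pX pc t.2 a)%:E * g t.2))%E.
Proof.
move=> mg g0.
have mpX : measurable_fun setT (fun t : sample => pX pc t.2 a).
  exact: (measurableT_comp (measurable_pX a) measurable_snd).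
apply: (ge0_integral_density_transfer (measurable_snd) (measurable_eq_spin a) _ mpX) => //.
  by move=> t; exact: pX_ge0.
move=> B mB.
have mB2 : measurable [set t : sample | B t.2].
  by rewrite -[X in measurable X]setTI; exact: measurable_snd.
have mE b : measurable [set t : sample | t.1 = (a, b)].
  rewrite -[X in measurable X]setTI.
  rewrite (_ : _ `&` _ = (setT `&` (fun t : sample => t.1.1) @^-1` [set a]) `&`
     (setT `&` (fun t : sample => t.1.2) @^-1` [set b])).
    apply: measurableI.
      apply: (measurableT_comp measurable_fst measurable_fst measurableT (Y := [set a])).
      exact: measurable_tuple_bool.
    apply: (measurableT_comp measurable_snd measurable_fst measurableT (Y := [set b])).
    exact: measurable_tuple_bool.
  by apply/seteqP; split => [[[x y] z] /= [_ [-> ->]]|[[x y] z] /= [[_ ->] [_ ->]]].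
have mI b : measurable [set t : sample | t.1 = (a, b) /\ B t.2].
  exact: (measurableI _ _ (mE b) mB2).
transitivity (\sum_b p [set t | t.1 = (a, b) /\ B t.2])%E.
  transitivity (\int[p]_t \sum_b (\1_([set t | t.1 = (a, b) /\ B t.2] : set sample) t)%:E)%E.
    apply: eq_integral => -[[x y] z] _ /=; rewrite -EFinM sumEFin; congr (_%:E).
    rewrite (bigD1 y)//= big1 ?addr0; last first.
      by move=> b /eqP bz; rewrite indicE memNset//= => -[[_ yb] _]; exact: bz.
    rewrite !indicE; case: eqP => [->|xa]; last by rewrite mul0r memNset//= => -[[/xa]].
    rewrite mul1r; have [zB|zB] := boolP (z \in B).
      by rewrite mem_set//=; split => //; rewrite inE in zB.
    by rewrite memNset//= => -[_]; move/negP: zB; rewrite inE.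
  rewrite ge0_integral_sum//; last first.
    by move=> b; apply/measurable_EFinP/measurable_indic; exact: mI.
  by apply: eq_bigr => b _; rewrite integral_indic// ?setIT.
under eq_bigr do rewrite (cond_pmf_disintegration hpc _ _ mB).
rewrite -ge0_integral_sum//.
- rewrite integral_mkcond; apply: eq_integral => t _; rewrite patchE /pX indicE.
  case: ifPn => tB; first by rewrite sumEFin mem_set ?mule1//; rewrite inE in tB.
  by rewrite memNset ?mule0//; move/negP: tB; rewrite inE.
- move=> b; apply/measurable_EFinP; apply: measurable_funTS.
  exact: (measurableT_comp (cond_pmf_measurable hpc a b) measurable_snd).
- by move=> b t _; rewrite lee_fin (cond_pmf_ge0 hpc).
Qed.

End disintegration.

Section swap.
Context d (T : measurableType d) (R : realType) (P : probability T R).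
Context (I : finType) (F : I -> set_system T).
Hypothesis indF : mutually_independent P F.
Hypothesis FT : forall i, F i setT.
Hypothesis Fm : forall i, F i `<=` measurable.
Hypothesis FI : forall i, setI_closed (F i).
Context (L L1 : nat) (dZ : measure_display) (Zs : measurableType dZ).
Local Notation sample := (L.-tuple bool * L1.-tuple bool * Zs)%type.
Context (p : probability sample R) (pc : Zs -> L.-tuple bool -> L1.-tuple bool -> R).
Hypothesis hpc : is_cond_pmf p pc.
Context (A : finType) (sA : A -> I) (S : A -> T -> sample).
Hypothesis sAinj : injective sA.
Hypothesis FS : forall a B, measurable B -> F (sA a) (S a @^-1` B).
Hypothesis lS : forall a B, measurable B -> P (S a @^-1` B) = p B.

Definition goodz (g : (A -> Zs) -> \bar R) :=
  (forall z, 0 <= g z)%E /\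
  forall d' (T' : measurableType d') (z : T' -> A -> Zs),
    (forall a, measurable_fun setT (fun t => z t a)) ->
    measurable_fun setT (fun t => g (z t)).

Let E (tau : A -> L.-tuple bool) r w : R := \prod_(a <- r) ((S a w).1.1 == tau a)%:R.

Let adapted_E (J : {set I}) tau r : (forall a, a \in r -> sA a \in J) ->
  adapted F J (E tau r).
Proof.
rewrite /E; elim: r => [|a r IH] rJ.
  rewrite (_ : (fun w => _) = cst 1); first exact: measurable_cst.
  by apply/funext => w; rewrite big_nil.
rewrite (_ : (fun w => _) = (fun w => ((S a w).1.1 == tau a)%:R *
    \prod_(c <- r) ((S c w).1.1 == tau c)%:R)).
  2: by apply/funext => w; rewrite big_cons.
apply: measurable_funM; last by apply: IH => c cr; apply: rJ; rewrite inE cr orbT.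
have mSa : adapted F J (S a).
  by apply: (adapted_source FT (rJ a (mem_head _ _))); exact: FS.
exact: (measurableT_comp (@measurable_eq_spin R L L1 dZ Zs (tau a)) mSa).
Qed.

(** The samples are treated one by one. With the others frozen, [disintegration] exchanges the
    indicator for the conditional probability, which depends on the side information only and can
    therefore be absorbed in the test function for the remaining samples. *)
Lemma swap_spins (tau : A -> L.-tuple bool) r (g : (A -> Zs) -> \bar R) :
  uniq r -> goodz g ->
  (\int[P]_w ((\prod_(a <- r) ((S a w).1.1 == tau a)%:R : R)%:E * g (fun a => (S a w).2)) =
   \int[P]_w ((\prod_(a <- r) pX pc (S a w).2 (tau a))%:E * g (fun a => (S a w).2)))%E.
Proof.
elim: r g => [|a r IH] g.
  by move=> _ _; apply: eq_integral => w _; rewrite !big_nil.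
move=> /= /andP[ar ur] [g0 mg].
pose J := [set i | i \in [seq sA c | c <- enum A & c != a]]%SET.
have memJ c : c != a -> sA c \in J.
  by move=> ca; rewrite inE map_f// mem_filter ca mem_enum.
have saJ : sA a \notin J.
  by rewrite inE mem_map// mem_filter eqxx.
have rJ c : c \in r -> sA c \in J.
  by move=> cr; apply: memJ; apply: contraNneq ar => <-.
have mE := adapted_E tau rJ.
pose zz (w : T) (t : sample) (c : A) : Zs := if c == a then t.2 else (S c w).2.
have mzz : measurable_fun setT
    (fun q : g_sigma_algebraType (cylinders F J) * sample => g (zz q.1 q.2)).
  apply: mg => c; rewrite /zz; case: (altP (c =P a)) => [_|ca].
    exact: (measurableT_comp measurable_snd measurable_snd).
  apply: (measurableT_comp measurable_snd).
  apply: (measurableT_comp (f := S c : g_sigma_algebraType (cylinders F J) -> sample)) => //.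
  by apply: (adapted_source FT (memJ c ca)); exact: FS.
pose f (h : sample -> R) (q : g_sigma_algebraType (cylinders F J) * sample) :=
  ((E tau r q.1)%:E * ((h q.2)%:E * g (zz q.1 q.2)))%E.
have mf (h : sample -> R) : measurable_fun setT h -> measurable_fun setT (f h).
  move=> mh; apply: emeasurable_funM.
    by apply/measurable_EFinP; exact: (measurableT_comp mE).
  apply: emeasurable_funM => //.
  by apply/measurable_EFinP; exact: (measurableT_comp mh).
have E0 w : 0 <= E tau r w by apply: prodr_ge0 => c _; rewrite ler0n.
have f0 (h : sample -> R) q : (forall t, 0 <= h t) -> (0 <= f h q)%E.
  by move=> h0; rewrite /f mule_ge0 ?lee_fin// mule_ge0 ?lee_fin.
have zzE w : zz w (S a w) = fun c => (S c w).2.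
  by apply/funext => c; rewrite /zz; case: eqP => [->|].
pose h1 (t : sample) : R := (t.1.1 == tau a)%:R.
pose h2 (t : sample) : R := pX pc t.2 (tau a).
have mh1 : measurable_fun setT h1 by exact: measurable_eq_spin.
have mh2 : measurable_fun setT h2.
  exact: (measurableT_comp (measurable_pX hpc (tau a)) measurable_snd).
have h10 t : 0 <= h1 t by exact: ler0n.
have h20 t : 0 <= h2 t by exact: (pX_ge0 hpc).
transitivity (\int[P]_w f h1 (w, S a w))%E.
  apply: eq_integral => w _; rewrite /f /= zzE big_cons muleA -EFinM.
  by congr ((_)%:E * _)%E; rewrite mulrC.
rewrite (@indep_peel _ T R P I F indF FT Fm FI J (sA a) _ sample p (S a) (f h1)
  saJ (@FS a) (@lS a) (mf _ mh1) (fun q => f0 _ q h10)).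
transitivity (\int[P]_w f h2 (w, S a w))%E.
  rewrite (@indep_peel _ T R P I F indF FT Fm FI J (sA a) _ sample p (S a) (f h2)
    saJ (@FS a) (@lS a) (mf _ mh2) (fun q => f0 _ q h20)).
  apply: eq_integral => w _; rewrite /f /=.
  have mgw : measurable_fun setT (fun z : Zs => g (fun c => if c == a then z else (S c w).2)).
    by apply: mg => c; case: eqP.
  have mgw2 : measurable_fun setT (fun t : sample => g (zz w t)).
    exact: (measurableT_comp mgw measurable_snd).
  rewrite ge0_integralZl//; last 3 first.
  - by apply: emeasurable_funM => //; exact/measurable_EFinP.
  - by move=> t _; rewrite mule_ge0 ?lee_fin.
  - by rewrite lee_fin.
  rewrite ge0_integralZl//; last 3 first.
  - by apply: emeasurable_funM => //; exact/measurable_EFinP.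
  - by move=> t _; rewrite mule_ge0 ?lee_fin.
  - by rewrite lee_fin.
  by congr (_ * _)%E; exact: (disintegration hpc (tau a) mgw).
pose g' (z : A -> Zs) : \bar R := ((pX pc (z a) (tau a))%:E * g z)%E.
have gg' : goodz g'.
  split => [z|d' T' z mz].
    by rewrite mule_ge0// lee_fin (pX_ge0 hpc).
  apply: emeasurable_funM; last exact: mg.
  by apply/measurable_EFinP; exact: (measurableT_comp (measurable_pX hpc (tau a))).
transitivity (\int[P]_w ((E tau r w)%:E * g' (fun c => (S c w).2)))%E.
  by apply: eq_integral => w _; rewrite /f /= zzE.
rewrite (IH g' ur gg'); apply: eq_integral => w _.
by rewrite big_cons /g' muleA -EFinM mulrC.
Qed.

(** The planted configuration is decomposed over its finitely many values; each indicator is a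
    product over the samples, to which [swap_spins] applies. *)
Lemma disintegration_samples (G : {ffun A -> L.-tuple bool} -> (A -> Zs) -> \bar R) :
  (forall tau, goodz (G tau)) ->
  (\int[P]_w G [ffun a => (S a w).1.1] (fun a => (S a w).2) =
   \int[P]_w \sum_(tau : {ffun A -> L.-tuple bool}) (\prod_a pX pc (S a w).2 (tau a))%:E * G tau (fun a => (S a w).2))%E.
Proof.
move=> gG.
have mS a : measurable_fun setT (S a).
  by move=> mT B mB; rewrite setTI; apply: (@Fm (sA a)); exact: FS.
have mGz tau : measurable_fun setT (fun w => G tau (fun a => (S a w).2)).
  by apply: (gG tau).2 => a; exact: (measurableT_comp measurable_snd).
transitivity (\int[P]_w \sum_(tau : {ffun A -> L.-tuple bool})
   ((\prod_a ((S a w).1.1 == tau a)%:R : R)%:E * G tau (fun a => (S a w).2)))%E.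
  apply: eq_integral => w _; set x := [ffun a => _].
  rewrite (bigD1 x)//= [X in (_ + X)%E]big1 ?adde0.
    by rewrite big1 ?mul1e// => a _; rewrite ffunE eqxx.
  move=> tau /eqP tx.
  have [a ha] : exists a, (S a w).1.1 != tau a.
    apply/existsP; rewrite -negb_forall; apply/forallP => h; apply: tx.
    by apply/ffunP => a; rewrite ffunE; apply/esym/eqP; exact: h.
  by rewrite (bigD1 a)//= (negbTE ha) mul0r mul0e.
rewrite !ge0_integral_sum//.
- apply: eq_bigr => tau _.
  have := @swap_spins tau (index_enum A) (G tau) (index_enum_uniq A) (gG tau).
  by [].
- move=> tau; apply: emeasurable_funM => //; apply/measurable_EFinP.
  apply: measurable_prod => a _.
  exact: (measurableT_comp (measurableT_comp (measurable_pX hpc (tau a)) measurable_snd)).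
- move=> tau w _; rewrite mule_ge0//; last exact: (gG tau).1.
  by rewrite lee_fin prodr_ge0// => a _; exact: (pX_ge0 hpc).
- move=> tau; apply: emeasurable_funM => //; apply/measurable_EFinP.
  apply: measurable_prod => a _.
  exact: (measurableT_comp (@measurable_eq_spin R L L1 dZ Zs (tau a))).
- move=> tau w _; rewrite mule_ge0//; last exact: (gG tau).1.
  by rewrite lee_fin prodr_ge0// => a _; rewrite ler0n.
Qed.

End swap.

(** * Nishimori identities and change of signs *)

Lemma goodZ {R : realType} (Sg : finType) (k : R) (F : (Sg -> R) -> \bar R) :
  0 <= k -> good F -> good (fun u => (k%:E * F u)%E).
Proof. by move=> k0 gF; apply: goodM => //; apply: good_cst; rewrite lee_fin. Qed.

Section nishimori.
Context {R : realType} (Sg : finType) (K : Type) (b : K -> Sg -> R) (ks : seq K).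
Variable v : Sg -> R.
Hypothesis v0 : forall x, 0 <= v x.

Lemma powsumS t u : 1 + t != 0 ->
  (\sum_y (v y * expR (u y))%:E * powsum t v u)%E = powsum (1 + t) v u.
Proof.
move=> t1; rewrite -ge0_sume_distrl; last first.
  by move=> y _; rewrite lee_fin mulr_ge0// expR_ge0.
rewrite sumEFin /powsum -EFinM -/(wsum v u); congr (_%:E).
(* At a vanishing sum both sides are 0, because 0 raised to the nonzero order [1 + t] is 0. *)
have [->|w0] := eqVneq (wsum v u) 0; first by rewrite mul0r powR0.
by rewrite powRD ?w0 ?implybT// powRr1// wsum_ge0.
Qed.

(* By Cameron-Martin, planting [y] weighs the unplanted model by [expR (u y)];
   summing over [y] completes one more power of the partition function. *)
Lemma nishimori t : 1 + t != 0 ->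
  (\sum_y (v y)%:E * gops b 1 ks (powsum t v) (fun x => cov b ks x y) =
   gops b 1 ks (powsum (1 + t) v) (fun=> 0%R))%E.
Proof.
move=> t1.
have gp := good_powsum t v.
have ge y : good (fun u : Sg -> R => ((expR (u y))%:E * powsum t v u)%E).
  by apply: goodM => //; exact: good_expR.
rewrite (_ : powsum (1 + t) v = fun u => (\sum_y (v y)%:E * ((expR (u y))%:E * powsum t v u))%E); last first.
  apply/funext => u; rewrite -powsumS//; apply: eq_bigr => y _.
  by rewrite muleA -EFinM.
rewrite gops_sum; last by move=> y; exact: goodZ.
apply: eq_bigr => y _; rewrite gopsZ ?lee_fin//.
rewrite gops_shift// expR0 mul1e; congr (_ * gops _ _ _ _ _)%E.
by apply/funext => x; rewrite add0r expr1n mul1r.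
Qed.

End nishimori.

Lemma gops_reindex {R : realType} (Sg Sg' : finType) (K : Type) (b : K -> Sg' -> R)
    (h : Sg -> Sg') s ks F u :
  gops b s ks (fun u => F (u \o h)) u = gops (fun k => b k \o h) s ks F (u \o h).
Proof.
elim: ks u => [//|k ks IH] u; rewrite !gops_cons !gopE.
by apply: eq_integral => g _; rewrite IH.
Qed.

Lemma gops_signs {R : realType} (Sg : finType) (K : Type) (b : K -> Sg -> R)
    (sg : K -> R) ks F : (forall k, sg k = 1 \/ sg k = -1) -> good F ->
  gops (fun k x => sg k * b k x) 1 ks F = gops b 1 ks F.
Proof.
move=> sg1 gF; elim: ks => [//|k ks IH]; rewrite !gops_cons IH; apply/funext => u.
case: (sg1 k) => ->.
  by rewrite (_ : (fun x => 1 * b k x) = b k)//; apply/funext => x; rewrite mul1r.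
rewrite (_ : (fun x => - 1 * b k x) = fun x => - b k x); last first.
  by apply/funext => x; rewrite mulN1r.
by rewrite gop_opp//; exact: gops_good.
Qed.

Section signs.
Context {R : realType} (Sg : finType) (K : Type) (b : K -> Sg -> R) (ks : seq K).
Variable v : Sg -> R.
Hypothesis v0 : forall x, 0 <= v x.
Variable sg : K -> R.
Hypothesis sg1 : forall k, sg k = 1 \/ sg k = -1.

(* The flipped channel is coupled to the original one through the same
   Gaussians by doubling the index set: [inr x] carries the flipped fields. *)
Let b' k (x : Sg + Sg) := match x with inl x => b k x | inr x => sg k * b k x end.
Let F t (u : Sg + Sg -> R) := powsum t v (u \o inl).
Let F' t (u : Sg + Sg -> R) := powsum t v (u \o inr).

Let gF t : good (F t).
Proof.
split => [u|d T u mu]; first exact: (good_ge0 _ (good_powsum t v)).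
by apply: (good_powsum t v).2 => x; exact: mu.
Qed.

Let gF' t : good (F' t).
Proof.
split => [u|d T u mu]; first exact: (good_ge0 _ (good_powsum t v)).
by apply: (good_powsum t v).2 => x; exact: mu.
Qed.

(** The weight [expR (u (inr y))] generates the drift with the flipped covariance. Summed over [y],
    the integrand is the flipped partition function times the power [t] of the original one;
    [young_powR] splits it into two moments of order [1 + t], which are equal because the Gaussians
    are symmetric. *)
Lemma flipped_signs t : 0 < t ->
  (\sum_y (v y)%:E * gops b 1 ks (powsum t v) (fun x => \sum_(k <- ks) sg k * b k x * b k y)%R <=
   gops b 1 ks (powsum (1 + t) v) (fun=> 0%R))%E.
Proof.
move=> t0.
have ge y : good (fun u : Sg + Sg -> R => ((expR (u (inr y)))%:E * F t u)%E).
  by apply: goodM => //; exact: good_expR.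
have gI u : gops b' 1 ks (F t) u = gops b 1 ks (powsum t v) (u \o inl).
  exact: (gops_reindex b' inl).
have -> : (\sum_y (v y)%:E * gops b 1 ks (powsum t v) (fun x => \sum_(k <- ks) sg k * b k x * b k y)%R =
    gops b' 1 ks (fun u => \sum_y (v y)%:E * ((expR (u (inr y)))%:E * F t u))%E (fun=> 0%R))%E.
  rewrite gops_sum; last by move=> y; exact: goodZ.
  apply: eq_bigr => y _; rewrite gopsZ ?lee_fin//.
  rewrite gops_shift// expR0 mul1e gI; congr (_ * gops _ _ _ _ _)%E.
  apply/funext => x; rewrite /= add0r expr1n mul1r /cov; apply: eq_bigr => k _ /=.
  by rewrite mulrCA mulrA.
have t1 : 0 < 1 + t by lra.
have k0 : (0 <= ((1 + t)^-1)%:E :> \bar R)%E by rewrite lee_fin invr_ge0 ltW.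
have t0' : (0 <= t%:E :> \bar R)%E by rewrite lee_fin ltW.
have gtF : good (fun u => (t%:E * F (1 + t)%R u)%E) by apply: goodZ => //; exact: ltW.
have gR : good (fun u => (F' (1 + t)%R u + t%:E * F (1 + t)%R u)%E)
  by exact: (goodD (gF' (1 + t)) gtF).
apply: (@le_trans _ _ (gops b' 1 ks (fun u => ((1 + t)^-1)%:E *
    (F' (1 + t)%R u + t%:E * F (1 + t)%R u))%E (fun=> 0%R))).
  apply: gops_le.
  - by apply: good_sum => y; exact: goodZ.
  - by apply: goodZ => //; rewrite invr_ge0 ltW.
  - move=> u.
    rewrite (eq_bigr (fun y => ((v y * expR (u (inr y)))%:E * F t u)%E)); last first.
      by move=> y _; rewrite muleA -EFinM.
    rewrite -ge0_sume_distrl; last first.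
      by move=> y _; rewrite lee_fin mulr_ge0// expR_ge0.
    rewrite sumEFin /F /F' /powsum -!EFinM lee_fin.
    rewrite -[X in X * _ <= _]/(wsum v (u \o inr)).
    rewrite [leRHS]mulrC ler_pdivlMr// mulrC.
    by apply: young_powR => //; exact: wsum_ge0.
rewrite (gopsZ _ _ _ k0 gR) (gopsD _ _ _ (gF' _) gtF) (gopsZ _ _ _ t0' (gF _)).
have -> : gops b' 1 ks (F' (1 + t)) (fun=> 0) = gops b 1 ks (powsum (1 + t) v) (fun=> 0).
  rewrite -(gops_signs b ks sg1 (good_powsum _ _)).
  exact: (gops_reindex b' inr).
have -> : gops b' 1 ks (F (1 + t)) (fun=> 0) = gops b 1 ks (powsum (1 + t) v) (fun=> 0).
  exact: (gops_reindex b' inl).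
rewrite -{1}[X in (X + _)%E]mul1e -ge0_muleDl ?lee_fin ?ler01 ?(ltW t0)//.
by rewrite -EFinD muleA -EFinM mulVf ?gt_eqF// mul1e.
Qed.

End signs.

Section compensator.
Context {R : realType} (Sg : finType).

(** A field that is constant in the configuration multiplies the partition function by an
    independent lognormal variable, and a functional homogeneous of degree [t] sees the moment of
    order [t] of that variable. *)
Lemma gop_const (kap t : R) (F : (Sg -> R) -> \bar R) u : good F ->
  (forall (c : R) u, F (fun x => u x + c)%R = (expR (t * c))%:E * F u)%E ->
  gop (fun=> kap) 1 F u = ((expR ((t ^+ 2 - t) * kap ^+ 2 / 2))%:E * F u)%E.
Proof.
move=> gF FE; rewrite gopE.
transitivity (\int[normal_prob 0 1]_g (((expR ((t ^+ 2 - t) * kap ^+ 2 / 2))%:E * F u) *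
    (expR (t * kap * g - 1 ^+ 2 * (t * kap) ^+ 2 / 2))%:E))%E.
  apply: eq_integral => g _; rewrite /tilt FE muleAC -EFinM -expRD.
  by congr ((expR _)%:E * _)%E; ring.
rewrite ge0_integralZl//.
- by rewrite normal_expR// mule1.
- apply/measurable_EFinP; apply: measurableT_comp => //.
  by apply: measurable_funB => //; exact: measurable_funM.
- by rewrite mule_ge0 ?lee_fin ?expR_ge0//; exact: good_ge0.
Qed.

Lemma powsum_addc t (v : Sg -> R) (c : R) u : (forall x, 0 <= v x) ->
  powsum t v (fun x => u x + c) = ((expR (t * c))%:E * powsum t v u)%E.
Proof.
move=> v0; rewrite /powsum -EFinM; congr (_%:E).
have -> : wsum v (fun x => u x + c) = expR c * wsum v u.
  by rewrite /wsum mulr_sumr; apply: eq_bigr => x _; rewrite expRD; ring.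
rewrite powRM ?expR_ge0 ?wsum_ge0//; congr (_ * _).
by rewrite /powR gt_eqF ?expR_gt0// expRK.
Qed.

End compensator.

Local Arguments gops : simpl never.

Section factorization.
Context {R : realType} (n : nat) (A : finType) (K : eqType) (beta : K -> A -> R).
Variables (t : R) (v : 'I_n -> A -> R).
Hypothesis v0 : forall i a, 0 <= v i a.
Hypothesis t0 : 0 < t.
Local Notation cfg := {ffun 'I_n -> A}.

Definition site_field (k : 'I_n * K) (x : cfg) : R := beta k.2 (x k.1).

Lemma powsum_prod (u : 'I_n -> A -> R) :
  powsum t (fun x : cfg => \prod_i v i (x i)) (fun x => \sum_i u i (x i)) =
  (\prod_i powsum t (v i) (u i))%E.
Proof.
rewrite /powsum prodEFin; congr (_%:E).
have -> : wsum (fun x : cfg => \prod_i v i (x i)) (fun x => \sum_i u i (x i)) =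
    \prod_i wsum (v i) (u i).
  rewrite /wsum bigA_distr_bigA/=; apply: eq_bigr => x _.
  by rewrite expR_sum -big_split.
elim: (index_enum _) => [|i r IH]; first by rewrite !big_nil powR1.
rewrite !big_cons powRM ?IH//; first exact: wsum_ge0.
by apply: prodr_ge0 => j _; exact: wsum_ge0.
Qed.

(** The Gaussian attached to a site alters only the factor of that site, so its integral passes
    through all the other factors. *)
Lemma gops_prod (ks : seq ('I_n * K)) (u : 'I_n -> A -> R) :
  gops site_field 1 ks (powsum t (fun x : cfg => \prod_i v i (x i)))
     (fun x => \sum_i u i (x i)) =
  (\prod_i gops beta 1 [seq k.2 | k <- ks & k.1 == i] (powsum t (v i)) (u i))%E.
Proof.
elim: ks u => [|[i l] ks IH] u; first exact: powsum_prod.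
rewrite gops_cons gopE.
pose u' g j a := if j == i then tilt (beta l) 1 g (u i) a else u j a.
have E g : tilt (site_field (i, l)) 1 g (fun x : cfg => \sum_j u j (x j)) =
    fun x => \sum_j u' g j (x j).
  apply/funext => x; rewrite /tilt (bigD1 i)//= [RHS](bigD1 i)//= /u' eqxx /tilt addrAC.
  congr (_ + _); apply: eq_bigr => j ji; by rewrite (negbTE ji).
under eq_integral do rewrite E IH.
have Ei : [seq k.2 | k <- (i, l) :: ks & k.1 == i] = l :: [seq k.2 | k <- ks & k.1 == i].
  by rewrite /= eqxx.
have Ej j : j != i -> [seq k.2 | k <- (i, l) :: ks & k.1 == j] = [seq k.2 | k <- ks & k.1 == j].
  by move=> ji; rewrite /= eq_sym (negbTE ji).
rewrite [RHS](bigD1 i)// Ei gops_cons gopE [RHS]/=.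
have p0 (r : 'I_n -> \bar R) (Q : pred 'I_n) : (forall j, 0 <= r j)%E -> (0 <= \prod_(j | Q j) r j)%E.
  by move=> r0; elim/big_ind : _ => // x y x0 y0; exact: mule_ge0.
have gg j ls : good (gops beta 1 ls (powsum t (v j))).
  by apply: gops_good; exact: good_powsum.
rewrite -ge0_integralZr//; last 3 first.
- exact: good_tilt.
- by move=> g _; exact: good_ge0.
- by apply: p0 => j; exact: good_ge0.
apply: eq_integral => g _; rewrite (bigD1 i)// [LHS]/=.
congr (_ * _)%E.
  by congr (gops _ _ _ _ _); apply/funext => a; rewrite /u' eqxx.
apply: eq_bigr => j ji; rewrite Ej// [X in gops _ _ _ _ X = _](_ : _ = u j)//.
by apply/funext => a; rewrite /u' (negbTE ji).
Qed.

Lemma filter_allpairs (is_ : seq 'I_n) (ls : seq K) i : uniq is_ -> i \in is_ ->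
  [seq k.2 | k <- [seq (j, l) | j <- is_, l <- ls] & k.1 == i] = ls.
Proof.
have f1 j : [seq k.2 | k <- [seq (j, l) | l <- ls] & k.1 == i] = if j == i then ls else [::].
  elim: ls => [|l ls IH] /=; first by case: ifP.
  by case: eqP IH => //= _ ->.
have f2 js : i \notin js -> [seq k.2 | k <- [seq (j, l) | j <- js, l <- ls] & k.1 == i] = [::].
  elim: js => [//|j js IH]; rewrite inE negb_or => /andP[ij ijs].
  by rewrite /= filter_cat map_cat f1 IH// eq_sym (negbTE ij).
elim: is_ => [//|j js IH] /= /andP[jjs ujs].
rewrite inE filter_cat map_cat f1 [j == i]eq_sym; case: eqP => [ij _|_ /= ijs].
  by rewrite f2 ?cats0// ij.
by rewrite IH.
Qed.

End factorization.

(** * Interpolation between the pair fields and the site fields *)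

Lemma sum_lt_pairs (R : realType) (n : nat) (a : 'I_n -> R) :
  \sum_(i < n) \sum_(j < n | (i < j)%N) a i * a j =
  ((\sum_i a i) ^+ 2 - \sum_i a i ^+ 2) / 2.
Proof.
have E : (\sum_i a i) ^+ 2 = \sum_i a i ^+ 2 +
    (\sum_(i < n) \sum_(j < n | (i < j)%N) a i * a j) *+ 2.
  rewrite expr2 mulr_suml mulr2n.
  under eq_bigr do rewrite mulr_sumr.
  rewrite [X in _ = _ + (_ + X)](exchange_big_dep xpredT)//= addrA -!big_split/=.
  apply: eq_bigr => i _.
  rewrite (bigD1 i)//= -expr2 -addrA; congr (_ + _).
  rewrite (bigID (fun j : 'I_n => (i < j)%N))/=; congr (_ + _).
    by apply: eq_bigl => j; rewrite andbC; case: ltnP => //= ij; rewrite neq_ltn ij orbT.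
  apply: eq_big => [j|j _]; last by rewrite mulrC.
  by rewrite neq_ltn; case: ltngtP.
by rewrite E mulr2n; field.
Qed.

Lemma gops_map {R : realType} (Sg : finType) (K K' : Type) (b : K' -> Sg -> R)
    (f : K -> K') s ks F :
  gops b s [seq f k | k <- ks] F = gops (fun k => b (f k)) s ks F.
Proof. by elim: ks => [//|k ks IH]; rewrite map_cons !gops_cons IH. Qed.

Section spiked.
Context (R : realType) (L n : nat) (lam : 'I_L -> R).
Hypothesis lam0 : forall l, 0 <= lam l.
Hypothesis n0 : (0 < n)%N.
Local Notation A := (L.-tuple bool).
Local Notation cfg := {ffun 'I_n -> A}.
Local Notation K := ('I_L * ('I_n * 'I_n))%type.

Lemma spin_sqr (a : A) l : spin R a l ^+ 2 = 1.
Proof. exact: sqrr_sign. Qed.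

Definition overlap l (x y : cfg) : R := \sum_i spin R (x i) l * spin R (y i) l.

Definition pair_field (k : K) (x : cfg) : R :=
  Num.sqrt (lam k.1 / n%:R) * spin R (x k.2.1) k.1 * spin R (x k.2.2) k.1.

Definition pairs : seq K := [seq k : K <- index_enum K | (k.2.1 < k.2.2)%N].

Lemma sum_pairs (f : K -> R) :
  \sum_(k <- pairs) f k = \sum_(l < L) \sum_(i < n) \sum_(j < n | (i < j)%N) f (l, (i, j)).
Proof.
rewrite /pairs big_filter.
under [RHS]eq_bigr do rewrite pair_big_dep/=.
rewrite pair_big_dep/=.
by apply: eq_big => [[l [i j]]//|[l [i j]] _].
Qed.

Let nR0 : (n%:R : R) != 0. Proof. by rewrite pnatr_eq0 -lt0n. Qed.

Lemma cov_pairs x y :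
  cov pair_field pairs x y = \sum_l lam l / (2 * n%:R) * (overlap l x y ^+ 2 - n%:R).
Proof.
rewrite /cov sum_pairs; apply: eq_bigr => l _.
transitivity (lam l / n%:R * \sum_(i < n) \sum_(j < n | (i < j)%N)
    (spin R (x i) l * spin R (y i) l) * (spin R (x j) l * spin R (y j) l)).
  rewrite mulr_sumr; apply: eq_bigr => i _; rewrite mulr_sumr; apply: eq_bigr => j _.
  rewrite /pair_field /=.
  rewrite -[in RHS](@sqr_sqrtr _ (lam l / n%:R)) ?divr_ge0//; ring.
rewrite (sum_lt_pairs (fun i => spin R (x i) l * spin R (y i) l)).
rewrite -/(overlap l x y).
have -> : \sum_(i < n) (spin R (x i) l * spin R (y i) l) ^+ 2 = n%:R.
  under eq_bigr do rewrite exprMn !spin_sqr mulr1.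
  by rewrite sumr_const card_ord.
by field.
Qed.

Section guerra.
Variable r : 'I_L -> R.
Hypothesis r0 : forall l, 0 <= r l.

Definition layer_field (l : 'I_L) (a : A) : R := Num.sqrt (lam l * r l) * spin R a l.

(** The variance that completes the square: the part n r^2 / 2 is n^2 r^2 / (2 n), and the 1 offsets
    the [- n%:R] that the missing diagonal pairs leave in [cov_pairs]. *)
Definition compensator : R := \sum_l lam l * (n%:R * r l ^+ 2 + 1) / 2.

Definition sites : seq ('I_n * 'I_L) := [seq (i, l) | i <- enum 'I_n, l <- enum 'I_L].

Lemma compensator_ge0 : 0 <= compensator.
Proof.
apply: sumr_ge0 => l _; rewrite divr_ge0// mulr_ge0// addr_ge0// mulr_ge0//.
exact: sqr_ge0.
Qed.

Lemma cov_sites x y :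
  cov (site_field layer_field) sites x y = \sum_l lam l * r l * overlap l x y.
Proof.
rewrite /cov /sites big_allpairs /= !big_enum/=.
under eq_bigr do rewrite big_enum/=.
rewrite exchange_big/=; apply: eq_bigr => l _; rewrite mulr_sumr.
apply: eq_bigr => i _; rewrite /site_field /layer_field/=.
by rewrite -[in RHS](@sqr_sqrtr _ (lam l * r l)) ?mulr_ge0//; ring.
Qed.

(** One additional Gaussian, common to all configurations, adds [compensator] to every covariance;
    [gop_const] later evaluates its effect exactly. *)
Let b1 (k : unit + K) : cfg -> R :=
  match k with inl _ => fun=> Num.sqrt compensator | inr k => pair_field k end.
Let ks1 : seq (unit + K) := inl tt :: [seq inr k | k <- pairs].

Let cov01 x y : cov (site_field layer_field) sites x y <= cov b1 ks1 x y.
Proof.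
have -> : cov b1 ks1 x y = compensator + cov pair_field pairs x y.
  rewrite /cov /ks1 big_cons big_map /= -expr2 sqr_sqrtr//.
  exact: compensator_ge0.
rewrite cov_sites cov_pairs /compensator -big_split/=; apply: ler_sum => l _.
rewrite -subr_ge0.
have -> : lam l * (n%:R * r l ^+ 2 + 1) / 2 + lam l / (2 * n%:R) * (overlap l x y ^+ 2 - n%:R) -
   lam l * r l * overlap l x y = lam l / (2 * n%:R) * (overlap l x y - n%:R * r l) ^+ 2.
  by field.
by rewrite mulr_ge0 ?sqr_ge0// divr_ge0// mulr_ge0.
Qed.

Lemma guerra (t : R) (w : cfg -> R) u : 0 < t < 1 -> (forall x, 0 <= w x) ->
  ((expR ((t ^+ 2 - t) * compensator / 2))%:E * gops pair_field 1 pairs (powsum t w) u <=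
   gops (site_field layer_field) 1 sites (powsum t w) u)%E.
Proof.
move=> t01 w0.
have := kahane t01 cov01 u w0.
rewrite /ks1 gops_cons gops_map => h; apply: le_trans h.
have gG : good (gops pair_field 1 pairs (powsum t w)) by exact/gops_good/good_powsum.
rewrite (gop_const (t := t) (F := gops pair_field 1 pairs (powsum t w)) _ u gG).
  by rewrite sqr_sqrtr//; exact: compensator_ge0.
move=> c {}u.
rewrite gops_translate.
have -> : (fun v : cfg -> R => powsum t w (fun x => v x + c)) =
    (fun v => (expR (t * c))%:E * powsum t w v)%E.
  by apply/funext => v; rewrite powsum_addc.
by rewrite gopsZ ?lee_fin ?expR_ge0//; exact: good_powsum.
Qed.

Lemma guerra_prod (t : R) (v : 'I_n -> A -> R) (u : 'I_n -> A -> R) : 0 < t < 1 ->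
  (forall i a, 0 <= v i a) ->
  (gops pair_field 1 pairs (powsum t (fun x : cfg => \prod_i v i (x i))%R)
     (fun x => \sum_i u i (x i))%R <=
   (expR ((t - t ^+ 2) * compensator / 2))%:E *
   \prod_i gops layer_field 1 (enum 'I_L) (powsum t (v i)) (u i))%E.
Proof.
move=> t01 v0; have t0 : 0 < t by case/andP: t01.
have w0 (x : cfg) : 0 <= \prod_i v i (x i) by exact: prodr_ge0.
have := guerra (fun x => \sum_i u i (x i)) t01 w0.
rewrite (gops_prod layer_field t v0).
have -> : (\prod_i gops layer_field 1 [seq k.2 | k <- sites & k.1 == i] (powsum t (v i)) (u i) =
   \prod_i gops layer_field 1 (enum 'I_L) (powsum t (v i)) (u i))%E.
  by apply: eq_bigr => i _; rewrite filter_allpairs ?enum_uniq ?mem_enum.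
move=> h.
have e0 : (0 <= (expR ((t - t ^+ 2) * compensator / 2))%:E)%E by rewrite lee_fin expR_ge0.
have := lee_wpmul2l e0 h; rewrite muleA -EFinM -expRD.
have -> : (t - t ^+ 2) * compensator / 2 + (t ^+ 2 - t) * compensator / 2 = 0 by ring.
by rewrite expR0 mul1e.
Qed.

End guerra.
End spiked.

(** * Transfer of the spiked model to iterated Gaussian averages *)

Section sigma_of_facts.
Context d (T : measurableType d) (R : realType) (P : probability T R).
Context d' (T' : measurableType d') (X : {RV P >-> T'}).

Lemma sigma_ofT : sigma_of X setT.
Proof. by exists setT => //; rewrite setTI preimage_setT. Qed.

Lemma sigma_of_measurable : sigma_of X `<=` measurable.
Proof. by move=> _ [B mB <-]; exact: measurable_funP. Qed.

Lemma sigma_of_setI : setI_closed (sigma_of X).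
Proof.
move=> _ _ [B mB <-] [C mC <-]; exists (B `&` C); first exact: measurableI.
by rewrite !setTI preimage_setI.
Qed.

Lemma sigma_of_preimage B : measurable B -> sigma_of X (X @^-1` B).
Proof. by move=> mB; exists B => //; rewrite setTI. Qed.

End sigma_of_facts.

Section planted.
Context d (T : measurableType d) (R : realType) (P : probability T R).
Context (I : finType) (F : I -> set_system T).
Hypothesis indF : mutually_independent P F.
Hypothesis FT : forall i, F i setT.
Hypothesis Fm : forall i, F i `<=` measurable.
Hypothesis FI : forall i, setI_closed (F i).
Context (Sg : finType) (K : eqType) (sK : K -> I) (W : K -> T -> R)
  (b : K -> Sg -> R) (ks : seq K) (J : {set I}).
Hypothesis uks : uniq [seq sK k | k <- ks].
Hypothesis ksJ : forall k, k \in ks -> sK k \notin J.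
Hypothesis FW : forall k B, k \in ks -> measurable B ->
  F (sK k) (W k @^-1` B).
Hypothesis lW : forall k B, k \in ks -> measurable B ->
  P (W k @^-1` B) = normal_prob 0 1 B.
Context (xs : T -> Sg) (v : T -> Sg -> R).
Hypothesis axs : forall f : Sg -> R, adapted F J (fun w => f (xs w)).
Hypothesis av : forall x, adapted F J (fun w => v w x).

Definition noise w x : R := \sum_(k <- ks) (b k x * W k w - b k x ^+ 2 / 2).

Lemma planted_link a (h : Sg -> Sg -> R) :
  (\int[P]_w powsum a (v w) (fun x => h x (xs w) + noise w x)%R =
   \int[P]_w gops b 1 ks (powsum a (v w)) (fun x => h x (xs w)))%E.
Proof.
apply: (@gaussian_link _ _ _ _ _ _ indF FT Fm FI _ _ sK W b ks J
  (fun w x => h x (xs w)) (fun w => powsum a (v w))) => //.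
exact: jgood_powsum.
Qed.

End planted.

Section ffun_adapted.
Context (R : realType) (L n : nat).
Local Notation A := (L.-tuple bool).
Local Notation cfg := {ffun 'I_n -> A}.

Lemma measurable_fun_ffun d (T : measurableType d) (X : 'I_n -> T -> A) (f : cfg -> R) :
  (forall i, measurable_fun setT (X i)) ->
  measurable_fun setT (fun w => f [ffun i => X i w]).
Proof.
move=> mX.
rewrite (_ : (fun w => _) = (fun w => \sum_(tau : cfg) f tau * \prod_i (X i w == tau i)%:R)).
  apply: measurable_sum => tau; apply: measurable_funM => //.
  apply: measurable_prod => i _.
  rewrite (_ : (fun w => _) = \1_(X i @^-1` [set tau i])).
    by apply: measurable_indic; rewrite -[X in measurable X]setTI; apply: mX => //; exact: measurable_tuple_bool.
  by apply/funext => w; rewrite indicE; case: eqP => e; [rewrite mem_set|rewrite memNset].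
apply/funext => w; set x := [ffun i => _].
rewrite (bigD1 x)//= [X in _ + X]big1 ?addr0.
  by rewrite big1 ?mulr1// => i _; rewrite ffunE eqxx.
move=> tau /eqP tx.
have [i hi] : exists i, X i w != tau i.
  apply/existsP; rewrite -negb_forall; apply/forallP => h; apply: tx.
  by apply/ffunP => i; rewrite ffunE; apply/esym/eqP; exact: h.
by rewrite (bigD1 i)//= (negbTE hi) mul0r mulr0.
Qed.

End ffun_adapted.

Section spiked_model.
Context (R : realType) (L L1 : nat) (dZ : measure_display) (Zs : measurableType dZ).
Local Notation sample := (L.-tuple bool * L1.-tuple bool * Zs)%type.
Local Notation A := (L.-tuple bool).
Context (p : probability sample R) (pc : Zs -> A -> L1.-tuple bool -> R).
Hypothesis hpc : is_cond_pmf p pc.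
Context (lam : 'I_L -> R).
Hypothesis lam0 : forall l, 0 <= lam l.
Context d (Omega : measurableType d) (P : probability Omega R) (n : nat).
Context (S : 'I_n -> {RV P >-> sample}) (W : 'I_L -> 'I_n -> 'I_n -> {RV P >-> R}).
Hypothesis hSW : is_spiked_model p S W.
Hypothesis n0 : (0 < n)%N.
Local Notation cfg := {ffun 'I_n -> A}.
Local Notation K := ('I_L * ('I_n * 'I_n))%type.
Local Notation F := (source_sigma S W).

Let FT s : F s setT.
Proof. by case: s => [i|[l ij]]; exact: sigma_ofT. Qed.

Let Fm s : F s `<=` measurable.
Proof. by case: s => [i|[l ij]]; exact: sigma_of_measurable. Qed.

Let FI s : setI_closed (F s).
Proof. by case: s => [i|[l ij]]; exact: sigma_of_setI. Qed.

(** Noise sources are indexed by pairs with i <= j together with a proof, which [insub] recovers;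
    the [inl] branch is a default value outside that range. *)
Let sK (k : K) : source L n :=
  if insub k.2 is Some ij then inr (k.1, ij) else inl k.2.1.

Let sKE (k : K) (h : (k.2.1 <= k.2.2)%N) : sK k = inr (k.1, Sub k.2 h).
Proof. by rewrite /sK insubT. Qed.

Let J : {set source L n} := [set s | if s is inl _ then true else false]%SET.

Let pairs_lt (k : K) : k \in pairs L n -> (k.2.1 < k.2.2)%N.
Proof. by rewrite mem_filter => /andP[]. Qed.

Let uks : uniq [seq sK k | k <- pairs L n].
Proof.
rewrite map_inj_in_uniq; first by rewrite filter_uniq// index_enum_uniq.
move=> k k' /pairs_lt h /pairs_lt h'.
rewrite (sKE (ltnW h)) (sKE (ltnW h')) => -[e1 e2].
by case: k k' e1 e2 {h h'} => [l ij] [l' ij'] /= -> ->.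
Qed.

Let ksJ (k : K) : k \in pairs L n -> sK k \notin J.
Proof. by move=> /pairs_lt h; rewrite (sKE (ltnW h)) inE. Qed.

Let Wk (k : K) : Omega -> R := W k.1 k.2.1 k.2.2.

Let FW (k : K) B : k \in pairs L n -> measurable B -> F (sK k) (Wk k @^-1` B).
Proof.
by move=> /pairs_lt h mB; rewrite (sKE (ltnW h)) /=; exact: sigma_of_preimage.
Qed.

Let lW (k : K) B : k \in pairs L n -> measurable B -> P (Wk k @^-1` B) = normal_prob 0 1 B.
Proof.
move=> /pairs_lt h mB; have := spiked_noise_law hSW k.1 (ltnW h) mB.
have -> : (k.2.1 == k.2.2) = false by apply/eqP => e; rewrite e ltnn in h.
by rewrite addr0 sqrtr1.
Qed.

Definition planted (w : Omega) : cfg := [ffun i => (S i w).1.1].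
Definition weights (z : 'I_n -> Zs) (x : cfg) : R := \prod_i pX pc (z i) (x i).
Local Notation wts w := (weights (fun i => (S i w).2)).

Lemma weights_ge0 z x : 0 <= weights z x.
Proof. by apply: prodr_ge0 => i _; exact: (pX_ge0 hpc). Qed.

Lemma measurable_weights d' (T' : measurableType d') (z : T' -> 'I_n -> Zs) x :
  (forall i, measurable_fun setT (fun t => z t i)) ->
  measurable_fun setT (fun t => weights (z t) x).
Proof.
move=> mz; apply: measurable_prod => i _.
exact: (measurableT_comp (measurable_pX hpc (x i)) (mz i)).
Qed.

Let aS i : adapted F J (S i).
Proof.
apply: (@adapted_source _ _ _ _ FT J (inl i)); first by rewrite inE.
by move=> B mB; exact: sigma_of_preimage.
Qed.

Let axs (f : cfg -> R) : adapted F J (fun w => f (planted w)).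
Proof.
apply: (@measurable_fun_ffun R L n _ (g_sigma_algebraType (cylinders F J))
  (fun i w => (S i w).1.1)) => i.
exact: (measurableT_comp measurable_fst (measurableT_comp measurable_fst (aS i))).
Qed.

Let av x : adapted F J (fun w => wts w x).
Proof.
apply: (@measurable_weights _ (g_sigma_algebraType (cylinders F J))
   (fun w i => (S i w).2)) => i.
exact: (measurableT_comp measurable_snd (aS i)).
Qed.

Local Notation field := (pair_field lam (n := n)).
Local Notation noise_ := (noise Wk field (pairs L n)).

Lemma spiked_link a (h : cfg -> cfg -> R) :
  (\int[P]_w powsum a (wts w) (fun x => h x (planted w) + noise_ w x)%R =
   \int[P]_w gops field 1 (pairs L n) (powsum a (wts w)) (fun x => h x (planted w)))%E.
Proof.
exact: (planted_link (spiked_independent hSW) FT Fm FI field uks ksJ FW lW axs av).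
Qed.

Let FS i B : measurable B -> F (inl i) (S i @^-1` B).
Proof. by move=> mB; exact: sigma_of_preimage. Qed.

Let lS i B : measurable B -> P (S i @^-1` B) = p B.
Proof. exact: (spiked_sample_law hSW). Qed.

Let inl_inj : injective (inl : 'I_n -> source L n).
Proof. by move=> i j []. Qed.

Lemma spiked_disintegration (G : cfg -> ('I_n -> Zs) -> \bar R) :
  (forall tau, goodz (G tau)) ->
  (\int[P]_w G (planted w) (fun i => (S i w).2) =
   \int[P]_w \sum_(tau : cfg) (wts w tau)%:E * G tau (fun i => (S i w).2))%E.
Proof.
by move=> gG; rewrite (disintegration_samples (spiked_independent hSW) FT Fm FI hpc
  inl_inj FS lS gG).
Qed.

Lemma spiked_prod (Psi : 'I_n -> sample -> \bar R) :
  (forall i, measurable_fun setT (Psi i)) -> (forall i t, 0 <= Psi i t)%E ->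
  (\int[P]_w \prod_i Psi i (S i w) = \prod_i \int[p]_t Psi i t)%E.
Proof.
move=> mPsi Psi0.
exact: (integral_prod_samples (spiked_independent hSW) FT Fm FI inl_inj FS lS
  (index_enum_uniq _) mPsi Psi0).
Qed.

End spiked_model.

Lemma measurable_gops_powsum (R : realType) (Sg : finType) (K : Type) (b : K -> Sg -> R)
    s ks a d (T : measurableType d) (v u : T -> Sg -> R) :
  (forall x, measurable_fun setT (fun t => v t x)) ->
  (forall x, measurable_fun setT (fun t => u t x)) ->
  measurable_fun setT (fun t => gops b s ks (powsum a (v t)) (u t)).
Proof.
move=> mv mu.
exact: ((jgood_gops b s ks (jgood_powsum a mv)).2 _ T id u (@measurable_id _ _ _) mu).
Qed.

Lemma gops_powsum_ge0 (R : realType) (Sg : finType) (K : Type) (b : K -> Sg -> R)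
    s ks a v u : (0 <= gops b s ks (powsum a v) u)%E.
Proof. exact: (good_ge0 _ (gops_good _ _ _ (good_powsum a v))). Qed.

(** * Moments of the one-sample channel *)

Section sample_level.
Context (R : realType) (L L1 : nat) (dZ : measure_display) (Zs : measurableType dZ).
Local Notation sample := (L.-tuple bool * L1.-tuple bool * Zs)%type.
Local Notation A := (L.-tuple bool).
Context (p : probability sample R) (pc : Zs -> A -> L1.-tuple bool -> R).
Hypothesis hpc : is_cond_pmf p pc.
Context (lam : 'I_L -> R).
Hypothesis lam0 : forall l, 0 <= lam l.

(** The moment of order [a] of the scalar partition function without signal; by [nishimori_sample]
    it is, for nonzero [a], the moment of order [a - 1] with the signal present. *)
Definition alpha (r : 'I_L -> R) (a : R) : \bar R :=
  \int[p]_t gops (layer_field lam r) 1 (enum 'I_L) (powsum a (pX pc t.2)) (fun=> 0%R).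

Lemma measurable_pX2 a : measurable_fun setT (fun t : sample => pX pc t.2 a).
Proof. exact: (measurableT_comp (measurable_pX hpc a) measurable_snd). Qed.

Lemma alpha_ge0 r a : (0 <= alpha r a)%E.
Proof. by apply: integral_ge0 => t _; exact: gops_powsum_ge0. Qed.

Lemma measurable_spin1 l : measurable_fun setT (fun t : sample => spin R t.1.1 l).
Proof.
rewrite (_ : (fun t => _) = (fun t : sample => \sum_(a : A) spin R a l * (t.1.1 == a)%:R)).
  by apply: measurable_sum => a; apply: measurable_funM => //; exact: measurable_eq_spin.
apply/funext => t; rewrite (bigD1 t.1.1)//= eqxx mulr1 big1 ?addr0// => a.
by rewrite eq_sym => /negbTE ->; rewrite mulr0.
Qed.

Lemma disintegration_fun (G : A -> Zs -> \bar R) :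
  (forall a, measurable_fun setT (G a)) -> (forall a z, 0 <= G a z)%E ->
  (\int[p]_t G t.1.1 t.2 = \int[p]_t \sum_a (pX pc t.2 a)%:E * G a t.2)%E.
Proof.
move=> mG G0.
have mG2 a : measurable_fun setT (fun t : sample => G a t.2).
  exact: (measurableT_comp (mG a) measurable_snd).
transitivity (\int[p]_t \sum_(a : A) (((t.1.1 == a)%:R : R)%:E * G a t.2))%E.
  apply: eq_integral => t _; rewrite (bigD1 t.1.1)//= eqxx mul1e big1 ?adde0// => a.
  by rewrite eq_sym => /negbTE ->; rewrite mul0e.
rewrite !ge0_integral_sum//.
- by apply: eq_bigr => a _; exact: (disintegration hpc).
- move=> a; apply: emeasurable_funM => //; apply/measurable_EFinP.
  exact: measurable_pX2.
- by move=> a t _; rewrite mule_ge0// lee_fin (pX_ge0 hpc).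
- move=> a; apply: emeasurable_funM => //; apply/measurable_EFinP.
  exact: measurable_eq_spin.
- by move=> a t _; rewrite mule_ge0// lee_fin ler0n.
Qed.

Lemma nishimori_sample r (a : R) : 1 + a != 0 ->
  (\int[p]_t gops (layer_field lam r) 1 (enum 'I_L) (powsum a (pX pc t.2))
     (fun x => cov (layer_field lam r) (enum 'I_L) x t.1.1) = alpha r (1 + a)%R)%E.
Proof.
move=> a1.
rewrite (disintegration_fun (G := fun y z => gops (layer_field lam r) 1 (enum 'I_L)
  (powsum a (pX pc z)) (fun x => cov (layer_field lam r) (enum 'I_L) x y))).
- apply: eq_integral => t _; apply: nishimori => // y; exact: (pX_ge0 hpc).
- by move=> y; apply: measurable_gops_powsum => x //; exact: (measurable_pX hpc).
- by move=> y z; exact: gops_powsum_ge0.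
Qed.

(** A variance cannot be negative, so the comparison field has parameter |m| while the drift keeps
    the sign of [m]. This mismatch is a sign flip of some layers, to which [flipped_signs] applies
    with [sg] the sign of [m]. *)
Lemma signed_le_alpha (m : 'I_L -> R) (t : R) : 0 < t ->
  (\int[p]_s gops (layer_field lam (fun l => `|m l|)%R) 1 (enum 'I_L) (powsum t (pX pc s.2))
     (fun x => \sum_l lam l * m l * spin R s.1.1 l * spin R x l)%R
   <= alpha (fun l => `|m l|)%R (1 + t)%R)%E.
Proof.
move=> t0; set r := (fun l : 'I_L => `|m l|).
rewrite (disintegration_fun (G := fun y z => gops (layer_field lam r) 1 (enum 'I_L)
  (powsum t (pX pc z)) (fun x => \sum_l lam l * m l * spin R y l * spin R x l))); last 2 first.
- by move=> y; apply: measurable_gops_powsum => x //; exact: (measurable_pX hpc).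
- by move=> y z; exact: gops_powsum_ge0.
apply: ge0_le_integral => //.
- move=> s _; apply: sume_ge0 => y _.
  by rewrite mule_ge0 ?lee_fin ?(pX_ge0 hpc)//; exact: gops_powsum_ge0.
- apply: emeasurable_sum => y; apply: emeasurable_funM.
    by apply/measurable_EFinP; exact: measurable_pX2.
  by apply: measurable_gops_powsum => x //; exact: measurable_pX2.
- by apply: measurable_gops_powsum => x //; exact: measurable_pX2.
move=> s _.
pose sg (l : 'I_L) : R := if 0 <= m l then 1 else - 1.
have sg1 l : sg l = 1 \/ sg l = -1 by rewrite /sg; case: ifP; [left|right].
apply: le_trans (flipped_signs (layer_field lam r) (enum 'I_L) (pX_ge0 hpc s.2) sg1 t0).
rewrite le_eqVlt; apply/orP; left; apply/eqP; apply: eq_bigr => y _.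
congr (_ * gops _ _ _ _ _)%E; apply/funext => x; rewrite big_enum/=.
apply: eq_bigr => l _; rewrite /layer_field.
have -> : lam l * m l = sg l * (Num.sqrt (lam l * r l) ^+ 2).
  have lr0 : 0 <= lam l * r l by rewrite mulr_ge0// /r normr_ge0.
  rewrite sqr_sqrtr// /sg /r; case: ifP => ml.
    by rewrite ger0_norm// mul1r.
  by rewrite ltr0_norm ?ltNge ?ml//; ring.
ring.
Qed.

End sample_level.

(** * Moment bounds for the spiked partition function *)

Section moments.
Context (R : realType) (L L1 : nat) (dZ : measure_display) (Zs : measurableType dZ).
Local Notation sample := (L.-tuple bool * L1.-tuple bool * Zs)%type.
Local Notation A := (L.-tuple bool).
Context (p : probability sample R) (pc : Zs -> A -> L1.-tuple bool -> R).
Hypothesis hpc : is_cond_pmf p pc.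
Context (lam : 'I_L -> R).
Hypothesis lam0 : forall l, 0 <= lam l.
Context d (Omega : measurableType d) (P : probability Omega R) (n : nat).
Context (S : 'I_n -> {RV P >-> sample}) (W : 'I_L -> 'I_n -> 'I_n -> {RV P >-> R}).
Hypothesis hSW : is_spiked_model p S W.
Hypothesis n0 : (0 < n)%N.
Local Notation cfg := {ffun 'I_n -> A}.
Local Notation K := ('I_L * ('I_n * 'I_n))%type.
Local Notation wts w := (weights pc (fun i => (S i w).2)).
Local Notation field := (pair_field lam (n := n)).
Local Notation noise_ := (noise (fun k : K => W k.1 k.2.1 k.2.2) field (pairs L n)).
Local Notation comp r := (compensator n lam r).

(** The drift [cov] is the signal, and [noise_] includes the compensating terms of [tilt], so this
    form suits both the Nishimori identity and [kahane]. The deterministic factor separating it from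
    the partition function is computed in [partition_functionE]. *)
Definition Ztilde w : R :=
  wsum (wts w) (fun x => cov field (pairs L n) x (planted S w) + noise_ w x).

Lemma mS i : measurable_fun setT (fun w => (S i w).2).
Proof. exact: measurableT_comp. Qed.

Lemma mwts x : measurable_fun setT (fun w => wts w x).
Proof. by apply: (measurable_weights hpc) => i; exact: mS. Qed.

(* The Nishimori identity turns the planted moment of order [- t] into an
   unplanted one of order [1 - t], which lies in the range of [kahane]. *)
Lemma lower_moment (t : R) (r : 'I_L -> R) : 0 < t < 1 -> (forall l, 0 <= r l) ->
  (\int[P]_w (Ztilde w `^ (- t))%:E <=
   (expR (t * (1 - t) * comp r / 2))%:E * \prod_(i < n) alpha p pc lam r (1 - t)%R)%E.
Proof.
move=> t01 r0; have /andP[t0 t1] := t01.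
have t1n : 1 + - t != 0 by rewrite gt_eqF//; lra.
have t01' : 0 < 1 - t < 1 by lra.
rewrite -[leLHS]/(\int[P]_w powsum (- t) (wts w)
  (fun x => cov field (pairs L n) x (planted S w) + noise_ w x)%R)%E.
rewrite (spiked_link hpc lam hSW (- t) (cov field (pairs L n))).
rewrite (spiked_disintegration hpc hSW (G := fun tau z =>
  gops field 1 (pairs L n) (powsum (- t) (weights pc z)) (fun x => cov field (pairs L n) x tau))).
  2: { move=> tau; split => [z|d' T' z mz]; first exact: gops_powsum_ge0.
       apply: measurable_gops_powsum => x //; exact: (measurable_weights hpc). }
under eq_integral => w _.
  rewrite (nishimori field (pairs L n) (v := wts w)) => [|x|]; [|exact: (weights_ge0 hpc)|exact: t1n].
  over.
pose Psi (s : sample) := gops (layer_field lam r) 1 (enum 'I_L) (powsum (1 - t) (pX pc s.2)) (fun=> 0%R).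
have mPsi : measurable_fun setT Psi.
  by apply: measurable_gops_powsum => x //; exact: (measurable_pX2 hpc).
have Psi0 s : (0 <= Psi s)%E by exact: gops_powsum_ge0.
have mprod : measurable_fun setT (fun w => \prod_i Psi (S i w))%E.
  elim: (index_enum _) => [|i js IH].
    rewrite (_ : (fun w => _) = cst 1%E); first exact: measurable_cst.
    by apply/funext => w; rewrite big_nil.
  rewrite (_ : (fun w => _) = (fun w => Psi (S i w) * \prod_(j <- js) Psi (S j w))%E).
    by apply: emeasurable_funM => //; exact: measurableT_comp.
  by apply/funext => w; rewrite big_cons.
have prod0 w : (0 <= \prod_i Psi (S i w))%E.
  by elim/big_ind : _ => // x y x0 y0; exact: mule_ge0.
apply: (@le_trans _ _ (\int[P]_w ((expR (t * (1 - t) * comp r / 2))%:E *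
    \prod_i Psi (S i w)))%E).
  apply: ge0_le_integral => //.
  - by move=> w _; exact: gops_powsum_ge0.
  - by apply: measurable_gops_powsum => x //; exact: mwts.
  - by apply: emeasurable_funM => //; exact: measurable_cst.
  - move=> w _.
    have := guerra_prod lam0 n0 r0 (fun _ _ => 0) t01' (fun i => pX_ge0 hpc (S i w).2).
    rewrite (_ : (fun x : cfg => \sum_(i < n) 0) = fun=> 0); last first.
      by apply/funext => x; rewrite big1.
    have -> : (1 - t - (1 - t) ^+ 2) * comp r / 2 = t * (1 - t) * comp r / 2 by ring.
    by [].
rewrite ge0_integralZl//.
by rewrite (spiked_prod hSW (Psi := fun _ => Psi) (fun _ => mPsi) (fun _ => Psi0)).
Qed.

(** Two configurations that agree at k of the [n] sites of a layer have overlap 2k - n there before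
    normalization, hence n + 1 possible values per layer. *)
Definition mag (m : {ffun 'I_L -> 'I_n.+1}) (l : 'I_L) : R := (2 * (m l)%:R - n%:R) / n%:R.

Lemma mag_le1 m l : `|mag m l| <= 1.
Proof.
have n0' : 0 < (n%:R : R) by rewrite ltr0n.
have h : ((m l)%:R : R) <= n%:R by rewrite ler_nat -ltnS.
have h0 : 0 <= ((m l)%:R : R) by rewrite ler0n.
by rewrite /mag ler_norml ler_pdivrMr// ler_pdivlMr//; lra.
Qed.

Definition tilt_field m (x y : cfg) : R := \sum_l lam l * mag m l * overlap R l x y.

(* The grid of magnetizations contains every overlap exactly, so linearizing
   the quadratic signal at the right grid point is an equality. *)
Lemma overlap_grid (x y : cfg) : exists m, forall l, overlap R l x y = n%:R * mag m l.
Proof.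
pose c l := #|[set i | tnth (x i) l == tnth (y i) l]|%SET.
have cn l : (c l < n.+1)%N by rewrite ltnS -[X in (_ <= X)%N]card_ord max_card.
exists [ffun l => Ordinal (cn l)] => l.
have n0' : (n%:R : R) != 0 by rewrite pnatr_eq0 -lt0n.
rewrite /mag ffunE /= mulrCA divff// mulr1.
have E i : spin R (x i) l * spin R (y i) l = 2 * (tnth (x i) l == tnth (y i) l)%:R - 1.
  by rewrite /spin; case: (tnth (x i) l); case: (tnth (y i) l); rewrite /= ?expr1 ?expr0; ring.
rewrite /overlap; under eq_bigr do rewrite E.
rewrite sumrB -mulr_sumr sumr_const card_ord; congr (2 * _ - _).
rewrite -natr_sum; congr (_%:R).
by rewrite /c -sum1dep_card [RHS]big_mkcond/=; apply: eq_bigr => i _; case: eqP.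
Qed.

Definition Zm m w : R := wsum (wts w) (fun x => tilt_field m x (planted S w) + noise_ w x).

(** The matching grid point depends on [x]; adding the nonnegative terms of all the others makes the
    range of the sum independent of [x]. When the overlap is n m, the signal equals the tilt minus
    the compensator exactly. *)
Lemma Ztilde_le w : Ztilde w <= \sum_m expR (- comp (mag m)) * Zm m w.
Proof.
have n0' : (n%:R : R) != 0 by rewrite pnatr_eq0 -lt0n.
rewrite /Ztilde /Zm /wsum; under [leRHS]eq_bigr do rewrite mulr_sumr.
rewrite exchange_big/=; apply: ler_sum => x _.
have [m hm] := overlap_grid x (planted S w).
rewrite (bigD1 m)//= -[leLHS]addr0 lerD//; last first.
  by apply: sumr_ge0 => i _; rewrite !mulr_ge0 ?expR_ge0//; exact: (weights_ge0 hpc).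
rewrite mulrCA ler_wpM2l//; first exact: (weights_ge0 hpc).
rewrite -expRD ler_expR addrA lerD2r le_eqVlt; apply/orP; left; apply/eqP.
rewrite cov_pairs// /tilt_field /compensator -sumrN -big_split/=.
by apply: eq_bigr => l _; rewrite hm; field.
Qed.

Lemma upper_moment (t : R) : 0 < t < 1 ->
  (\int[P]_w (Ztilde w `^ t)%:E <=
   \sum_(m : {ffun 'I_L -> 'I_n.+1}) (expR (- (t * comp (mag m) / 2)))%:E *
     \prod_(i < n) alpha p pc lam (fun l => `|mag m l|)%R (1 + t)%R)%E.
Proof.
move=> t01; have /andP[t0 t1] := t01.
pose h m w x : R := tilt_field m x (planted S w).
have mh m x : measurable_fun setT (fun w => h m w x).
  apply: (@measurable_fun_ffun R L n _ Omega (fun i w => (S i w).1.1)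
    (fun y => tilt_field m x y)) => i.
  exact: (measurableT_comp measurable_fst (measurableT_comp measurable_fst _)).
have mcov x : measurable_fun setT (fun w => cov field (pairs L n) x (planted S w)).
  apply: (@measurable_fun_ffun R L n _ Omega (fun i w => (S i w).1.1)
    (fun y => cov field (pairs L n) x y)) => i.
  exact: (measurableT_comp measurable_fst (measurableT_comp measurable_fst _)).
have mnoise x : measurable_fun setT (fun w => noise_ w x).
  apply: measurable_sum => k; apply: measurable_funB => //.
  by apply: measurable_funM.
have mpow (g : Omega -> cfg -> R) : (forall x, measurable_fun setT (fun w => g w x)) ->
    measurable_fun setT (fun w => powsum t (wts w) (g w)).
  by move=> mg; apply: ((jgood_powsum t mwts).2 _ Omega id g _ mg).
have mZ m : measurable_fun setT (fun w => (Zm m w `^ t)%:E).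
  by apply: (mpow (fun w x => h m w x + noise_ w x)) => x; exact: measurable_funD.
apply: (@le_trans _ _ (\int[P]_w (\sum_m (expR (- (t * comp (mag m))))%:E * (Zm m w `^ t)%:E))%E).
  apply: ge0_le_integral => //.
  - by move=> w _; rewrite lee_fin powR_ge0.
  - by apply: (mpow (fun w x => cov field (pairs L n) x (planted S w) + noise_ w x)) => x;
      exact: measurable_funD.
  - by apply: emeasurable_sum => m; apply: emeasurable_funM => //; exact: measurable_cst.
  move=> w _; under eq_bigr do rewrite -EFinM.
  rewrite sumEFin lee_fin.
  have Zm0 m : 0 <= expR (- comp (mag m)) * Zm m w.
    by rewrite mulr_ge0 ?expR_ge0// wsum_ge0// => x; exact: (weights_ge0 hpc).
  apply: (@le_trans _ _ ((\sum_m expR (- comp (mag m)) * Zm m w) `^ t)).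
    apply: ge0_ler_powR; rewrite ?nnegrE ?(ltW t0)//.
    - by rewrite wsum_ge0// => x; exact: (weights_ge0 hpc).
    - exact: sumr_ge0.
    - exact: Ztilde_le.
  apply: (le_trans (powR_sum_le _ t01 Zm0)); apply: ler_sum => m _.
  rewrite powRM ?expR_ge0//; last by rewrite wsum_ge0// => x; exact: (weights_ge0 hpc).
  by rewrite {1}/powR gt_eqF ?expR_gt0// expRK mulrN.
rewrite ge0_integral_sum//; last 2 first.
- by move=> m; apply: emeasurable_funM => //; exact: measurable_cst.
- by move=> m w _; rewrite mule_ge0// lee_fin ?expR_ge0// powR_ge0.
apply: lee_sum => m _.
rewrite ge0_integralZl//; last by move=> w _; rewrite lee_fin powR_ge0.
rewrite -[X in (_ * X <= _)%E]/(\int[P]_w powsum t (wts w)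
  (fun x => tilt_field m x (planted S w) + noise_ w x)%R)%E.
rewrite (spiked_link hpc lam hSW t (tilt_field m)).
pose r l := `|mag m l|.
have r0 l : 0 <= r l by rewrite /r normr_ge0.
pose u (s : sample) (a : A) : R := \sum_l lam l * mag m l * spin R s.1.1 l * spin R a l.
pose Psi (s : sample) := gops (layer_field lam r) 1 (enum 'I_L) (powsum t (pX pc s.2)) (u s).
have mu a : measurable_fun setT (fun s => u s a).
  apply: measurable_sum => l; apply: measurable_funM => //; apply: measurable_funM => //.
  exact: measurable_spin1.
have mPsi : measurable_fun setT Psi.
  by apply: measurable_gops_powsum => x //; exact: (measurable_pX2 hpc).
have Psi0 s : (0 <= Psi s)%E by exact: gops_powsum_ge0.
have mprod : measurable_fun setT (fun w => \prod_i Psi (S i w))%E.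
  elim: (index_enum _) => [|i js IH].
    rewrite (_ : (fun w => _) = cst 1%E); first exact: measurable_cst.
    by apply/funext => w; rewrite big_nil.
  rewrite (_ : (fun w => _) = (fun w => Psi (S i w) * \prod_(j <- js) Psi (S j w))%E).
    by apply: emeasurable_funM => //; exact: measurableT_comp.
  by apply/funext => w; rewrite big_cons.
have prod0 w : (0 <= \prod_i Psi (S i w))%E.
  by elim/big_ind : _ => // x y x0 y0; exact: mule_ge0.
have compE : comp (mag m) = comp r.
  by apply: eq_bigr => l _; rewrite /r real_normK// num_real.
have comp0 : 0 <= comp r by exact: compensator_ge0.
apply: (@le_trans _ _ ((expR (- (t * comp (mag m))))%:E * (\int[P]_w ((expR ((t - t ^+ 2) * comp r / 2))%:E *
    \prod_i Psi (S i w)))%E)%E).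
  rewrite lee_wpmul2l ?lee_fin ?expR_ge0//.
  apply: ge0_le_integral => //.
  - by move=> w _; exact: gops_powsum_ge0.
  - by apply: measurable_gops_powsum => x; [exact: mwts|exact: mh].
  - by apply: emeasurable_funM => //; exact: measurable_cst.
  - move=> w _.
    have := guerra_prod lam0 n0 r0 (fun i => u (S i w)) t01 (fun i => pX_ge0 hpc (S i w).2).
    rewrite (_ : (fun x : cfg => \sum_(i < n) u (S i w) (x i)) = fun x => tilt_field m x (planted S w))//.
    apply/funext => x; rewrite /u exchange_big/=; apply: eq_bigr => l _.
    rewrite /overlap mulr_sumr; apply: eq_bigr => i _; rewrite /planted ffunE; ring.
rewrite ge0_integralZl//.
rewrite (spiked_prod hSW (Psi := fun _ => Psi) (fun _ => mPsi) (fun _ => Psi0)).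
rewrite muleA -EFinM -expRD.
have PsiI : (\int[p]_s Psi s <= alpha p pc lam r (1 + t)%R)%E by exact: (signed_le_alpha hpc).
have I0 : (0 <= \int[p]_s Psi s)%E by exact: integral_ge0.
apply: lee_pmul.
- by rewrite lee_fin expR_ge0.
- by elim/big_ind : _ => // x y x0 y0; exact: mule_ge0.
(* The linearization contributes - t comp to the exponent and the comparison gives back (t - t^2)
   comp / 2; the total is at most - t comp / 2. *)
- rewrite lee_fin ler_expR compE.
  have -> : - (t * comp r) + (t - t ^+ 2) * comp r / 2 = - (t * comp r / 2) - t ^+ 2 * comp r / 2 by field.
  by rewrite gerBl divr_ge0// mulr_ge0// sqr_ge0.
- elim: (index_enum _) => [|i js IH]; first by rewrite !big_nil.
  rewrite !big_cons; apply: lee_pmul => //.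
  by elim/big_ind : _ => // x y x0 y0; exact: mule_ge0.
Qed.

End moments.

(** * From exponential moments to logarithms *)

Section log_moments.
Context d (T : measurableType d) (R : realType) (P : probability T R).
Implicit Types (X B : T -> R).

Lemma expR_le_quadratic (y : R) : expR y <= 1 + y + y ^+ 2 * expR `|y|.
Proof.
have h1 := expR_sub1_le y; have h2 := expR_ge1Dx y.
have [y0|y0] := leP 0 y; first by rewrite ger0_norm//; nra.
have h3 : 1 <= expR `|y| by rewrite -expR0 ler_expR.
have := sqr_ge0 y; nra.
Qed.

Lemma expR_scaled_le (t x b : R) : `|t| <= 1 -> `|x| <= b ->
  expR (t * x) <= 1 + t * x + 2 * t ^+ 2 * expR (2 * b).
Proof.
move=> t1 xb; apply: (le_trans (expR_le_quadratic (t * x))).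
rewrite lerD2l exprMn.
have -> : 2 * t ^+ 2 * expR (2 * b) = t ^+ 2 * (2 * expR (2 * b)) by ring.
rewrite -mulrA ler_wpM2l ?sqr_ge0//.
have h1 : expR `|t * x| <= expR `|x|.
  by rewrite ler_expR normrM ler_piMl.
have h2 : x ^+ 2 <= 2 * expR `|x|.
  have := expR_ge1Dxn 1 (normr_ge0 x); rewrite real_normK ?num_real//.
  by rewrite (_ : 2`!%:R = 2 :> R)//; lra.
apply: (@le_trans _ _ (2 * expR `|x| * expR `|x|)).
  by apply: ler_pM; rewrite ?sqr_ge0 ?expR_ge0.
rewrite -mulrA -expRD ler_pM2l// ler_expR; lra.
Qed.

Lemma integrable_of_exp X B (c : R) : measurable_fun setT X -> measurable_fun setT B ->
  (forall w, `|X w| <= B w) -> 0 < c ->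
  (\int[P]_w (expR (c * B w))%:E < +oo)%E -> P.-integrable setT (EFin \o X).
Proof.
move=> mX mB XB c0 fin.
have me : measurable_fun setT (fun w => (expR (c * B w))%:E).
  apply/measurable_EFinP; apply: measurableT_comp => //.
  exact: measurable_funM.
apply: (@le_integrable _ _ _ _ _ measurableT _ (fun w => (c^-1 * expR (c * B w))%:E)) => //.
- exact/measurable_EFinP.
- move=> w _ /=; rewrite lee_fin [leRHS]ger0_norm; last by rewrite mulr_ge0 ?expR_ge0// invr_ge0 ltW.
  apply: (le_trans (XB w)); rewrite mulrC ler_pdivlMr// mulrC.
  by have := expR_ge1Dx (c * B w); lra.
- apply/integrableP; split.
    under eq_fun do rewrite EFinM.
    by apply: emeasurable_funM => //; exact: measurable_cst.
  under eq_integral => w _.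
    rewrite gee0_abs ?lee_fin; last by rewrite mulr_ge0 ?expR_ge0// invr_ge0 ltW.
    rewrite EFinM; over.
  rewrite ge0_integralZl// ?lee_fin ?invr_ge0 ?(ltW c0)//.
  by rewrite lte_mul_pinfty// ?lee_fin ?invr_ge0 ?(ltW c0)//.
Qed.

(** Second-order expansion of the exponential at 0, with the exponential moment of a dominating
    variable in the remainder. It bounds a moment by a mean, the direction opposite to
    [log_moment_le]. *)
Lemma exp_moment_le X B (t M : R) : measurable_fun setT X -> measurable_fun setT B ->
  (forall w, `|X w| <= B w) -> (\int[P]_w (expR (2 * B w))%:E <= M%:E)%E ->
  `|t| <= 1 ->
  (\int[P]_w (expR (t * X w))%:E <= 1 + t%:E * \int[P]_w (X w)%:E + (2 * t ^+ 2 * M)%:E)%E.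
Proof.
move=> mX mB XB BM t1.
have fin : (\int[P]_w (expR (2 * B w))%:E < +oo)%E by rewrite (le_lt_trans BM) ?ltry.
have iX := integrable_of_exp mX mB XB (ltr0Sn R 1) fin.
have me : measurable_fun setT (fun w => (expR (2 * B w))%:E).
  apply/measurable_EFinP; apply: measurableT_comp => //.
  exact: measurable_funM.
have ie : P.-integrable setT (fun w => (expR (2 * B w))%:E).
  apply/integrableP; split => //.
  by under eq_integral do rewrite gee0_abs ?lee_fin ?expR_ge0//.
have i1 : P.-integrable setT (fun=> 1%E) by exact: finite_measure_integrable_cst.
have itX : P.-integrable setT (fun w => (t%:E * (X w)%:E)%E) by exact: integrableZl.
have ite : P.-integrable setT (fun w => ((2 * t ^+ 2)%:E * (expR (2 * B w))%:E)%E).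
  exact: integrableZl.
have i1X : P.-integrable setT (fun w => (1 + t%:E * (X w)%:E)%E) by exact: integrableD.
have met : measurable_fun setT (fun w => (expR (t * X w))%:E).
  apply/measurable_EFinP; apply: measurableT_comp => //.
  exact: measurable_funM.
have ile : P.-integrable setT (fun w => (expR (t * X w))%:E).
  apply: (le_integrable measurableT met _ ie) => w _ /=.
  rewrite lee_fin !ger0_norm ?expR_ge0// ler_expR.
  have h0 : `|t * X w| <= `|X w| by rewrite normrM ler_piMl.
  have h1 := XB w; have h2 := ler_norm (t * X w); have h3 := normr_ge0 (X w); lra.
apply: (@le_trans _ _ (\int[P]_w ((1 + t%:E * (X w)%:E) + (2 * t ^+ 2)%:E * (expR (2 * B w))%:E))%E).
  apply: le_integral => //; first exact: integrableD.
  move=> w _; rewrite -!EFinM -!EFinD lee_fin.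
  exact: expR_scaled_le.
rewrite integralD// integralD// integral_cst//= probability_setT mul1e.
rewrite integralZl// integralZl// leeD2l// [X in (_ <= X)%E]EFinM lee_wpmul2l// lee_fin.
by rewrite mulr_ge0// sqr_ge0.
Qed.

(** Jensen's inequality in tangent form: y <= ln c - 1 + e^y / c, integrated at y = t X. *)
Lemma log_moment_le X (t c : R) : P.-integrable setT (EFin \o X) -> 0 < c ->
  (\int[P]_w (expR (t * X w))%:E <= c%:E)%E ->
  (t%:E * \int[P]_w (X w)%:E <= (ln c)%:E)%E.
Proof.
move=> iX c0 h.
have mX : measurable_fun setT X by apply/measurable_EFinP; exact: measurable_int iX.
have met : measurable_fun setT (fun w => (expR (t * X w))%:E).
  apply/measurable_EFinP; apply: measurableT_comp => //.
  exact: measurable_funM.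
have ie : P.-integrable setT (fun w => (expR (t * X w))%:E).
  apply/integrableP; split => //.
  under eq_integral do rewrite gee0_abs ?lee_fin ?expR_ge0//.
  by rewrite (le_lt_trans h) ?ltry.
have ice : P.-integrable setT (fun w => ((c^-1)%:E * (expR (t * X w))%:E)%E) by exact: integrableZl.
have ik : P.-integrable setT (fun=> (ln c - 1)%:E) by exact: finite_measure_integrable_cst.
rewrite -integralZl//.
apply: (@le_trans _ _ (\int[P]_w ((ln c - 1)%:E + (c^-1)%:E * (expR (t * X w))%:E))%E).
  apply: le_integral => //.
  - exact: integrableZl.
  - exact: integrableD.
  move=> w _; rewrite -!EFinM -EFinD lee_fin.
  have := expR_ge1Dx (t * X w - ln c).
  rewrite expRD expRN lnK ?posrE// => h1.
  rewrite (mulrC c^-1); lra.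
rewrite integralD// integral_cst//= probability_setT mule1 integralZl//.
have ci : (0 <= (c^-1)%:E)%E by rewrite lee_fin invr_ge0 ltW.
apply: (le_trans (leeD2l _ (lee_wpmul2l ci h))).
by rewrite -EFinM -EFinD lee_fin mulVf ?gt_eqF//; lra.
Qed.

Lemma normal_abs_exp (c : R) :
  (\int[normal_prob 0 1]_g (expR (c * `|g|))%:E <= (2 * expR (c ^+ 2 / 2))%:E)%E.
Proof.
have m k : measurable_fun setT (fun g : measurableTypeR R => (expR (k * g))%:E).
  by apply/measurable_EFinP; apply: measurableT_comp => //; exact: measurable_funM.
have E k : (\int[normal_prob 0 1]_g (expR (k * g))%:E = (expR (k ^+ 2 / 2))%:E :> \bar R)%E.
  transitivity (\int[normal_prob 0 1]_g ((expR (k ^+ 2 / 2))%:E * (expR (k * g - 1 ^+ 2 * k ^+ 2 / 2))%:E))%E.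
    by apply: eq_integral => g _; rewrite -EFinM -expRD; congr ((expR _)%:E); ring.
  rewrite ge0_integralZl//.
  - by rewrite normal_expR// mule1.
  - by apply/measurable_EFinP; apply: measurableT_comp => //; apply: measurable_funB => //; exact: measurable_funM.
apply: (@le_trans _ _ (\int[normal_prob 0 1]_g ((expR (c * g))%:E + (expR (- c * g))%:E))%E).
  apply: ge0_le_integral => //.
  - by apply/measurable_EFinP; apply: measurableT_comp => //; apply: measurable_funM => //.
  - by apply: emeasurable_funD => //; exact: m.
  - move=> g _; rewrite -EFinD lee_fin.
    have [g0|g0] := leP 0 g; first by rewrite ger0_norm// lerDl expR_ge0.
    by rewrite ltr0_norm// mulrN -mulNr lerDr expR_ge0.
rewrite ge0_integralD// E E sqrrN -EFinD lee_fin; lra.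
Qed.

Lemma gaussian_abs_exp (G : {RV P >-> R}) (c : R) : has_law G (normal_prob 0 1) ->
  (\int[P]_w (expR (c * `|G w|))%:E <= (2 * expR (c ^+ 2 / 2))%:E)%E.
Proof.
move=> lG; apply: le_trans (normal_abs_exp c).
have mf : measurable_fun setT (fun g : measurableTypeR R => (expR (c * `|g|))%:E).
  by apply/measurable_EFinP; apply: measurableT_comp => //; apply: measurable_funM => //.
have mG0 : measurable_fun setT G by exact: measurable_funP.
have mG : measurable_fun setT (G : T -> measurableTypeR R).
  by move=> mT B mB; exact: mG0.
pose mG_mixin := isMeasurableFun.Build _ _ _ _ _ mG.
pose G' : {RV P >-> measurableTypeR R} := HB.pack (G : T -> measurableTypeR R) mG_mixin.
rewrite -(@ge0_integral_distribution _ _ _ _ _ P G' (fun g => (expR (c * `|g|))%:E))//.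
rewrite le_eqVlt; apply/orP; left; apply/eqP.
by apply: eq_measure_integral => B mB _; exact: lG.
Qed.

(** The sum is at most the number of terms times the largest one. Exponential moments of a sum thus
    reduce to those of single terms; the 1 covers an empty index type. *)
Lemma expR_sum_le (I : finType) (x : I -> R) : (forall i, 0 <= x i) ->
  expR (\sum_i x i) <= 1 + \sum_i expR (#|I|%:R * x i).
Proof.
move=> x0; case: (pickP (fun _ : I => true)) => [i0 _|I0]; last first.
  by rewrite !big_pred0// expR0 addr0.
have [i _ hi] := arg_maxP x (isT : xpredT i0).
apply: (@le_trans _ _ (expR (#|I|%:R * x i))).
  rewrite ler_expR mulr_natl -sumr_const; apply: ler_sum => j _; exact: hi.
rewrite (bigD1 i)//= addrCA lerDl addr_ge0//.
by apply: sumr_ge0 => j _; exact: expR_ge0.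
Qed.

Lemma wsum_between (Sg : finType) (v u : Sg -> R) (B : R) : (forall x, 0 <= v x) ->
  \sum_x v x = 1 -> (forall x, `|u x| <= B) -> `|ln (wsum v u)| <= B /\ 0 < wsum v u.
Proof.
move=> v0 v1 uB.
have h1 : expR (- B) <= wsum v u.
  rewrite -[leLHS]mul1r -v1 mulr_suml; apply: ler_sum => x _; rewrite ler_wpM2l// ler_expR.
  by have := uB x; rewrite ler_norml => /andP[].
have h2 : wsum v u <= expR B.
  rewrite -[leRHS]mul1r -[X in _ <= X * _]v1 mulr_suml; apply: ler_sum => x _; rewrite ler_wpM2l// ler_expR.
  by have := uB x; rewrite ler_norml => /andP[].
have w0 : 0 < wsum v u by apply: lt_le_trans h1; exact: expR_gt0.
split => //; rewrite ler_norml -[- B]expRK -[X in _ && (_ <= X)]expRK.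
by rewrite !ler_ln ?posrE ?expR_gt0// h1 h2.
Qed.

End log_moments.

Lemma norm_spin (R : realType) (L : nat) (a : L.-tuple bool) l : `|spin R a l| = 1.
Proof. by rewrite /spin normrX normrN1 expr1n. Qed.

(** * Logarithmic moments of the scalar model *)

Section scalar_model.
Context (R : realType) (L L1 : nat) (dZ : measure_display) (Zs : measurableType dZ).
Local Notation sample := (L.-tuple bool * L1.-tuple bool * Zs)%type.
Local Notation A := (L.-tuple bool).
Context (p : probability sample R) (pc : Zs -> A -> L1.-tuple bool -> R).
Hypothesis hpc : is_cond_pmf p pc.
Context (lam : 'I_L -> R).
Hypothesis lam0 : forall l, 0 <= lam l.
Context d (Omega : measurableType d) (P : probability Omega R).
Context (S : {RV P >-> sample}) (G : 'I_L -> {RV P >-> R}).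
Hypothesis hSG : is_scalar_model p S G.
Local Notation F := (scalar_source_sigma S G).
Local Notation beta q := (layer_field lam q).
Local Notation noise_ q := (noise (fun l => G l : Omega -> R) (beta q) (enum 'I_L)).

Let FT s : F s setT.
Proof. by case: s => [l|]; exact: sigma_ofT. Qed.

Let Fm s : F s `<=` measurable.
Proof. by case: s => [l|]; exact: sigma_of_measurable. Qed.

Let FI s : setI_closed (F s).
Proof. by case: s => [l|]; exact: sigma_of_setI. Qed.

Let J : {set option 'I_L} := [set None]%SET.

Let uks : uniq [seq Some l | l <- enum 'I_L].
Proof. by rewrite map_inj_uniq ?enum_uniq// => l l' []. Qed.

Let ksJ l : l \in enum 'I_L -> Some l \notin J.
Proof. by rewrite inE. Qed.

Let FW l B : l \in enum 'I_L -> measurable B -> F (Some l) (G l @^-1` B).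
Proof. by move=> _ mB; exact: sigma_of_preimage. Qed.

Let lW l B : l \in enum 'I_L -> measurable B -> P (G l @^-1` B) = normal_prob 0 1 B.
Proof. by move=> _ mB; exact: (scalar_noise_law hSG). Qed.

Let aS : adapted F J S.
Proof.
apply: (@adapted_source _ _ _ _ FT J None); first by rewrite inE.
by move=> B mB; exact: sigma_of_preimage.
Qed.

Lemma measurable_fun_spins (f : A -> R) : measurable_fun setT (fun t : sample => f t.1.1).
Proof.
rewrite (_ : (fun t => _) = (fun t : sample => \sum_(a : A) f a * (t.1.1 == a)%:R)).
  by apply: measurable_sum => a; apply: measurable_funM => //; exact: measurable_eq_spin.
apply/funext => t; rewrite (bigD1 t.1.1)//= eqxx mulr1 big1 ?addr0// => a.
by rewrite eq_sym => /negbTE ->; rewrite mulr0.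
Qed.

Definition zscalar q w : R := wsum (pX pc (S w).2)
  (fun x => cov (beta q) (enum 'I_L) x (S w).1.1 + noise_ q w x).

Definition log_zscalar q w : R := ln (zscalar q w).

(** Dominates |log Z| at once for all nonnegative parameters [q] with [q l <= c]: lam c for the
    drift, at most lam c for the compensating term, and the Gaussian term. *)
Definition scalar_bound (c : R) w : R :=
  \sum_l (2 * (lam l * c) + Num.sqrt (lam l * c) * `|G l w|).

(** The bound on E[exp(2 scalar_bound)] given by [expR_sum_le], with [L] terms, and by the Gaussian
    exponential moment 2 exp(k^2 / 2). It depends neither on the number of samples nor on [q], which
    makes the later errors uniform. *)
Definition scalar_moment_bound (c : R) : R :=
  expR (\sum_l 4 * (lam l * c)) *
  (1 + \sum_(l < L) 2 * expR ((L%:R * (2 * Num.sqrt (lam l * c))) ^+ 2 / 2)).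

Lemma measurable_zscalar q : measurable_fun setT (zscalar q).
Proof.
apply: measurable_sum => x; apply: measurable_funM.
  exact: (measurableT_comp (measurable_pX2 hpc x)).
apply: measurableT_comp => //; apply: measurable_funD.
  exact: (measurableT_comp (measurable_fun_spins (fun y => cov (beta q) (enum 'I_L) x y))).
apply: measurable_sum => l; apply: measurable_funB => //.
exact: measurable_funM.
Qed.

Lemma measurable_scalar_bound c : measurable_fun setT (scalar_bound c).
Proof.
apply: measurable_sum => l; apply: measurable_funD => //.
by apply: measurable_funM => //; exact: measurableT_comp.
Qed.

Lemma scalar_moment_bound_ge0 c : 0 <= scalar_moment_bound c.
Proof.
rewrite mulr_ge0 ?expR_ge0// addr_ge0//; apply: sumr_ge0 => l _.
by rewrite mulr_ge0 ?expR_ge0.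
Qed.

Lemma scalar_bound_exp c : 0 <= c ->
  (\int[P]_w (expR (2 * scalar_bound c w))%:E <= (scalar_moment_bound c)%:E)%E.
Proof.
move=> c0.
have me l : measurable_fun setT (fun w => (expR (L%:R * (2 * Num.sqrt (lam l * c)) * `|G l w|))%:E).
  apply/measurable_EFinP; apply: measurableT_comp => //; apply: measurable_funM => //.
  exact: measurableT_comp.
have ms : measurable_fun setT (fun w => (\sum_l (expR (L%:R * (2 * Num.sqrt (lam l * c)) * `|G l w|))%:E)%E).
  exact: emeasurable_sum.
apply: (@le_trans _ _ (\int[P]_w ((expR (\sum_l 4 * (lam l * c))%R)%:E *
   (1 + \sum_l (expR (L%:R * (2 * Num.sqrt (lam l * c)) * `|G l w|)%R)%:E)))%E).
  apply: ge0_le_integral => //.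
  - apply/measurable_EFinP; apply: measurableT_comp => //; apply: measurable_funM => //.
    exact: measurable_scalar_bound.
  - by apply: emeasurable_funM; [exact: measurable_cst|exact: emeasurable_funD].
  - move=> w _; rewrite sumEFin -EFinD -EFinM lee_fin.
    have -> : 2 * scalar_bound c w = \sum_l 4 * (lam l * c) +
        \sum_l 2 * Num.sqrt (lam l * c) * `|G l w|.
      by rewrite /scalar_bound mulr_sumr -big_split/=; apply: eq_bigr => l _; ring.
    rewrite expRD ler_wpM2l ?expR_ge0//.
    have h : forall l : 'I_L, 0 <= 2 * Num.sqrt (lam l * c) * `|G l w|.
      by move=> l; rewrite !mulr_ge0// sqrtr_ge0.
    apply: (le_trans (expR_sum_le h)); rewrite lerD2l card_ord.
    by apply: ler_sum => l _; rewrite !mulrA.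
rewrite ge0_integralZl//; last 2 first.
- exact: emeasurable_funD.
- by move=> w _; rewrite adde_ge0// sume_ge0// => l _; rewrite lee_fin expR_ge0.
rewrite EFinM lee_wpmul2l ?lee_fin ?expR_ge0//.
rewrite ge0_integralD//; last by move=> w _; apply: sume_ge0 => l _; rewrite lee_fin expR_ge0.
rewrite integral_cst//= probability_setT mule1 EFinD leeD2l//.
rewrite ge0_integral_sum//.
rewrite -sumEFin; apply: lee_sum => l _.
exact: (gaussian_abs_exp _ (scalar_noise_law hSG l)).
Qed.

Section bounded_parameter.
Variables (q : 'I_L -> R) (c : R).
Hypothesis q0 : forall l, 0 <= q l.
Hypothesis qc : forall l, q l <= c.

Lemma sqr_layer_field l a : beta q l a ^+ 2 = lam l * q l.
Proof. by rewrite /layer_field exprMn sqr_sqrtr ?mulr_ge0// spin_sqr mulr1. Qed.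

Lemma scalar_exponent_le w x y :
  `|cov (beta q) (enum 'I_L) x y + noise_ q w x| <= scalar_bound c w.
Proof.
rewrite /cov /noise -big_split/= big_enum/=.
apply: (le_trans (ler_norm_sum _ _ _)); apply: ler_sum => l _.
have k0 : 0 <= lam l * q l by rewrite mulr_ge0.
have kc : lam l * q l <= lam l * c by rewrite ler_wpM2l.
apply: (le_trans (ler_normD _ _)).
have -> : 2 * (lam l * c) + Num.sqrt (lam l * c) * `|G l w| =
   lam l * c + (Num.sqrt (lam l * c) * `|G l w| + lam l * c) by ring.
apply: lerD.
  rewrite /layer_field !normrM !norm_spin !mulr1 -normrM -expr2 sqr_sqrtr//.
  by rewrite ger0_norm.
apply: (le_trans (ler_normB _ _)); apply: lerD.
  rewrite normrM /layer_field normrM norm_spin mulr1 ger0_norm ?sqrtr_ge0//.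
  by rewrite ler_wpM2r// ler_wsqrtr.
rewrite sqr_layer_field ger0_norm; last by rewrite divr_ge0.
by apply: le_trans kc; rewrite ler_pdivrMr//; lra.
Qed.

Lemma zscalar_between w : `|log_zscalar q w| <= scalar_bound c w /\ 0 < zscalar q w.
Proof.
apply: wsum_between => [x||x]; first exact: (pX_ge0 hpc).
  exact: (pX_sum1 hpc).
exact: scalar_exponent_le.
Qed.

Lemma measurable_log_zscalar : measurable_fun setT (log_zscalar q).
Proof. exact: (measurableT_comp (@measurable_ln R) (measurable_zscalar q)). Qed.

(** Positivity of [zscalar] turns the exponential of [s] times its logarithm into a power; the
    Nishimori identity then removes the signal and raises the order by 1. *)
Lemma scalar_moment s : 1 + s != 0 ->
  (\int[P]_w (expR (s * log_zscalar q w))%:E = alpha p pc lam q (1 + s)%R)%E.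
Proof.
move=> s1.
have axs (f : A -> R) : adapted F J (fun w => f (S w).1.1).
  exact: (measurableT_comp (measurable_fun_spins f) aS).
have av x : adapted F J (fun w => pX pc (S w).2 x).
  exact: (measurableT_comp (measurable_pX2 hpc x) aS).
transitivity (\int[P]_w powsum s (pX pc (S w).2)
   (fun x => cov (beta q) (enum 'I_L) x (S w).1.1 + noise_ q w x)%R)%E.
  apply: eq_integral => w _; rewrite /powsum; congr (_%:E).
  have [_ z0] := zscalar_between w.
  by rewrite -/(zscalar q w) /powR gt_eqF.
rewrite (planted_link (scalar_independent hSG) FT Fm FI (beta q) uks ksJ FW lW
  (xs := fun w => (S w).1.1) axs av s (cov (beta q) (enum 'I_L))).
rewrite -(nishimori_sample hpc lam q s1).
pose f (t : sample) := gops (beta q) 1 (enum 'I_L) (powsum s (pX pc t.2))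
  (fun x => cov (beta q) (enum 'I_L) x t.1.1).
have mf : measurable_fun setT f.
  apply: measurable_gops_powsum => x; first exact: (measurable_pX2 hpc).
  exact: measurable_fun_spins.
rewrite -[LHS]/(\int[P]_w (f \o S) w)%E -ge0_integral_distribution//; last first.
  by move=> t; exact: gops_powsum_ge0.
by apply: eq_measure_integral => B mB _; exact: (scalar_sample_law hSG).
Qed.

End bounded_parameter.
End scalar_model.

(** * Scalar and spiked potentials *)

Section scalar_potential.
Context (R : realType) (L L1 : nat) (dZ : measure_display) (Zs : measurableType dZ).
Local Notation sample := (L.-tuple bool * L1.-tuple bool * Zs)%type.
Local Notation A := (L.-tuple bool).
Context (p : probability sample R) (pc : Zs -> A -> L1.-tuple bool -> R).
Hypothesis hpc : is_cond_pmf p pc.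
Context (lam : 'I_L -> R).
Hypothesis lam0 : forall l, 0 <= lam l.
Context d (Omega : measurableType d) (P : probability Omega R).
Context (S : {RV P >-> sample}) (G : 'I_L -> {RV P >-> R}).
Hypothesis hSG : is_scalar_model p S G.
Local Notation beta q := (layer_field lam q).
Local Notation noise_ q := (noise (fun l => G l : Omega -> R) (beta q) (enum 'I_L)).

(** For nonnegative [q], the scalar free energy minus half the sum of lam q, which is the sum of the
    terms b^2 / 2 built into [noise]. *)
Definition psi q : R := fine (\int[P]_w (log_zscalar pc lam S G q w)%:E)%E.

Lemma le_sum_coordinates (q : 'I_L -> R) l : (forall l, 0 <= q l) -> q l <= \sum_l q l.
Proof. by move=> q0; rewrite (bigD1 l)//= lerDl sumr_ge0. Qed.

Section nonnegative.
Variable q : 'I_L -> R.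
Hypothesis q0 : forall l, 0 <= q l.

Lemma integrable_log_zscalar :
  P.-integrable setT (EFin \o log_zscalar pc lam S G q).
Proof.
have qc l := le_sum_coordinates l q0.
have c0 : 0 <= \sum_l q l by exact: sumr_ge0.
apply: (@integrable_of_exp _ _ _ _ _ (scalar_bound lam G (\sum_l q l)) 2) => //.
- exact: (measurable_log_zscalar hpc).
- exact: measurable_scalar_bound.
- by move=> w; have [] := zscalar_between hpc lam0 S G q0 qc w.
- by apply: le_lt_trans (scalar_bound_exp lam hSG c0) _; rewrite ltry.
Qed.

Lemma psiE : (\int[P]_w (log_zscalar pc lam S G q w)%:E = (psi q)%:E)%E.
Proof. by rewrite fineK//; apply: integrable_fin_num integrable_log_zscalar. Qed.

(** Combines [exp_moment_le] with 1 + z <= e^z; it is applied at order t for the upper bound and at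
    - t for the lower bound. *)
Lemma alpha_le (c s : R) : (forall l, q l <= c) -> 0 <= c -> `|s| <= 1 -> 1 + s != 0 ->
  (alpha p pc lam q (1 + s)%R <=
   (expR (s * psi q + 2 * s ^+ 2 * scalar_moment_bound lam c))%:E)%E.
Proof.
move=> qc c0 s1 s1'.
rewrite -(scalar_moment hpc lam0 hSG q0 qc s1').
apply: (@le_trans _ _ (1 + s * psi q + 2 * s ^+ 2 * scalar_moment_bound lam c)%:E).
  rewrite !EFinD EFinM -psiE; apply: (@exp_moment_le _ _ _ _ _ (scalar_bound lam G c)) => //.
  - exact: (measurable_log_zscalar hpc).
  - exact: measurable_scalar_bound.
  - by move=> w; have [] := zscalar_between hpc lam0 S G q0 qc w.
  - exact: (scalar_bound_exp lam hSG c0).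
by rewrite lee_fin -addrA expR_ge1Dx.
Qed.

Lemma scalar_free_energyE :
  (scalar_free_energy pc S G lam q = (psi q + (\sum_l lam l * q l) / 2)%:E)%E.
Proof.
rewrite /scalar_free_energy unlock.
transitivity (\int[P]_w ((log_zscalar pc lam S G q w)%:E + ((\sum_l lam l * q l) / 2)%:E))%E.
  apply: eq_integral => w _; rewrite -EFinD; congr (_%:E).
  have [_ z0] := zscalar_between hpc lam0 S G q0 (fun l => le_sum_coordinates l q0) w.
  rewrite -[X in _ = _ + X]expRK -lnM ?posrE ?expR_gt0//; congr (ln _).
  rewrite /zscalar /wsum mulr_suml; apply: eq_bigr => x _.
  rewrite -mulr_suml -/(pX pc (S w).2 x) -mulrA -expRD; congr (_ * expR _).
  rewrite /cov /noise !big_enum/= -big_split/= mulr_suml -big_split/=.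
  apply: eq_bigr => l _.
  have k0 : 0 <= lam l * q l by rewrite mulr_ge0.
  rewrite (sqr_layer_field lam0 q0) /layer_field.
  have -> : lam l * q l * spin R (S w).1.1 l * spin R x l =
    Num.sqrt (lam l * q l) ^+ 2 * spin R (S w).1.1 l * spin R x l by rewrite sqr_sqrtr.
  by ring.
rewrite integralD//; first by rewrite psiE integral_cst//= probability_setT mule1.
  exact: integrable_log_zscalar.
exact: finite_measure_integrable_cst.
Qed.

End nonnegative.
End scalar_potential.

Section spiked_potential.
Context (R : realType) (L L1 : nat) (dZ : measure_display) (Zs : measurableType dZ).
Local Notation sample := (L.-tuple bool * L1.-tuple bool * Zs)%type.
Local Notation A := (L.-tuple bool).
Context (p : probability sample R) (pc : Zs -> A -> L1.-tuple bool -> R).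
Hypothesis hpc : is_cond_pmf p pc.
Context (lam : 'I_L -> R).
Hypothesis lam0 : forall l, 0 <= lam l.
Context d (Omega : measurableType d) (P : probability Omega R) (n : nat).
Context (S : 'I_n -> {RV P >-> sample}) (W : 'I_L -> 'I_n -> 'I_n -> {RV P >-> R}).
Hypothesis hSW : is_spiked_model p S W.
Hypothesis n0 : (0 < n)%N.
Local Notation cfg := {ffun 'I_n -> A}.
Local Notation K := ('I_L * ('I_n * 'I_n))%type.
Local Notation wts w := (weights pc (fun i => (S i w).2)).
Local Notation field := (pair_field lam (n := n)).
Local Notation noise_ := (noise (fun k : K => W k.1 k.2.1 k.2.2) field (pairs L n)).
Local Notation Zt := (Ztilde pc lam S W).

Lemma sum_weights z : \sum_x weights pc (n := n) z x = 1.
Proof.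
rewrite /weights -(bigA_distr_bigA (fun i a => pX pc (z i) a)) big1// => i _.
exact: (pX_sum1 hpc).
Qed.

Lemma half_cov_diag (x : cfg) :
  cov field (pairs L n) x x / 2 = (\sum_l lam l) * (n%:R - 1) / 4.
Proof.
have n0' : (n%:R : R) != 0 by rewrite pnatr_eq0 -lt0n.
rewrite cov_pairs// !mulr_suml; apply: eq_bigr => l _.
have -> : overlap R l x x = n%:R.
  rewrite /overlap; under eq_bigr do rewrite -expr2 spin_sqr.
  by rewrite sumr_const card_ord.
by field.
Qed.

(** [noise] contains the terms - b^2 / 2 that the Hamiltonian lacks. Their sum is half the variance
    of the field, which is the same for all configurations since spins square to 1. *)
Lemma hamiltonianE w (x : cfg) :
  hamiltonian lam (observation lam S W w) x =
  (\sum_l lam l) * (n%:R - 1) / 4 + (cov field (pairs L n) x (planted S w) + noise_ w x).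
Proof.
rewrite -(half_cov_diag x) /cov /noise -big_split/= mulr_suml -big_split/= sum_pairs.
apply: eq_bigr => l _; apply: eq_bigr => i _; apply: eq_bigr => j _.
rewrite /observation /pair_field /planted/= !mxE !ffunE big_ord1 !mxE; ring.
Qed.

Lemma partition_functionE w :
  partition_function pc lam (observation lam S W w) (fun i => (S i w).2) =
  expR ((\sum_l lam l) * (n%:R - 1) / 4) * Zt w.
Proof.
rewrite /partition_function /Ztilde /wsum mulr_sumr; apply: eq_bigr => x _.
rewrite -mulr_suml -(bigA_distr_bigA (fun i b => pc (S i w).2 (x i) b)).
by rewrite hamiltonianE [in RHS]mulrCA -expRD.
Qed.

(** It grows with [n], which is harmless: it only ensures the positivity of [Zt] and the
    integrability of its logarithm. *)
Definition field_bound w : R :=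
  \sum_(k <- pairs L n) (2 * (lam k.1 / n%:R) + Num.sqrt (lam k.1 / n%:R) * `|W k.1 k.2.1 k.2.2 w|).

Lemma Ztilde_between w : `|ln (Zt w)| <= field_bound w /\ 0 < Zt w.
Proof.
apply: wsum_between => [x||x]; first exact: (weights_ge0 hpc).
  exact: sum_weights.
rewrite /cov /noise -big_split/=.
apply: (le_trans (ler_norm_sum _ _ _)); apply: ler_sum => k _.
have k0 : 0 <= lam k.1 / n%:R by rewrite divr_ge0.
have nf y : `|field k y| = Num.sqrt (lam k.1 / n%:R).
  by rewrite /pair_field !normrM !norm_spin !mulr1 ger0_norm ?sqrtr_ge0.
apply: (le_trans (ler_normD _ _)).
have -> : forall s : R, 2 * (lam k.1 / n%:R) + s = lam k.1 / n%:R + (s + lam k.1 / n%:R) by move=> s; ring.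
apply: lerD; first by rewrite normrM !nf -expr2 sqr_sqrtr.
apply: (le_trans (ler_normB _ _)); apply: lerD; first by rewrite normrM nf.
rewrite normrM normrX nf sqr_sqrtr// ger0_norm ?invr_ge0//.
by rewrite ler_pdivrMr//; lra.
Qed.

Lemma measurable_Ztilde : measurable_fun setT Zt.
Proof.
apply: measurable_sum => x; apply: measurable_funM; first exact: (mwts hpc).
apply: measurableT_comp => //; apply: measurable_funD.
  apply: (@measurable_fun_ffun R L n _ Omega (fun i w => (S i w).1.1)
    (fun y => cov field (pairs L n) x y)) => i.
  exact: (measurableT_comp measurable_fst (measurableT_comp measurable_fst _)).
apply: measurable_sum => k; apply: measurable_funB => //.
exact: measurable_funM.
Qed.

Lemma integrable_abs_noise l (i j : 'I_n) : (i < j)%N ->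
  P.-integrable setT (fun w => `|W l i j w|%:E).
Proof.
move=> ij; have mW : measurable_fun setT (fun w => `|W l i j w|).
  exact: measurableT_comp.
apply: (@integrable_of_exp _ _ _ _ _ (fun w => `|W l i j w|) 1) => //.
  by move=> w; rewrite normr_id.
have lW := spiked_noise_law hSW l (ltnW ij).
have ij' : (i == j) = false by apply/negbTE/eqP => e; rewrite e ltnn in ij.
rewrite ij' addr0 sqrtr1 in lW.
by apply: le_lt_trans (gaussian_abs_exp 1 lW) _; rewrite ltry.
Qed.

Lemma integrable_log_Ztilde : P.-integrable setT (fun w => (ln (Zt w))%:E).
Proof.
have mB : measurable_fun setT (fun w => ln (Zt w)).
  exact: (measurableT_comp (@measurable_ln R) measurable_Ztilde).
apply: (@le_integrable _ _ _ _ _ measurableT _ (fun w => (field_bound w)%:E)) => //.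
- exact/measurable_EFinP.
- move=> w _ /=; rewrite lee_fin; have [h _] := Ztilde_between w.
  by rewrite (le_trans h)// ler_norm.
rewrite (_ : (fun w => _) = (fun w => \sum_(k <- pairs L n | (k.2.1 < k.2.2)%N)
   (2 * (lam k.1 / n%:R) + Num.sqrt (lam k.1 / n%:R) * `|W k.1 k.2.1 k.2.2 w|)%:E)%E); last first.
  apply/funext => w; rewrite sumEFin /field_bound /pairs !big_filter.
  by rewrite big_filter_cond; congr (_%:E); apply: eq_bigl => k; rewrite andbb.
apply: integrable_sum => // k kk; under eq_fun do rewrite EFinD.
apply: integrableD => //; first exact: finite_measure_integrable_cst.
exact: (integrableZl measurableT (Num.sqrt (lam k.1 / n%:R)) (integrable_abs_noise k.1 kk)).
Qed.

End spiked_potential.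

Lemma prode_const_le (R : realType) (n : nat) (x : \bar R) (e : R) :
  (0 <= x)%E -> (x <= (expR e)%:E)%E ->
  (\prod_(i < n) x <= (expR (n%:R * e))%:E)%E.
Proof.
move=> x0 xe; elim: n => [|n IH]; first by rewrite big_ord0 mul0r expR0.
rewrite big_ord_recl (_ : n.+1%:R * e = e + n%:R * e); last first.
  by rewrite -natr1; ring.
rewrite expRD EFinM; apply: lee_pmul => //.
by elim/big_ind : _ => // y z y0 z0; exact: mule_ge0.
Qed.

Lemma le_of_slope (R : realFieldType) (a b c : R) :
  (forall t, 0 < t < 1 -> a <= b + t * c) -> a <= b.
Proof.
move=> h; rewrite leNgt; apply/negP => ba.
have c1 : 0 < 1 + `|c| + (a - b).
  by rewrite addr_gt0 ?subr_gt0// (@lt_le_trans _ _ 1)// lerDl.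
(* Chosen so that t c is at most half of a - b. *)
set t := (a - b) / (2 * (1 + `|c| + (a - b))).
have t0 : 0 < t by rewrite divr_gt0 ?subr_gt0// mulr_gt0.
have t1 : t < 1.
  rewrite ltr_pdivrMr ?mulr_gt0// mul1r.
  have := normr_ge0 c; lra.
have := h t; rewrite t0 t1 => /(_ isT).
have : t * c <= t * (1 + `|c| + (a - b)).
  by rewrite ler_pM2l//; have := ler_norm c; lra.
have -> : t * (1 + `|c| + (a - b)) = (a - b) / 2.
  by rewrite /t; field; rewrite gt_eqF.
lra.
Qed.

(** * Two-sided bounds on the mean logarithm *)

Section free_energy_bounds.
Context (R : realType) (L L1 : nat) (dZ : measure_display) (Zs : measurableType dZ).
Local Notation sample := (L.-tuple bool * L1.-tuple bool * Zs)%type.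
Local Notation A := (L.-tuple bool).
Context (p : probability sample R) (pc : Zs -> A -> L1.-tuple bool -> R).
Hypothesis hpc : is_cond_pmf p pc.
Context (lam : 'I_L -> R).
Hypothesis lam0 : forall l, 0 <= lam l.
Context d (Omega : measurableType d) (P : probability Omega R) (n : nat).
Context (S : 'I_n -> {RV P >-> sample}) (W : 'I_L -> 'I_n -> 'I_n -> {RV P >-> R}).
Hypothesis hSW : is_spiked_model p S W.
Hypothesis n0 : (0 < n)%N.
Context d' (Omega0 : measurableType d') (P0 : probability Omega0 R).
Context (S0 : {RV P0 >-> sample}) (G : 'I_L -> {RV P0 >-> R}).
Hypothesis hSG : is_scalar_model p S0 G.
Local Notation Zt := (Ztilde pc lam S W).
Local Notation comp r := (compensator n lam r).
Local Notation psi_ := (psi pc lam S0 G).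

Definition mean_log : R := fine (\int[P]_w (ln (Zt w))%:E)%E.

Lemma mean_logE : (\int[P]_w (ln (Zt w))%:E = mean_log%:E)%E.
Proof. by rewrite fineK//; apply: integrable_fin_num (integrable_log_Ztilde hpc lam0 hSW). Qed.

Lemma free_energyE :
  free_energy pc S W lam =
  (n%:R^-1 * ((\sum_l lam l) * (n%:R - 1) / 4 + mean_log))%:E.
Proof.
rewrite /free_energy unlock EFinM; congr (_ * _)%E.
rewrite EFinD -mean_logE.
transitivity (\int[P]_w (((\sum_l lam l) * (n%:R - 1) / 4)%:E + (ln (Zt w))%:E))%E.
  apply: eq_integral => w _.
  have [_ z0] := Ztilde_between hpc lam0 S W w.
  by rewrite partition_functionE// lnM ?posrE ?expR_gt0// expRK EFinD.
rewrite integralD//; first by rewrite integral_cst//= probability_setT mule1.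
  exact: finite_measure_integrable_cst.
exact: (integrable_log_Ztilde hpc lam0 hSW).
Qed.

Lemma moment_mean_log (s c : R) : 0 < c -> (\int[P]_w (Zt w `^ s)%:E <= c%:E)%E ->
  s * mean_log <= ln c.
Proof.
move=> c0 h; rewrite -lee_fin EFinM -mean_logE.
apply: (@log_moment_le _ _ _ _ (fun w => ln (Zt w))) => //.
  exact: (integrable_log_Ztilde hpc lam0 hSW).
apply: le_trans h; rewrite le_eqVlt; apply/orP; left; apply/eqP.
apply: eq_integral => w _; have [_ z0] := Ztilde_between hpc lam0 S W w.
by rewrite /powR gt_eqF.
Qed.

Lemma mean_log_ge (r : 'I_L -> R) : (forall l, 0 <= r l) ->
  n%:R * psi_ r - comp r / 2 <= mean_log.
Proof.
move=> r0; set c := \sum_l r l; set M := scalar_moment_bound lam c.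
have rc l := le_sum_coordinates l r0 : r l <= c.
have c0 : 0 <= c by exact: sumr_ge0.
(* Here [n] is fixed and [t] tends to 0, so the lower bound keeps no error from the second-order
   expansion. *)
apply: (@le_of_slope _ _ _ (n%:R * (2 * M))) => t t01.
have /andP[t0 t1] := t01.
have nt : `|- t| <= 1 by rewrite normrN gtr0_norm// ltW.
have nt1 : 1 + - t != 0 by rewrite gt_eqF//; lra.
have al := alpha_le hpc lam0 hSG r0 rc c0 nt nt1.
have cr := compensator_ge0 n lam0 r.
set e := t * (1 - t) * comp r / 2 + n%:R * (- t * psi_ r + 2 * (- t) ^+ 2 * M).
have h : (\int[P]_w (Zt w `^ (- t))%:E <= (expR e)%:E)%E.
  apply: (le_trans (lower_moment hpc lam0 hSW n0 t01 r0)).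
  rewrite expRD EFinM lee_wpmul2l ?lee_fin ?expR_ge0//.
  apply: prode_const_le al; exact: alpha_ge0.
have := moment_mean_log (expR_gt0 e) h; rewrite expRK /e => {}h.
have h1 : t * (n%:R * psi_ r - (1 - t) * (comp r / 2)) <= t * (mean_log + t * (n%:R * (2 * M))).
  rewrite -subr_ge0; move: h; rewrite -subr_ge0; congr (0 <= _); ring.
rewrite ler_pM2l// in h1; apply: le_trans h1; nra.
Qed.

(** The (n + 1)^L grid points contribute [L%:R * ln n.+1%:R / t], and the second-order remainder of
    [alpha_le] contributes a multiple of n t; [t] stays free so that the two can be balanced. *)
Lemma mean_log_le (Phi t : R) : 0 < t < 1 ->
  (forall r : 'I_L -> R, (forall l, 0 <= r l) -> psi_ r - \sum_l lam l * r l ^+ 2 / 4 <= Phi) ->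
  mean_log <= L%:R * ln n.+1%:R / t + n%:R * (Phi + 2 * t * scalar_moment_bound lam 1).
Proof.
move=> t01 hPhi; have /andP[t0 t1] := t01; set M := scalar_moment_bound lam 1.
have nt : `|t| <= 1 by rewrite gtr0_norm// ltW.
have nt1 : 1 + t != 0 by rewrite gt_eqF//; lra.
set e := n%:R * (t * Phi + 2 * t ^+ 2 * M).
have h : (\int[P]_w (Zt w `^ t)%:E <= ((n.+1 ^ L)%:R * expR e)%:E)%E.
  apply: (le_trans (upper_moment hpc lam0 hSW n0 t01)).
  apply: (@le_trans _ _ (\sum_(m : {ffun 'I_L -> 'I_n.+1}) (expR e)%:E)%E); last first.
    by rewrite sumEFin sumr_const card_ffun !card_ord mulr_natl.
  apply: lee_sum => m _; set r : 'I_L -> R := fun l => `|mag R m l|.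
  have r0 l : 0 <= r l by exact: normr_ge0.
  have r1 l : r l <= 1 by exact: mag_le1.
  have al := alpha_le hpc lam0 hSG r0 r1 ler01 nt nt1.
  have := prode_const_le n (alpha_ge0 _ _ _ _ _) al.
  move=> /(@lee_wpmul2l _ (expR (- (t * comp (mag R m) / 2)))%:E) => h.
  apply: (le_trans (h _)); first by rewrite lee_fin expR_ge0.
  rewrite -EFinM lee_fin -expRD ler_expR /e.
  have hr := hPhi r r0.
  have hc : n%:R * (\sum_l lam l * r l ^+ 2 / 4) <= comp (mag R m) / 2.
    rewrite mulr_sumr /compensator mulr_suml; apply: ler_sum => l _.
    rewrite /r real_normK ?num_real//.
    have := lam0 l; lra.
  have n1 : 0 < (n%:R : R) by rewrite ltr0n.
  have h2 : n%:R * psi_ r - comp (mag R m) / 2 <= n%:R * Phi.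
    by move: hr; rewrite -(ler_pM2l n1) mulrBr => hr; lra.
  have h3 := ler_wpM2l (ltW t0) h2.
  rewrite -subr_ge0; move: h3; rewrite -subr_ge0; congr (0 <= _); rewrite -/M; ring.
have N0 : 0 < ((n.+1 ^ L)%:R : R) by rewrite ltr0n expn_gt0.
have := moment_mean_log (mulr_gt0 N0 (expR_gt0 e)) h.
rewrite lnM ?posrE ?expR_gt0// expRK natrX lnXn ?ltr0n// -mulr_natl => {}h.
rewrite -(ler_pM2l t0); apply: (le_trans h); rewrite /e le_eqVlt; apply/orP; left; apply/eqP.
by field; rewrite gt_eqF.
Qed.

End free_energy_bounds.

(** * The limit *)

(** With [s] the fourth root of n + 1, the estimates become polynomial algebra in [s]; taking n + 1
    gives s > 1 for positive [n]. *)
Lemma cvg_root4_rate (R : realType) (u : nat -> R) (l C : R) : 0 <= C ->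
  (forall n s, (0 < n)%N -> 1 < s -> s ^+ 4 = n.+1%:R -> `|l - u n| <= C / s) ->
  u n @[n --> \oo] --> l.
Proof.
move=> C0 h; apply/cvgrPdist_le => e e0; near=> n.
set s : R := Num.sqrt (Num.sqrt n.+1%:R).
have n0 : (0 < n)%N by near: n; exact: nbhs_infty_gt.
have s1 : 1 < s.
  rewrite -[X in X < _]sqrtr1 ltr_sqrt ?sqrtr_gt0// -[X in X < _]sqrtr1 ltr_sqrt//.
  by rewrite ltr1n ltnS.
have s4 : s ^+ 4 = n.+1%:R.
  by rewrite (_ : 4 = 2 * 2)%N// exprM sqr_sqrtr ?sqrtr_ge0// sqr_sqrtr.
apply: (le_trans (h n s n0 s1 s4)).
have s0 : 0 < s by lra.
rewrite ler_pdivrMr// mulrC -ler_pdivrMr//.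
have Ce : 0 <= C / e by rewrite divr_ge0// ltW.
rewrite -(@ler_pXn2r _ 4)// ?nnegrE ?(ltW s0)// s4.
apply: (@le_trans _ _ n%:R); last by rewrite ler_nat.
by near: n; exact: nbhs_infty_ger.
Unshelve. all: by end_near. Qed.

Theorem proposition1p1 (R : realType) (L L1 : nat) (hL : (1 <= L)%N)
    (dZ : measure_display) (Zs : measurableType dZ)
    (p : probability (L.-tuple bool * L1.-tuple bool * Zs)%type R)
    (hp : uniform_coordinates p)
    (pc : Zs -> L.-tuple bool -> L1.-tuple bool -> R)
    (hpc : is_cond_pmf p pc)
    (d : nat -> measure_display) (Omega : forall n, measurableType (d n))
    (P : forall n, probability (Omega n) R)
    (S : forall n,
       'I_n -> {RV (P n) >-> (L.-tuple bool * L1.-tuple bool * Zs)%type})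
    (W : forall n, 'I_L -> 'I_n -> 'I_n -> {RV (P n) >-> R})
    (hSW : forall n, is_spiked_model p (S n) (W n))
    (d0 : measure_display) (Omega0 : measurableType d0)
    (P0 : probability Omega0 R)
    (S0 : {RV P0 >-> (L.-tuple bool * L1.-tuple bool * Zs)%type})
    (G : 'I_L -> {RV P0 >-> R})
    (hSG : is_scalar_model p S0 G)
    (lam : 'I_L -> R) (hlam : forall l, 0 <= lam l) :
  free_energy pc (S n) (W n) lam @[n --> \oo] -->
    (((\sum_(l < L) lam l) / 4)%R%:E
     + ereal_sup
         [set scalar_free_energy pc S0 G lam q
              - (\sum_(l < L) lam l * (q l ^+ 2 + 2 * q l) / 4)%R%:E
         | q in [set q : 'I_L -> R | forall l, (0 <= q l)%R]])%E.
Proof.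
set Q := [set q : 'I_L -> R | forall l, (0 <= q l)%R].
set Lam := \sum_(l < L) lam l.
(* By [scalar_free_energyE] the free energy contributes half the sum of lam q, which cancels the
   linear part of the penalty and leaves the quadratic one. *)
pose f (q : 'I_L -> R) : R := psi pc lam S0 G q - \sum_l lam l * q l ^+ 2 / 4.
pose E n := mean_log pc lam (S n) (W n).
have Lam0 : 0 <= Lam by exact: sumr_ge0.
have lower q n : (0 < n)%N -> Q q -> n%:R * f q - Lam / 4 <= E n.
  move=> n0 q0; apply: le_trans (mean_log_ge hpc hlam (hSW n) n0 hSG q0).
  rewrite le_eqVlt; apply/orP; left; apply/eqP.
  rewrite /f mulrBr /compensator -addrA; congr (_ + _).
  rewrite -opprD mulr_sumr !mulr_suml -big_split/=; congr (- _).
  by apply: eq_bigr => l _; field.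
(* The lower bound at n = 1 already bounds the potential uniformly in [q], since [E 1%N] is a real
   number; so the supremum is finite. *)
have ubV : has_ubound (f @` Q).
  exists (E 1%N + Lam / 4) => _ [q q0 <-].
  by have := lower q 1%N isT q0; lra.
have neV : (f @` Q) !=set0 by exists (f (fun=> 0)); exists (fun=> 0) => //= l.
set Phi := sup (f @` Q).
have fPhi q : Q q -> f q <= Phi by move=> q0; apply: (ub_le_sup ubV); exists q.
have -> : (ereal_sup [set scalar_free_energy pc S0 G lam q
    - (\sum_(l < L) lam l * (q l ^+ 2 + 2 * q l) / 4)%R%:E | q in Q] = Phi%:E)%E.
  rewrite -ereal_sup_EFin//; congr ereal_sup; apply/seteqP.
  have fE q : Q q -> (scalar_free_energy pc S0 G lam q
      - (\sum_(l < L) lam l * (q l ^+ 2 + 2 * q l) / 4)%R%:E)%E = (f q)%:E.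
    move=> q0; rewrite (scalar_free_energyE hpc hlam hSG q0) -EFinB; congr (_%:E).
    rewrite /f -addrA; congr (_ + _).
    by rewrite mulr_suml -sumrB -sumrN; apply: eq_bigr => l _; field.
  split=> [_ [q hq <-]|_ [_ [q hq <-] <-]].
    by exists (f q); [exists q|rewrite fE].
  by exists q => //; rewrite fE.
have uE n : (0 < n)%N -> free_energy pc (S n) (W n) lam =
    (n%:R^-1 * (Lam * (n%:R - 1) / 4 + E n))%:E.
  by move=> n0; exact: (free_energyE hpc hlam (hSW n) n0).
rewrite -EFinD; apply: cvg_EFin.
  by near=> n; rewrite uE//; near: n; exact: nbhs_infty_gt.
set M := scalar_moment_bound lam 1.
have M0 : 0 <= M by exact: scalar_moment_bound_ge0.
apply: (@cvg_root4_rate _ _ _ (8 * L%:R + 2 * M + Lam)) => [|n s n0 s1 s4].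
  by rewrite !addr_ge0// mulr_ge0.
have s0 : 0 < s by lra.
have n1 : 1 <= (n%:R : R) by rewrite ler1n.
have N0 : 0 < (n%:R : R) by lra.
have s4n : s ^+ 4 <= 2 * n%:R by rewrite s4 -natr1; lra.
rewrite /=; set u := fine (free_energy pc (S n) (W n) lam).
have Eu : n%:R * u = Lam * (n%:R - 1) / 4 + E n.
  by rewrite /u uE//= mulrA divff ?mul1r// gt_eqF.
have s0' : 0 < s^-1 by rewrite invr_gt0.
have sV : s^-1 < 1 by rewrite invf_lt1.
have ln4 : ln n.+1%:R <= 4 * s.
  rewrite -s4 lnXn// -[ln s *+ 4]mulr_natl ler_wpM2l//; exact/ltW/ln_sublinear.
(* Moments of order [s^-1 = (n + 1)^(-1/4)] balance both error terms. *)
have up : u <= Lam / 4 + Phi + (8 * L%:R + 2 * M + Lam) / s.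
  have := mean_log_le hpc hlam (hSW n) n0 hSG (Phi := Phi) (t := s^-1).
  rewrite s0' sV -/(E n) -/M invrK => /(_ isT fPhi) h.
  rewrite -(ler_pM2l N0) Eu.
  (* By [ln4] the left-hand side is at most 4 L s^2, and s^3 <= s^4 = n + 1 <= 2 n. *)
  have h1 : L%:R * ln n.+1%:R * s <= n%:R * (8 * L%:R / s).
    apply: (@le_trans _ _ (L%:R * (4 * s) * s)).
      by rewrite ler_wpM2r ?(ltW s0)// ler_wpM2l.
    rewrite [leRHS]mulrA ler_pdivlMr//.
    have s34 : s ^+ 3 <= s ^+ 4 by rewrite ler_eXn2l.
    have L0 : 0 <= (4 * L%:R : R) by rewrite mulr_ge0.
    have -> : L%:R * (4 * s) * s * s = 4 * L%:R * s ^+ 3 by ring.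
    have -> : n%:R * (8 * L%:R) = 4 * L%:R * (2 * n%:R) :> R by ring.
    by rewrite ler_wpM2l// (le_trans s34).
  have h2 : 0 <= n%:R * (Lam / s) by rewrite mulr_ge0 ?divr_ge0// ltW.
  have : Lam * (n%:R - 1) / 4 <= n%:R * (Lam / 4) by lra.
  have -> : n%:R * (Lam / 4 + Phi + (8 * L%:R + 2 * M + Lam) / s) =
    n%:R * (Lam / 4) + n%:R * (8 * L%:R / s) + n%:R * (Phi + 2 * s^-1 * M) + n%:R * (Lam / s).
    by field; rewrite gt_eqF.
  lra.
have lo : Lam / 4 + Phi - (8 * L%:R + 2 * M + Lam) / s <= u.
  have h : Phi <= (E n + Lam / 4) / n%:R.
    apply: ge_sup => // _ [q q0 <-]; rewrite ler_pdivlMr//.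
    by have := lower q n n0 q0; lra.
  move: h; rewrite ler_pdivlMr// => h.
  rewrite -(ler_pM2l N0) Eu.
  (* The total loss is Lam / 2: a quarter of Lam from the 1 in the compensators and a quarter from
     the n - 1 of the deterministic factor. It is absorbed since s <= s^4 <= 2 n. *)
  have h1 : Lam / 2 <= n%:R * (Lam / s).
    have s14 : s ^+ 1 <= s ^+ 4 by rewrite ler_eXn2l.
    rewrite [leRHS]mulrA ler_pdivlMr// -[leRHS]mulrC -mulrA ler_wpM2l//.
    by move: s14; rewrite expr1; lra.
  have h2 : 0 <= n%:R * ((8 * L%:R + 2 * M) / s).
    by rewrite mulr_ge0// divr_ge0 ?(ltW s0)// addr_ge0// mulr_ge0.
  have -> : n%:R * (Lam / 4 + Phi - (8 * L%:R + 2 * M + Lam) / s) =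
    n%:R * (Lam / 4) + Phi * n%:R - n%:R * ((8 * L%:R + 2 * M) / s) - n%:R * (Lam / s).
    by field; rewrite gt_eqF.
  lra.
by rewrite ler_distl; apply/andP; split; lra.
Unshelve. all: by end_near. Qed.
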